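(* Let $(X,\mathcal{F},\mu_0)$, together with the corresponding map $F:X\to\mathcal{A}(D)$, be any one of the three priors (log-Gaussian, star-shaped, level set) described in the context, let $\mathcal{G}:X\to Y=\mathbb{R}^{JL}$ be the corresponding forward map and let $\Phi(u;y)=\tfrac12|\mathcal{G}(u)-y|_\Gamma^2$. Suppose $u\sim\mu_0$ and $y=\mathcal{G}(u)+\eta$ with $\eta\sim\mathbb{Q}_0=N(0,\Gamma)$ independent of $u$. Then the posterior distribution $\mu^y$ of the state $u$ given data $y$ (i.e. the conditional distribution of $u|y$) is well-defined. Furthermore, $\mu^y\ll\mu_0$ with Radon–Nikodym derivative $$\frac{\mathrm{d}\mu^y}{\mathrm{d}\mu_0}(u)=\frac{1}{Z_\mu}\exp(-\Phi(u;y)),$$ where, for $y$ $\mathbb{Q}_0$-almost surely, $$Z_\mu:=\int_X\exp(-\Phi(u;y))\,\mu_0(\mathrm{d}u)>0.$$ Additionally, the posterior measure $\mu^y$ is locally Lipschitz with respect to $y$ in the Hellinger distance: for every $\rho>0$ there exists $C=C(\rho)>0$ such that for all $y,y'\in Y$ with $\max\{|y|_\Gamma,|y'|_\Gamma\}<\rho$, $$d_{\mathrm{Hell}}(\mu^y,\mu^{y'})\le C|y-y'|_\Gamma.$$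
   Context: **Forward model.** $D\subseteq\mathbb{R}^d$, $d\le 3$, is a bounded open set with smooth boundary; $e_1,\dots,e_L\subseteq\partial D$ are electrodes with contact impedances $z_1,\dots,z_L$ satisfying $0<z_-\le z_l\le z_+<\infty$. Set $\mathbb{H}=H^1(D)\oplus\mathbb{R}^L$ with $\|(v,V)\|_{\mathbb{H}}^2=\|v\|_{H^1(D)}^2+\|V\|_{\ell^2}^2$, $\dot{\mathbb{H}}=\mathbb{H}/\mathbb{R}$ (quotient by $(v,V)\sim(v+c,V+c)$, $c\in\mathbb{R}$) with $\|(v,V)\|_{\dot{\mathbb{H}}}=\inf_{c\in\mathbb{R}}\|(v-c,V-c)\|_{\mathbb{H}}$, and $$\|(v,V)\|_*^2=\|\nabla v\|_{L^2(D)}^2+\sum_{l=1}^L\int_{e_l}|v(x)-V_l|^2\,\mathrm{d}S.$$ For a current pattern $I\in\mathbb{R}^L$ with $\sum_{l}I_l=0$, and $v'=(v,V)$, $w'=(w,W)$, put $$B(v',w';\sigma)=\int_D\sigma\nabla v\cdot\nabla w\,\mathrm{d}x+\sum_{l=1}^L\frac1{z_l}\int_{e_l}(v-V_l)(w-W_l)\,\mathrm{d}S,\qquad r(w')=\sum_{l=1}^LI_lW_l.$$ A measurable $\sigma:\overline D\to\mathbb{R}$ is admissible, $\sigma\in\mathcal{A}(D)$, if (i) there are $N\in\mathbb{N}$ and open disjoint subsets $D_1,\dots,D_N$ of $D$ with $\overline D=\bigcup_{n=1}^N\overline{D}_n$; (ii) $\sigma|_{D_n}\in C(\overline{D}_n)$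 for each $n$ (i.e. it extends continuously to $\overline D_n$); (iii) there are $\sigma^-,\sigma^+\in(0,\infty)$ with $\sigma^-\le\sigma(x)\le\sigma^+$ for all $x\in\overline D$. Standing facts, quoted from the literature and taken as given for the domain and electrodes considered: $\|\cdot\|_*$ and $\|\cdot\|_{\dot{\mathbb{H}}}$ are equivalent norms on $\dot{\mathbb{H}}$, and for every $\sigma\in\mathcal{A}(D)$ there is a unique class $[(v,V)]\in\dot{\mathbb{H}}$ with $B(v',w';\sigma)=r(w')$ for all $w'\in\dot{\mathbb{H}}$. The solution map $\mathcal{M}:\mathcal{A}(D)\to\mathbb{H}$ sends $\sigma$ to the representative $(v,V)$ of this class with $\sum_{l=1}^LV_l=0$. **Observations.** Fix current patterns $I^{(1)},\dots,I^{(J)}\in\mathbb{R}^L$, each with entries summing to zero, and let $\mathcal{M}_j$ be the solution map for $I^{(j)}$. Let $\Pi:\mathbb{H}\to\mathbb{R}^L$, $\Pi(v,V)=V$. For $F:X\to\mathcal{A}(D)$ let $\mathcal{G}_j=\Pi\circ\mathcal{M}_j\circ F$ and $\mathcal{G}=(\mathcal{G}_1,\dots,\mathcal{G}_J):X\to Y=\mathbb{R}^{JL}$. $\Gamma=\mathrm{diag}(\Gamma_0,\dots,\Gamma_0)$ ($J$ blocks), where $\Gamma_0\in\mathbb{R}^{L\times L}$ is a positive definite covariance matrix, and $|y|_\Gamma=|\Gamma^{-1/2}y|$. **Priors** ($\mathcal{F}$ is the Borel $\sigma$-algebra in each case; $C^0(\overline D)$ carries the supremum norm). 1. Log-Gaussian: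 $X=C^0(\overline D)$, $F=F_1$, $F_1(u)=\exp(u)$, $\mu_0=N(m_0,\mathcal{C}_0)$ a non-degenerate Gaussian measure on $C^0(\overline D)$. 2. Star-shaped ($d=2$ or $3$): $R_{d-1}=(-\pi,\pi]\times[0,\pi]^{d-2}$; $C^0_P(R_{d-1})$ is the space of continuous periodic functions on $R_{d-1}$ ($2\pi$-periodic in the first angle), with supremum norm; $h:\mathbb{R}^d\to R_{d-1}$ maps Cartesian to angular polar coordinates: $h(x,y)=\mathrm{atan2}(y,x)$ for $d=2$, $h(x,y,z)=(\mathrm{atan2}(y,x),\mathrm{arccot}(z/\sqrt{x^2+y^2}))$ for $d=3$ (any fixed convention where the angles are undefined). $X=C^0_P(R_{d-1})\times D$ with $\|(r,x_0)\|_X=\max\{\|r\|_\infty,|x_0|\}$; $A(r,x_0)=\{x\in D: |x-x_0|\le r(h(x-x_0))\}$; $F=F_2$, $F_2(r,x_0)=u_+\mathbf{1}_{A(r,x_0)}+u_-\mathbf{1}_{D\setminus A(r,x_0)}$ with fixed scalars $u_+,u_->0$; $\mu_0=\sigma_0\otimes\tau_0$ where $\sigma_0$ is a probability measure on $C^0_P(R_{d-1})$ with $\sigma_0(B)>0$ for all balls $B\subseteq C^0_P(R_{d-1})$, and $\tau_0$ is a probability measure on $D$. 3. Level set: $X=C^0(\overline D)$; fix $n\in\mathbb{N}$, constants $-\infty=c_0<c_1<\dots<c_n=\infty$ and strictly positive $f_1,\dots,f_n\in C^0(\overline D)$; for $u\in X$ let $D_i=\{x\in D: c_{i-1}\le u(x)<c_i\}$;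 $F=F_3$, $F_3(u)=\sum_{i=1}^nf_i\mathbf{1}_{D_i}$; $\mu_0=N(m_0,\mathcal{C}_0)$ a non-degenerate Gaussian measure on $C^0(\overline D)$. (The values of $F_2,F_3$ on $\partial D$ are immaterial.) **Hellinger distance**: $d_{\mathrm{Hell}}(\mu,\mu')^2=\frac12\int_X\big(\sqrt{\mathrm{d}\mu/\mathrm{d}\mu_0}-\sqrt{\mathrm{d}\mu'/\mathrm{d}\mu_0}\big)^2\mathrm{d}\mu_0$ for $\mu,\mu'\ll\mu_0$. *)

(* Defs.v *)
From HB Require Import structures.
From mathcomp Require Import all_boot all_order all_algebra.
From mathcomp Require Import all_classical all_reals all_analysis.
From mathcomp Require Import measurable_realfun.
Set Implicit Arguments.
Unset Strict Implicit.
Unset Printing Implicit Defensive.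
Import Order.TTheory GRing.Theory Num.Theory.
Import numFieldNormedType.Exports.
Local Open Scope classical_set_scope.
Local Open Scope ring_scope.

(* As for [n.-tuple T] in the library, R^n carries the product sigma-algebra,
   which is its Borel sigma-algebra. *)
Definition rV_display : measure_display -> measure_display.
Proof. exact. Qed.

Section measurable_rV.
Context {d : measure_display} {T : measurableType d} (n : nat).

Let coors : 'I_n -> 'rV[T]_n -> T := fun i x => x ord0 i.

Let rV0 : g_sigma_preimage coors set0.
Proof. exact: sigma_algebra0. Qed.

Let rVC A : g_sigma_preimage coors A -> g_sigma_preimage coors (~` A).
Proof. exact: sigma_algebraC. Qed.

Let rV_bigcup (F : _^nat) : (forall i, g_sigma_preimage coors (F i)) ->
  g_sigma_preimage coors (\bigcup_i (F i)).
Proof. exact: sigma_algebra_bigcup. Qed.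

HB.instance Definition _ := @isMeasurable.Build (rV_display d)
  'rV[T]_n (g_sigma_preimage coors) rV0 rVC rV_bigcup.

End measurable_rV.

Lemma measurable_fun_rVP d d' (T : measurableType d) (T' : measurableType d')
    (n : nat) (f : T -> 'rV[T']_n) :
  measurable_fun setT f <->
  forall i : 'I_n, measurable_fun setT (fun x => f x ord0 i).
Proof.
split=> [mf i|mf].
- move=> _ A mA; rewrite setTI.
  have := mf measurableT ((fun x : 'rV[T']_n => x ord0 i) @^-1` A).
  rewrite setTI; apply; apply: sub_sigma_algebra => /=.
  rewrite -bigcup_seq/=; exists i => /=; first by rewrite mem_index_enum.
  by exists A => //; rewrite setTI.
- move=> _ A mA; rewrite setTI.
  pose G := [set B : set 'rV[T']_n | measurable (f @^-1` B)].
  suff sG : measurable `<=` G by exact: (sG A mA).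
  apply: smallest_sub; first split.
  + by rewrite /G/= preimage_set0.
  + by move=> B mB; rewrite /G/= setTD preimage_setC; exact: measurableC.
  + move=> F mF; rewrite /G/= preimage_bigcup.
    by apply: bigcup_measurable => k _; exact: mF.
  + move=> B; rewrite -bigcup_seq => -[i /= _] [C mC]; rewrite setTI => <-.
    by have := mf i measurableT C mC; rewrite setTI.
Qed.

Definition rV_cons (R : realType) (n : nat) (p : R * 'rV[R]_n) : 'rV[R]_n.+1 :=
  row_mx p.1%:M p.2.

Lemma measurable_rV_cons (R : realType) (n : nat) :
  measurable_fun setT (@rV_cons R n).
Proof.
apply/measurable_fun_rVP => i.
have : forall j : 'I_(1 + n), measurable_fun setT
    (fun p : R * 'rV[R]_n => row_mx (p.1%:M : 'M[R]_1) p.2 ord0 j).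
  move=> j; rewrite -(fintype.splitK j); case: (fintype.split j) => k /=.
  - rewrite (_ : (fun _ => _) = fst); first exact: measurable_fst.
    by apply/funext => p; rewrite row_mxEl mxE (ord1 k).
  - under eq_fun do rewrite row_mxEr.
    have /measurable_fun_rVP := @measurable_snd _ _ R 'rV[R]_n.
    exact.
by move=> /(_ i).
Qed.

Lemma measurable_rV_uncons (R : realType) (n : nat) :
  measurable_fun setT (fun v : 'rV[R]_n.+1 =>
    (v ord0 ord0, rsubmx (v : 'rV[R]_(1 + n))) : R * 'rV[R]_n).
Proof.
have /measurable_fun_rVP mid := @measurable_id _ 'rV[R]_n.+1 setT.
apply/measurable_fun_pairP; split; first exact: (mid ord0).
apply/measurable_fun_rVP => i /=.
by under eq_fun do rewrite !mxE; exact: mid.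
Qed.

Section lebesgue_succ.
Context (R : realType) (n : nat) (m : {sigma_finite_measure set 'rV[R]_n -> \bar R}).
Local Open Scope ereal_scope.

Definition lebesgue_rVS : set 'rV[R]_n.+1 -> \bar R :=
  pushforward (@lebesgue_measure R \x m) (@rV_cons R n).

Let rVS0 : lebesgue_rVS set0 = 0.
Proof. by rewrite /lebesgue_rVS /pushforward preimage_set0 measure0. Qed.

Let rVS_ge0 A : 0 <= lebesgue_rVS A.
Proof. by rewrite /lebesgue_rVS /pushforward; exact: measure_ge0. Qed.

Let rVS_semi_sigma_additive : semi_sigma_additive lebesgue_rVS.
Proof.
have mp A : measurable A -> measurable (@rV_cons R n @^-1` A).
  by move=> /(measurable_rV_cons measurableT); rewrite setTI.
move=> F mF tF mUF; rewrite /lebesgue_rVS /pushforward preimage_bigcup.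
apply: measure_semi_sigma_additive.
- by move=> k; exact: mp.
- apply/trivIsetP => /= i j _ _ ij; rewrite -preimage_setI.
  by move/trivIsetP : tF => /(_ _ _ _ _ ij) ->//; rewrite preimage_set0.
- by rewrite -preimage_bigcup; exact: mp.
Qed.

HB.instance Definition _ := isMeasure.Build _ _ _
  lebesgue_rVS rVS0 rVS_ge0 rVS_semi_sigma_additive.

Let rVS_sigma_finite : sigma_finite setT lebesgue_rVS.
Proof.
have /sigma_finiteP[F [TF ndF Foo]] := sigma_finiteT (@lebesgue_measure R).
have /sigma_finiteP[G [TG ndG Goo]] := sigma_finiteT m.
pose g (v : 'rV[R]_n.+1) : (R * 'rV[R]_n)%type :=
  (v ord0 ord0, rsubmx (v : 'rV[R]_(1 + n))).
have gK : cancel (@rV_cons R n) g.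
  move=> [x y]; rewrite /g/= /rV_cons row_mxKr; congr pair.
  transitivity ((x%:M : 'M[R]_1) ord0 ord0); last by rewrite mxE.
  rewrite -(@row_mxEl _ 1 1 n x%:M y ord0 ord0); congr (row_mx _ _ _ _).
  exact/val_inj.
exists (fun k => g @^-1` (F k `*` G k)).
  rewrite -preimage_bigcup -[LHS](preimage_setT g); congr (_ @^-1` _).
  rewrite -setXTT TF TG predeqE => -[x y]; split.
    move=> [/= [i _ Fx] [k _ Gy]]; exists (maxn i k) => //; split.
    - by move: x Fx; exact/subsetPset/ndF/leq_maxl.
    - by move: y Gy; exact/subsetPset/ndG/leq_maxr.
  by move=> [i _ []/= ? ?]; split; exists i.
move=> k; have [mF Fk] := Foo k; have [mG Gk] := Goo k; split.
  have := @measurable_rV_uncons R n measurableT (F k `*` G k).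
  by rewrite setTI; apply; exact: measurableX.
rewrite /lebesgue_rVS /pushforward -comp_preimage.
rewrite (_ : g \o _ = id); last by apply/funext => p; exact: gK.
rewrite preimage_id product_measure1E//.
by rewrite lte_mul_pinfty// ge0_fin_numE.
Qed.

HB.instance Definition _ := Measure_isSigmaFinite.Build _ _ _
  lebesgue_rVS rVS_sigma_finite.

End lebesgue_succ.

Fixpoint lebesgue_rV (R : realType) (n : nat) :
    {sigma_finite_measure set 'rV[R]_n -> \bar R} :=
  match n with
  | 0 => \d_(0 : 'rV[R]_0)
  | n'.+1 => lebesgue_rVS (lebesgue_rV R n')
  end.

(* The library norm of ['rV[R]_n] is the maximum norm. *)
Definition enorm (R : realType) (n : nat) (x : 'rV[R]_n) : R :=
  Num.sqrt (\sum_(i < n) x ord0 i ^+ 2).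

Definition boundary (T : topologicalType) (D : set T) : set T :=
  closure D `\` D^°.

Definition ediam (R : realType) (n : nat) (A : set 'rV[R]_n) : \bar R :=
  ereal_sup [set (enorm (p.1 - p.2))%:E | p in A `*` A].

Definition unit_ball_volume (R : realType) (s : nat) : R :=
  fine (lebesgue_rV R s [set x | enorm x <= 1]).

Definition hausdorff_weight (R : realType) (n s : nat) (A : set 'rV[R]_n) : R :=
  if A == set0 then 0 else unit_ball_volume R s * (fine (ediam A) / 2) ^+ s.

(* The s-dimensional Hausdorff (outer) measure, normalised so that it agrees
   with s-dimensional area on s-dimensional surfaces. *)
Definition hausdorff_measure (R : realType) (n s : nat) (A : set 'rV[R]_n) :
    \bar R :=
  ereal_sup [set ereal_inf
      [set (\sum_(0 <= k <oo) (hausdorff_weight s (U k))%:E)%E |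
         U in [set U : (set 'rV[R]_n)^nat |
                A `<=` \bigcup_k U k /\ forall k, (ediam (U k) <= delta%:E)%E]]
    | delta in [set delta : R | 0 < delta]].

Definition is_surface_measure (R : realType) (n : nat) (D : set 'rV[R]_n.+1)
    (S : {measure set 'rV[R]_n.+1 -> \bar R}) : Prop :=
  forall A, measurable A -> A `<=` boundary D -> S A = hausdorff_measure n A.

Definition basis_vec (R : realType) (n : nat) (i : 'I_n) : 'rV[R]_n :=
  delta_mx ord0 i.

Fixpoint partials (R : realType) (n : nat) (s : seq 'I_n) (f : 'rV[R]_n -> R) :
    'rV[R]_n -> R :=
  if s is i :: s' then 'D_(basis_vec R i) (partials s' f) else f.

Definition smooth_on (R : realType) (n : nat) (U : set 'rV[R]_n)
    (f : 'rV[R]_n -> R) : Prop :=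
  forall (s : seq 'I_n) (x : 'rV[R]_n), U x ->
    {for x, continuous (partials s f)} /\
    forall i, derivable (partials s f) x (basis_vec R i).

(* Near each boundary point, D is the sublevel set of a smooth function without
   critical point there. *)
Definition smooth_boundary (R : realType) (n : nat) (D : set 'rV[R]_n) : Prop :=
  forall p, boundary D p ->
    exists (U : set 'rV[R]_n) (phi : 'rV[R]_n -> R),
      [/\ open U, U p, smooth_on U phi,
          (exists i, 'D_(basis_vec R i) phi p != 0) &
          forall x, U x -> (D x <-> phi x < 0)].

Definition test_function (R : realType) (n : nat) (D : set 'rV[R]_n)
    (phi : 'rV[R]_n -> R) : Prop :=
  smooth_on setT phi /\
  exists K : set 'rV[R]_n,
    [/\ compact K, K `<=` D & forall x, ~ K x -> phi x = 0].

Definition admissible (R : realType) (n : nat) (D : set 'rV[R]_n)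
    (sigma : 'rV[R]_n -> R) : Prop :=
  [/\ measurable_fun (closure D) sigma,
      exists (N : nat) (Dn : 'I_N -> set 'rV[R]_n),
        [/\ forall i, open (Dn i) /\ Dn i `<=` D,
            forall i j, i != j -> Dn i `&` Dn j = set0,
            closure D = \bigcup_i closure (Dn i) &
            forall i, exists g : 'rV[R]_n -> R,
              {within closure (Dn i), continuous g} /\
              forall x, Dn i x -> sigma x = g x] &
      exists sminus splus : R, 0 < sminus /\
        forall x, closure D x -> sminus <= sigma x <= splus].

(* An element (v, V) of H = H^1(D) (+) R^L is given by a representative of v,
   of its weak gradient on D and of its trace on the boundary of D, together
   with the electrode voltages V. *)
Record cem_state (R : realType) (n L : nat) := CemState {
  cem_val : 'rV[R]_n.+1 -> R;
  cem_grad : 'I_n.+1 -> 'rV[R]_n.+1 -> R;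
  cem_trace : 'rV[R]_n.+1 -> R;
  cem_volt : 'rV[R]_L }.

HB.instance Definition _ (R : realType) (n L : nat) :=
  gen_eqMixin (cem_state R n L).
HB.instance Definition _ (R : realType) (n L : nat) :=
  gen_choiceMixin (cem_state R n L).

Section complete_electrode_model.
Context (R : realType) (n L : nat).
Let E := 'rV[R]_n.+1.
Context (D : set E) (S : {measure set E -> \bar R}).
Context (e : 'I_L -> set E) (z : 'I_L -> R).
Local Notation vol := (lebesgue_rV R n.+1).
Local Notation state := (cem_state R n L).

Definition square_integrable (v : E -> R) : Prop :=
  measurable_fun D v /\ (\int[vol]_(x in D) (v x ^+ 2)%:E < +oo)%E.

Definition is_weak_gradient (v : E -> R) (g : 'I_n.+1 -> E -> R) : Prop :=
  forall i phi, test_function D phi ->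
    \int[vol]_(x in D) (v x * 'D_(basis_vec R i) phi x) =
    - \int[vol]_(x in D) (g i x * phi x).

(* The trace operator is the continuous extension to H^1(D) of the restriction
   to the boundary of functions smooth up to the boundary: t is the trace of v
   when some smooth functions converge to v in H^1(D) and to t in L^2 of the
   boundary. *)
Definition is_trace (v : E -> R) (g : 'I_n.+1 -> E -> R) (t : E -> R) : Prop :=
  measurable_fun (boundary D) t /\
  exists phi : nat -> E -> R,
    [/\ forall k, smooth_on setT (phi k),
        ((fun k => \int[vol]_(x in D) ((phi k x - v x) ^+ 2)%:E)
           @ \oo --> (0 : \bar R))%E,
        forall i, ((fun k => \int[vol]_(x in D)
            (('D_(basis_vec R i) (phi k) x - g i x) ^+ 2)%:E)
           @ \oo --> (0 : \bar R))%E &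
        ((fun k => \int[S]_(x in boundary D) ((phi k x - t x) ^+ 2)%:E)
           @ \oo --> (0 : \bar R))%E].

Definition in_H (v : state) : Prop :=
  [/\ square_integrable (cem_val v),
      forall i, square_integrable (cem_grad v i),
      is_weak_gradient (cem_val v) (cem_grad v) &
      is_trace (cem_val v) (cem_grad v) (cem_trace v)].

Definition shift (c : R) (v : state) : state :=
  CemState (fun x => cem_val v x + c) (cem_grad v)
    (fun x => cem_trace v x + c) (\row_l (cem_volt v ord0 l + c)).

(* The norms are squared and extended-real valued, so that comparing them also
   compares their finiteness. *)
Definition H_sqnorm (v : state) : \bar R :=
  (\int[vol]_(x in D) (cem_val v x ^+ 2)%:E
   + \sum_(i < n.+1) \int[vol]_(x in D) (cem_grad v i x ^+ 2)%:E
   + (\sum_(l < L) cem_volt v ord0 l ^+ 2)%:E)%E.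

Definition Hdot_sqnorm (v : state) : \bar R :=
  ereal_inf [set H_sqnorm (shift (- c) v) | c in [set: R]].

Definition star_sqnorm (v : state) : \bar R :=
  (\sum_(i < n.+1) \int[vol]_(x in D) (cem_grad v i x ^+ 2)%:E
   + \sum_(l < L) \int[S]_(x in e l)
       ((cem_trace v x - cem_volt v ord0 l) ^+ 2)%:E)%E.

Definition star_norm_equivalent : Prop :=
  exists a b : R, [/\ 0 < a, 0 < b & forall v, in_H v ->
    (a%:E * Hdot_sqnorm v <= star_sqnorm v <= b%:E * Hdot_sqnorm v)%E].

Definition cem_form (sigma : E -> R) (v w : state) : R :=
  \int[vol]_(x in D)
    (sigma x * \sum_(i < n.+1) cem_grad v i x * cem_grad w i x)
  + \sum_(l < L) (z l)^-1 * \int[S]_(x in e l)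
      ((cem_trace v x - cem_volt v ord0 l)
       * (cem_trace w x - cem_volt w ord0 l)).

Definition cem_rhs (I : 'rV[R]_L) (w : state) : R :=
  \sum_(l < L) I ord0 l * cem_volt w ord0 l.

Definition weak_solution (sigma : E -> R) (I : 'rV[R]_L) (v : state) : Prop :=
  in_H v /\ forall w, in_H w -> cem_form sigma v w = cem_rhs I w.

Definition zero_mean (V : 'rV[R]_L) : Prop := \sum_(l < L) V ord0 l = 0.

Definition same_class (v w : state) : Prop := exists c : R,
  {ae vol, forall x, D x -> cem_val w x = cem_val v x + c} /\
  cem_volt w = cem_volt (shift c v).

Definition cem_wellposed : Prop :=
  forall (sigma : E -> R) (I : 'rV[R]_L), admissible D sigma -> zero_mean I ->
    exists v, weak_solution sigma I v /\
      forall w, weak_solution sigma I w -> same_class v w.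

Definition zero_state : state :=
  CemState (cst 0) (fun=> cst 0) (cst 0) 0.

(* The choice is immaterial under [cem_wellposed] at an admissible sigma; the
   default value is only reached elsewhere. *)
Definition solution_map (I : 'rV[R]_L) (sigma : E -> R) : state :=
  xget zero_state
    [set v | weak_solution sigma I v /\ zero_mean (cem_volt v)].

Definition forward_map (X : Type) (F : X -> E -> R) (J : nat)
    (I : 'I_J -> 'rV[R]_L) (u : X) : 'rV[R]_(\sum_(j < J) L) :=
  \mxrow_(j < J) cem_volt (solution_map (I j) (F u)).

End complete_electrode_model.

Definition covariance_matrix (R : realType) (L : nat) (G : 'M[R]_L) : Prop :=
  G^T = G /\ forall x : 'rV[R]_L, x != 0 -> 0 < (x *m G *m x^T) ord0 ord0.

(* The weighted norm |G^(-1/2) y|, through |G^(-1/2) y|^2 = <y, G^(-1) y>. *)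
Definition wnorm (R : realType) (N : nat) (G : 'M[R]_N) (y : 'rV[R]_N) : R :=
  Num.sqrt ((y *m invmx G *m y^T) ord0 ord0).

Definition mvnormal_pdf (R : realType) (N : nat) (G : 'M[R]_N) (y : 'rV[R]_N) :
    R :=
  expR (- (wnorm G y ^+ 2 / 2)) / Num.sqrt ((2 * pi) ^+ N * \det G).

Definition is_mvnormal (R : realType) (N : nat) (G : 'M[R]_N)
    (Q : probability 'rV[R]_N R) : Prop :=
  forall B, measurable B ->
    Q B = (\int[lebesgue_rV R N]_(y in B) (mvnormal_pdf G y)%:E)%E.

Definition dist_open (R : realType) (T : Type) (dist : T -> T -> R) :
    set (set T) :=
  [set U | forall x, U x ->
     exists2 r : R, 0 < r & forall y, dist x y < r -> U y].

Notation borel dist := (g_sigma_algebraType (dist_open dist)).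

(* A function on K is represented by its extension by 0. *)
Record C0 (R : realType) (T : topologicalType) (K : set T) := MkC0 {
  C0_fun :> T -> R;
  C0_continuous : {within K, continuous C0_fun};
  C0_out : forall x, ~ K x -> C0_fun x = 0 }.

Lemma cst0_within (R : realType) (T : topologicalType) (K : set T) :
  {within K, continuous (fun=> 0 : R)}.
Proof. by apply: continuous_subspaceT => x; exact: cst_continuous. Qed.

HB.instance Definition _ (R : realType) (T : topologicalType) (K : set T) :=
  gen_eqMixin (C0 R K).
HB.instance Definition _ (R : realType) (T : topologicalType) (K : set T) :=
  gen_choiceMixin (C0 R K).
HB.instance Definition _ (R : realType) (T : topologicalType) (K : set T) :=
  isPointed.Build (C0 R K) (MkC0 (@cst0_within R T K) (fun _ _ => erefl)).

Definition sup_norm (R : realType) (T : Type) (K : set T) (f : T -> R) : R :=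
  sup [set `|f x| | x in K].

Definition C0_dist (R : realType) (T : topologicalType) (K : set T)
  (u v : C0 R K) : R := sup_norm K (fun x => u x - v x).

Section gaussian.
Context (R : realType) (T : topologicalType) (K : set T).
Local Notation X := (C0 R K).

Definition in_dual (l : X -> R) : Prop :=
  (forall (a b : R) (u v w : X), (forall x, w x = a * u x + b * v x) ->
     l w = a * l u + b * l v) /\
  exists M : R, forall u, `|l u| <= M * sup_norm K u.

(* [normal_prob] is not the Dirac measure when the deviation is 0. *)
Definition gaussian1 (m v : R) (B : set R) : \bar R :=
  if v == 0 then \d_m B else normal_prob m (Num.sqrt v) B.

(* The measure N(m, C), with covariance operator C from the dual of X to X. *)
Definition is_gaussian (mu : probability (borel (@C0_dist R T K)) R)
    (m : X) (C : (X -> R) -> X) : Prop :=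
  forall l, in_dual l ->
    (forall B : set R, measurable B ->
       mu (l @^-1` B) = gaussian1 (l m) (l (C l)) B) /\
    forall l', in_dual l' ->
      l' (C l) = \int[mu]_u ((l u - l m) * (l' u - l' m)).

Definition nondegenerate (C : (X -> R) -> X) : Prop :=
  forall l, in_dual l -> (exists u, l u != 0) -> 0 < l (C l).

End gaussian.

Definition log_gaussian_map (R : realType) (n : nat) (D : set 'rV[R]_n.+1)
    (u : C0 R (closure D)) (x : 'rV[R]_n.+1) : R := expR (u x).

Definition level_set_map (R : realType) (n : nat) (D : set 'rV[R]_n.+1)
    (k : nat) (c : nat -> \bar R) (f : 'I_k -> C0 R (closure D))
    (u : C0 R (closure D)) (x : 'rV[R]_n.+1) : R :=
  \sum_(i < k) f i x * \1_[set y | (c i <= (u y)%:E < c i.+1)%E] x.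

(* Functions on the angles (-pi, pi] x [0, pi]^(n-1) are represented by their
   2pi-periodic extensions in the first angle. *)
Definition angle_strip (R : realType) (n : nat) : set 'rV[R]_n :=
  [set t | forall i : 'I_n, i != 0%N :> nat -> 0 <= t ord0 i <= pi].

Definition angles (R : realType) (n : nat) : set 'rV[R]_n :=
  [set t | angle_strip t /\
    forall i : 'I_n, i = 0%N :> nat -> - pi < t ord0 i <= pi].

Definition full_turn (R : realType) (n : nat) : 'rV[R]_n :=
  \row_(i < n) if i == 0%N :> nat then 2 * pi else 0.

Record CP (R : realType) (n : nat) := MkCP {
  CP_fun :> C0 R (@angle_strip R n);
  CP_periodic : forall t, CP_fun (t + full_turn R n) = CP_fun t }.

HB.instance Definition _ (R : realType) (n : nat) := gen_eqMixin (CP R n).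
HB.instance Definition _ (R : realType) (n : nat) := gen_choiceMixin (CP R n).
HB.instance Definition _ (R : realType) (n : nat) :=
  isPointed.Build (CP R n) (@MkCP R n point (fun=> erefl)).

Definition CP_dist (R : realType) (n : nat) (r r' : CP R n) : R :=
  sup_norm (@angles R n) (fun t => r t - r' t).

(* The set D as a type; measurable types are pointed, whence [D0]. *)
Record set_point (R : realType) (n : nat) (D : set 'rV[R]_n)
    (D0 : D !=set0) := SetPoint {
  set_point_val : 'rV[R]_n;
  set_point_in : D set_point_val }.

HB.instance Definition _ (R : realType) (n : nat) (D : set 'rV[R]_n)
    (D0 : D !=set0) :=
  gen_eqMixin (set_point D0).
HB.instance Definition _ (R : realType) (n : nat) (D : set 'rV[R]_n)
    (D0 : D !=set0) :=
  gen_choiceMixin (set_point D0).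
HB.instance Definition _ (R : realType) (n : nat) (D : set 'rV[R]_n)
    (D0 : D !=set0) :=
  isPointed.Build (set_point D0) (SetPoint D0 (projT2 (cid D0))).

Section star_shaped.
Context (R : realType) (n : nat) (D : set 'rV[R]_n.+1) (D0 : D !=set0).
Local Notation X := (CP R n * set_point D0)%type.

Definition center_dist (x y : set_point D0) : R :=
  enorm (set_point_val x - set_point_val y).

Definition star_dist (p q : X) : R :=
  Num.max (CP_dist p.1 q.1) (center_dist p.2 q.2).

(* Angle of (x, y) in (-pi, pi], with the convention theta0 at the origin. *)
Definition atan2 (theta0 y x : R) : R :=
  if 0 < x then atan (y / x)
  else if x < 0 then (if 0 <= y then atan (y / x) + pi else atan (y / x) - pi)
  else if 0 < y then pi / 2
  else if y < 0 then - (pi / 2)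
  else theta0.

(* arccot (z / rho) in [0, pi] for rho >= 0, with its limits 0 and pi at
   rho = 0, and the convention phi0 at z = rho = 0. *)
Definition polar_angle (phi0 z rho : R) : R :=
  if 0 < rho then pi / 2 - atan (z / rho)
  else if 0 < z then 0
  else if z < 0 then pi
  else phi0.

Definition angular (theta0 phi0 : R) (x : 'rV[R]_n.+1) : 'rV[R]_n :=
  let x_ k := x ord0 (inord k) in
  \row_(i < n) if i == 0%N :> nat then atan2 theta0 (x_ 1%N) (x_ 0%N)
    else polar_angle phi0 (x_ 2%N) (Num.sqrt (x_ 0%N ^+ 2 + x_ 1%N ^+ 2)).

Definition star_set (theta0 phi0 : R) (p : X) : set 'rV[R]_n.+1 :=
  [set x | D x /\
    enorm (x - set_point_val p.2)
      <= p.1 (angular theta0 phi0 (x - set_point_val p.2))].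

Definition star_map (theta0 phi0 uplus uminus : R) (p : X)
    (x : 'rV[R]_n.+1) : R :=
  if x \in star_set theta0 phi0 p then uplus else uminus.

End star_shaped.

Inductive eit_prior (R : realType) (n : nat) (D : set 'rV[R]_n.+1) :
    forall (dX : measure_display) (X : measurableType dX),
      (X -> 'rV[R]_n.+1 -> R) -> probability X R -> Prop :=
| Log_gaussian (mu0 : probability (borel (@C0_dist R _ (closure D))) R) m0 C :
    is_gaussian mu0 m0 C -> nondegenerate C ->
    @eit_prior R n D _ (borel (@C0_dist R _ (closure D)))
      (@log_gaussian_map R n D) mu0
| Star_shaped (D0 : D !=set0) (theta0 phi0 uplus uminus : R)
    (sigma0 : probability (borel (@CP_dist R n)) R)
    (tau0 : probability (borel (@center_dist R n D D0)) R)
    (mu0 : probability (borel (@star_dist R n D D0)) R) :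
    n = 1%N \/ n = 2%N ->
    - pi < theta0 <= pi -> 0 <= phi0 <= pi ->
    0 < uplus -> 0 < uminus ->
    (forall r (rho : R), 0 < rho ->
       (0 < sigma0 [set r' | (CP_dist r r' < rho)%R])%E) ->
    (forall (A : set (borel (@CP_dist R n)))
            (B : set (borel (@center_dist R n D D0))),
       measurable A -> measurable B ->
       mu0 ((A : set (CP R n)) `*` (B : set (set_point D0)))
       = (sigma0 A * tau0 B)%E) ->
    @eit_prior R n D _ (borel (@star_dist R n D D0))
      (@star_map R n D D0 theta0 phi0 uplus uminus) mu0
| Level_set (k : nat) (c : nat -> \bar R) (f : 'I_k -> C0 R (closure D))
    (mu0 : probability (borel (@C0_dist R _ (closure D))) R) m0 C :
    c 0%N = -oo%E -> c k = +oo%E ->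
    (forall i, (i < k)%N -> (c i < c i.+1)%E) ->
    (forall i x, closure D x -> 0 < f i x) ->
    is_gaussian mu0 m0 C -> nondegenerate C ->
    @eit_prior R n D _ (borel (@C0_dist R _ (closure D)))
      (level_set_map c f) mu0.

Definition independent_rv (R : realType) (dO dX dY : measure_display)
    (Omega : measurableType dO) (X : measurableType dX) (Y : measurableType dY)
    (P : probability Omega R) (u : Omega -> X) (eta : Omega -> Y) : Prop :=
  forall A B, measurable A -> measurable B ->
    P (u @^-1` A `&` eta @^-1` B) = (P (u @^-1` A) * P (eta @^-1` B))%E.

(* [post] is a regular version of the conditional distribution of u given y. *)
Definition is_conditional_distribution (R : realType)
    (dO dX dY : measure_display) (Omega : measurableType dO)
    (X : measurableType dX) (Y : measurableType dY) (P : probability Omega R)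
    (u : Omega -> X) (y : Omega -> Y) (post : Y -> probability X R) : Prop :=
  (forall A, measurable A ->
     measurable_fun setT (fun t => post t A)) /\
  forall A B, measurable A -> measurable B ->
    P (u @^-1` A `&` y @^-1` B) = (\int[P]_(w in y @^-1` B) post (y w) A)%E.

Definition density (R : realType) (dX : measure_display)
    (X : measurableType dX) (mu mu0 : probability X R) : X -> \bar R :=
  Radon_Nikodym (charge_of_finite_measure mu) mu0.

Definition hellinger (R : realType) (dX : measure_display)
    (X : measurableType dX) (mu0 mu mu' : probability X R) : R :=
  Num.sqrt (2^-1 * \int[mu0]_x
    (Num.sqrt (fine (density mu mu0 x))
     - Num.sqrt (fine (density mu' mu0 x))) ^+ 2).

Definition potential (R : realType) (X : Type) (N : nat) (Gamma : 'M[R]_N)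
    (G : X -> 'rV[R]_N) (u : X) (y : 'rV[R]_N) : R :=
  2^-1 * wnorm Gamma (G u - y) ^+ 2.

Definition normalising_constant (R : realType) (dX : measure_display)
    (X : measurableType dX) (mu0 : probability X R) (N : nat)
    (Gamma : 'M[R]_N) (G : X -> 'rV[R]_N) (y : 'rV[R]_N) : R :=
  \int[mu0]_u expR (- potential Gamma G u y).

(* Main.v *)
(* If v and v' are the solutions for conductivities s and s' and the same
   current pattern, then B(v' - v, v' - v; s') is the integral over D of
   (s - s') grad v . grad (v' - v).  With Young's inequality and the equivalence
   of the star norm with the quotient norm, the squared difference of the
   voltages is at most a constant times the integral of (s - s')^2 |grad v|^2.
   By dominated convergence, the voltages are continuous under almost
   everywhere convergence of uniformly bounded conductivities.

   The log-Gaussian field depends continuously on u, so its forward map is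
   continuous.  A level-set field is the limit of fields in which the indicators
   of the levels are replaced by steep continuous ramps, so its forward map is a
   limit of continuous maps, hence Borel; no condition on the measure of the
   interfaces is needed.  The star-shaped field is the two-valued level-set field
   of r(h(x - x0)) - |x - x0|, continuous off a null hyperplane through x0, near
   which a second ramp replaces the field by the constant 1.

   Once G is Borel, the joint law of (u, y) has density
   c exp(-Phi(u; y)) with respect to mu0 times Lebesgue measure, by Fubini and
   translation invariance, which gives the posterior and its density.  Since
   a |-> exp(-a^2/4) is 1-Lipschitz, y |-> exp(-Phi(u; y)/2) is 1-Lipschitz for
   the weighted norm, uniformly in u, and Z is bounded below on balls by
   exp(-rho^2) times the integral of exp(-|G|^2). *)

Require Import Defs.
From HB Require Import structures.
From mathcomp Require Import all_boot all_order all_algebra.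
From mathcomp Require Import all_classical all_reals all_analysis.
From mathcomp Require Import measurable_realfun ring lra.
Set Implicit Arguments.
Unset Strict Implicit.
Unset Printing Implicit Defensive.
Import Order.TTheory GRing.Theory Num.Theory.
Import numFieldNormedType.Exports.
Local Open Scope classical_set_scope.
Local Open Scope ring_scope.

(** * Lebesgue measure on R^n *)

(** A state carries representatives of its gradient and trace, so subtracting two weak solutions or
    shifting one to zero mean is legitimate only once differences and constants are known to stay in
    [in_H]. For constants this is the vanishing of the integral of a partial derivative of a test
    function, which comes from translation invariance of the measure on R^n; hence the measure
    theory at the start. Real integrals are [fine] of extended ones, so each use of linearity first
    requires integrability.

    Well-posedness speaks of admissible conductivities only, so the approximating fields and their
    limits must all be admissible. A ramped field is continuous and one piece suffices. A field with
    sharp levels needs disjoint open pieces whose closures cover the closure of D, although its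
    level sets need not be open and their boundaries may have positive measure.

    Measurability on a prior space refers to the open sets of a distance, for the star-shaped prior
    those of the maximum of two distances. It is therefore derived from continuity along sequences
    in that distance. *)

Section rV_borel.
Context (R : realType) (n : nat).
Local Notation E := 'rV[R]_n.

Lemma measurable_coord (i : 'I_n) : measurable_fun setT (fun x : E => x ord0 i).
Proof. by have /measurable_fun_rVP := @measurable_id _ E setT; exact. Qed.

Lemma rV_ballE (x : E) e y : 0 < e ->
  ball x e y <-> forall i, `|x ord0 i - y ord0 i| < e.
Proof.
move=> e0; split=> [[_ h] i|h]; first exact: h.
by split => // i j; rewrite (ord1 i); exact: h.
Qed.

(** Balls of the maximum norm are cubes, so an open set is the union of the countably many cubes
    with rational centre and radius [k.+1%:R^-1] that it contains. Each is a finite intersection of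
    coordinate conditions. *)
Lemma open_measurable_rV (U : set E) : open U -> measurable U.
Proof.
move=> oU.
pose cube (p : 'rV[rat]_n * nat) : set E :=
  [set x | forall i, `|x ord0 i - ratr (p.1 ord0 i)| < p.2.+1%:R^-1].
pose C p := if `[< cube p `<=` U >] then cube p else set0.
have mcube p : measurable (cube p).
  have -> : cube p = \bigcap_(i in [set: 'I_n])
      ((fun x : E => x ord0 i) @^-1` ball (ratr (p.1 ord0 i) : R) p.2.+1%:R^-1).
    apply/seteqP; split=> x.
      by move=> h i _; rewrite /= /ball/= distrC; exact: h.
    by move=> h i; rewrite distrC; exact: (h i I).
  rewrite -[X in measurable X]setCK setC_bigcap; apply: measurableC.
  apply: fin_bigcup_measurable => // i _; apply: measurableC.
  rewrite -[X in measurable X]setTI; apply: measurable_coord => //.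
  exact: measurable_ball.
have -> : U = \bigcup_p C p.
  apply/seteqP; split=> [x Ux|x [p _]]; last first.
    by rewrite /C; case: asboolP => // h /h.
  have /nbhs_ballP[e /= e0 xeU] : nbhs x U by exact: open_nbhs_nbhs.
  (* With radius below [e / 2], a cube whose rational centre is that close to [x] contains [x] and
     stays inside the ball. *)
  have e20 : 0 < e / 2 by rewrite divr_gt0.
  have [k ke] : exists k : nat, k.+1%:R^-1 < e / 2.
    have /cvgr0Pnorm_lt/(_ _ e20)[k _ /(_ k (leqnn k)) /=] := @cvg_harmonic R.
    by rewrite ger0_norm// => ?; exists k.
  have k0 : 0 < k.+1%:R^-1 :> R by rewrite invr_gt0.
  have q i : {q : rat | `|x ord0 i - ratr q| < k.+1%:R^-1}.
    apply: cid; have /rat_in_itvoo[q] :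
      x ord0 i - k.+1%:R^-1 < x ord0 i + k.+1%:R^-1 by rewrite ltrD2l gtrN.
    rewrite in_itv/= => /andP[h1 h2]; exists q.
    by rewrite distrC ltr_distl h1 h2.
  exists (\row_i sval (q i), k) => //; rewrite /C.
  have xc : cube (\row_i sval (q i), k) x.
    by move=> i /=; rewrite mxE; case: (q i).
  rewrite asboolT// => y yc; apply: xeU; apply/rV_ballE => // i.
  have := yc i; have := xc i; rewrite /= mxE => h1 h2.
  rewrite (_ : _ - _ = (x ord0 i - ratr (sval (q i)))
    - (y ord0 i - ratr (sval (q i)))); last by ring.
  by apply: (le_lt_trans (ler_normB _ _)); rewrite (splitr e) ltrD// (lt_trans _ ke).
apply: countable_bigcupT_measurable => //.
move=> p; rewrite /C; case: asboolP => _; first exact: mcube.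
exact: measurable0.
Qed.

Lemma closed_measurable_rV (A : set E) : closed A -> measurable A.
Proof.
by move=> cA; rewrite -[A]setCK; apply: measurableC; apply: open_measurable_rV; exact: closed_openC.
Qed.

Lemma within_continuous_measurable_rV (A : set E) (f : E -> R) : measurable A ->
  {within A, continuous f} -> measurable_fun A f.
Proof.
move=> mA /continuousP cf; apply: (measurability _ (RGenOpens.measurableE R)).
move=> _ [_ [a [b ->] <-]].
have /open_subspaceP[V oV VA] : open (f @^-1` `]a, b[%classic : set (subspace A)).
  exact/cf/interval_open.
rewrite setIC -VA; apply: measurableI => //; exact: open_measurable_rV.
Qed.

Lemma continuous_measurable_rV (f : E -> R) :
  continuous f -> measurable_fun setT f.
Proof.
move=> cf; apply: within_continuous_measurable_rV => //.
exact: continuous_subspaceT.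
Qed.

Lemma measurable_translate (h : E) : measurable_fun setT (fun x : E => x + h).
Proof.
apply/measurable_fun_rVP => i; under eq_fun do rewrite mxE.
by apply: measurable_funD => //; exact: measurable_coord.
Qed.

Definition cube (M : R) : set E := [set x | forall i, `|x ord0 i| <= M].

Lemma compact_cube M : compact (cube M).
Proof.
rewrite (_ : cube M = [set x : E | forall i, [set` `[- M, M]] (x ord0 i)]).
  by apply: (@rV_compact _ _ (fun=> [set` `[- M, M]])) => _; exact: segment_compact.
by apply/seteqP; split=> x h i; have := h i; rewrite /= in_itv/= ler_norml.
Qed.

Lemma bounded_sub_cube (A : set E) : bounded_set A ->
  exists2 M, 0 < M & A `<=` cube M.
Proof.
move=> [M [_ MA]]; exists (`|M| + 1) => [|x Ax i]; first by rewrite ltr_pwDr.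
apply: le_trans (MA (`|M| + 1) _ x Ax).
  by rewrite [leRHS]/Num.norm/= mx_normrE; apply: (le_bigmax _ _ (ord0, i)).
by rewrite (le_lt_trans (ler_norm _))// ltrDl.
Qed.

Lemma closed_cube M : closed (cube M).
Proof. by apply: compact_closed; [exact: norm_hausdorff|exact: compact_cube]. Qed.

Lemma measurable_cube M : measurable (cube M).
Proof. by apply: closed_measurable_rV; exact: closed_cube. Qed.

End rV_borel.

Lemma lebesgue_measure_translate (R : realType) (c : R) (A : set R) : measurable A ->
  lebesgue_measure ((fun x : measurableTypeR R => x + c : measurableTypeR R) @^-1` A)
  = lebesgue_measure A.
Proof.
have mc : measurable_fun setT (fun x : measurableTypeR R => x + c : measurableTypeR R).
  exact: measurable_funD.
move=> mA; apply/esym; move: A mA.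
apply: (lebesgue_measure_unique (mu := pushforward lebesgue_measure
  (fun x : measurableTypeR R => x + c : measurableTypeR R))) => //= _ [[a b]] _ <-.
rewrite /pushforward/=.
rewrite (_ : _ @^-1` _ = `]a - c, b - c]%classic); last first.
  by apply/seteqP; split=> x /=; rewrite !in_itv/= ltrBlDr lerBrDr.
by rewrite !lebesgue_measure_itv/= !lte_fin ltrD2r -!EFinB (_ : b - c - (a - c) = b - a)//; ring.
Qed.

Lemma rV_consE (R : realType) n (p : R * 'rV[R]_n) (i : 'I_n.+1) :
  rV_cons p ord0 i = if unlift ord0 i is Some j then p.2 ord0 j else p.1.
Proof.
case: unliftP => [j|] ->; rewrite /rV_cons.
- have -> : lift (@ord0 n) j = rshift 1 j by exact/val_inj.
  exact: (@row_mxEr _ 1 1 n).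
- have -> : (@ord0 n) = lshift n (ord0 : 'I_1) by exact/val_inj.
  by apply: etrans (@row_mxEl _ 1 1 n _ _ _ _) _; rewrite mxE.
Qed.

Lemma lebesgue_rVSE (R : realType) n (A : set 'rV[R]_n.+1) :
  lebesgue_rV R n.+1 A = (lebesgue_measure \x lebesgue_rV R n)%E (@rV_cons R n @^-1` A).
Proof. by []. Qed.

(** Induction on the dimension: under [rV_cons] a translation acts on each factor of the product,
    and a measure agreeing with the product on rectangles is the product. In dimension 0 there is
    only one point. *)
Lemma lebesgue_rV_translate (R : realType) n (h : 'rV[R]_n) (A : set 'rV[R]_n) :
  measurable A -> lebesgue_rV R n ((fun x => x + h) @^-1` A) = lebesgue_rV R n A.
Proof.
elim: n h A => [|n IH] h A mA.
  have xh (x : 'rV[R]_0) : x + h = x by apply/rowP => -[].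
  by congr (lebesgue_rV R 0 _); apply/funext => x; rewrite /preimage/= xh.
rewrite !lebesgue_rVSE.
pose t (p : measurableTypeR R * 'rV[R]_n) : measurableTypeR R * 'rV[R]_n :=
  (p.1 + h ord0 ord0, p.2 + (\row_j h ord0 (lift ord0 j))).
have mt : measurable_fun setT t.
  apply/measurable_fun_pairP; split; first exact: measurable_funD.
  exact: measurableT_comp (@measurable_translate R n _) _.
have mconsA : measurable (@rV_cons R n @^-1` A).
  by rewrite -[X in measurable X]setTI; exact: measurable_rV_cons.
rewrite (_ : _ @^-1` (_ @^-1` _) = t @^-1` (@rV_cons R n @^-1` A)); last first.
  apply: funext => p; rewrite /preimage/mkset; congr (A _).
  apply/rowP => i; rewrite mxE !rV_consE.
  by case: unliftP => [j|] ->//=; rewrite !mxE.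
apply/esym; move: (_ @^-1` A) mconsA.
apply: (product_measure_unique (m' := pushforward
  (lebesgue_measure \x lebesgue_rV R n)%E t)) => //= B C mB mC.
rewrite /pushforward/=.
rewrite (_ : _ @^-1` _ = ((fun x : measurableTypeR R => x + h ord0 ord0) @^-1` B) `*`
   ((fun x => x + (\row_j h ord0 (lift ord0 j))) @^-1` C))//.
rewrite product_measure1E.
- by congr (_ * _)%E; [exact: lebesgue_measure_translate|exact: IH].
- rewrite -[X in measurable X]setTI.
  have : measurable_fun setT (fun x : measurableTypeR R => x + h ord0 ord0).
    exact: measurable_funD.
  exact.
- by rewrite -[X in measurable X]setTI; exact: measurable_translate.
Qed.

Lemma lebesgue_rV_cube (R : realType) n (M : R) :
  (lebesgue_rV R n (@cube R n M) < +oo)%E.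
Proof.
elim: n => [|n IH]; first by rewrite /= diracE ltry.
rewrite lebesgue_rVSE.
have -> : @rV_cons R n @^-1` (@cube R n.+1 M) = `[- M, M]%classic `*` @cube R n M.
  apply/seteqP; split=> [[x y] h|[x y] [/= xM yM] i]; last first.
    rewrite rV_consE; case: unliftP => [j|] _ /=; first exact: yM.
    by rewrite ler_norml; move: xM; rewrite in_itv.
  split=> /=.
    by have := h ord0; rewrite rV_consE unlift_none/= ler_norml in_itv.
  by move=> i; have := h (lift ord0 i); rewrite rV_consE liftK.
rewrite product_measure1E//.
  have I : (lebesgue_measure (`[(- M)%R, M]%classic : set R) < +oo)%E.
    by rewrite lebesgue_measure_itv/=; case: ifP => // _; rewrite ltry.
  by rewrite lte_mul_pinfty// ge0_fin_numE.
exact: measurable_cube.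
Qed.

Lemma lebesgue_rV_bounded (R : realType) n (A : set 'rV[R]_n) : measurable A ->
  bounded_set A -> (lebesgue_rV R n A < +oo)%E.
Proof.
move=> mA /bounded_sub_cube[M _ AM]; apply: le_lt_trans (@lebesgue_rV_cube R n M).
by apply: le_measure; rewrite ?inE//; exact: measurable_cube.
Qed.

(** The singleton factor has measure 0. Such hyperplanes are the exceptional null sets of the
    star-shaped fields. *)
Lemma lebesgue_rV_hyperplane (R : realType) n (c : R) :
  lebesgue_rV R n.+1 [set x : 'rV[R]_n.+1 | x ord0 ord0 = c] = 0%E.
Proof.
rewrite lebesgue_rVSE.
have -> : @rV_cons R n @^-1` [set x : 'rV[R]_n.+1 | x ord0 ord0 = c] =
    [set c] `*` setT.
  apply/seteqP; split=> [[x y]|[x y] []]; rewrite /= rV_consE unlift_none//=.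
rewrite product_measure1E//.
by apply: etrans (mul0e _); congr (_ * _)%E; exact: lebesgue_measure_set1.
Qed.

(** * Square-integrable functions *)

Section square_integrable_functions.
Context d (T : measurableType d) (R : realType) (mu : {measure set T -> \bar R}).
Context (D : set T) (mD : measurable D).
Implicit Types f g b : T -> R.

(** Same shape as [square_integrable], for any measure and set, so that it serves both the volume on
    [D] and the surface measure on the electrodes. *)
Definition L2 f :=
  measurable_fun D f /\ (\int[mu]_(x in D) (f x ^+ 2)%:E < +oo)%E.

Lemma L2_sqr_integrable f : L2 f -> mu.-integrable D (EFin \o (fun x => f x ^+ 2)).
Proof.
move=> [mf f2]; apply/integrableP; split.
  by apply/measurable_EFinP; exact: measurable_funX.
by under eq_integral do rewrite /= ger0_norm ?sqr_ge0//.
Qed.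

Lemma L2_le f g : measurable_fun D f -> (forall x, D x -> f x ^+ 2 <= g x) ->
  mu.-integrable D (EFin \o g) -> L2 f.
Proof.
move=> mf fg /integrableP[mg ig]; split => //; apply: le_lt_trans ig.
apply: ge0_le_integral => //=.
- by move=> x _; rewrite lee_fin sqr_ge0.
- by apply/measurable_EFinP; exact: measurable_funX.
- apply/measurable_EFinP; apply: measurableT_comp => //.
  exact/measurable_EFinP.
- by move=> x Dx; rewrite lee_fin (le_trans (fg x Dx))// ler_norm.
Qed.

Lemma L2_mul_integrable f g : L2 f -> L2 g ->
  mu.-integrable D (EFin \o (fun x => f x * g x)).
Proof.
move=> hf hg.
have i2 := integrableD mD (L2_sqr_integrable hf) (L2_sqr_integrable hg).
apply: (le_integrable mD) i2.
  by apply/measurable_EFinP; apply: measurable_funM; [exact: hf.1|exact: hg.1].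
move=> x Dx /=; rewrite lee_fin.
rewrite [leRHS]ger0_norm ?addr_ge0 ?sqr_ge0// normrM.
have := sqr_ge0 (`|f x| - `|g x|); rewrite sqrrB !real_normK ?num_real// => h.
have := mulr_ge0 (normr_ge0 (f x)) (normr_ge0 (g x)).
by move: h; rewrite -mulr_natr; lra.
Qed.

Lemma L2D f g : L2 f -> L2 g -> L2 (fun x => f x + g x).
Proof.
move=> hf hg.
have i2 := integrableD mD (integrableZl mD 2 (L2_sqr_integrable hf))
  (integrableZl mD 2 (L2_sqr_integrable hg)).
apply: (L2_le (g := fun x => 2 * f x ^+ 2 + 2 * g x ^+ 2)) => //.
  by apply: measurable_funD; [exact: hf.1|exact: hg.1].
by move=> x _; have := sqr_ge0 (f x - g x); nra.
Qed.

Lemma L2N f : L2 f -> L2 (fun x => - f x).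
Proof.
move=> [mf f2]; split; first exact: measurableT_comp.
by under eq_integral do rewrite sqrrN.
Qed.

Lemma L2B f g : L2 f -> L2 g -> L2 (fun x => f x - g x).
Proof. by move=> hf hg; apply: L2D => //; exact: L2N. Qed.

Lemma L2_bounded f (M : R) : (mu D < +oo)%E -> measurable_fun D f ->
  (forall x, D x -> `|f x| <= M) -> L2 f.
Proof.
move=> Doo mf fM; apply: (L2_le (g := cst (M ^+ 2))) => //.
  move=> x Dx; rewrite -real_normK ?num_real//.
  by rewrite lerXn2r ?nnegrE//; [exact: le_trans (fM x Dx)|exact: fM].
apply/integrableP; split; first exact/measurable_EFinP.
have : (\int[mu]_(x in D) (cst (`|M ^+ 2|%R%:E)) x < +oo)%E.
  by rewrite integral_cst// lte_mul_pinfty.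
exact.
Qed.

Lemma bounded_mul_integrable b f (M : R) : measurable_fun D b ->
  (forall x, D x -> `|b x| <= M) -> mu.-integrable D (EFin \o f) ->
  mu.-integrable D (EFin \o (fun x => b x * f x)).
Proof.
move=> mb bM fi; have iM := integrableZl mD M fi.
apply: (le_integrable mD) iM.
  apply/measurable_EFinP; apply: measurable_funM => //.
  by apply/measurable_EFinP; exact: measurable_int fi.
move=> x Dx /=; rewrite lee_fin !normrM ler_wpM2r//.
by rewrite (le_trans (bM x Dx))// ler_norm.
Qed.

Lemma sum_integrable (I : Type) (r : seq I) (F : I -> T -> R) :
  (forall i, mu.-integrable D (EFin \o F i)) ->
  mu.-integrable D (EFin \o (fun x => \sum_(i <- r) F i x)).
Proof.
move=> Fi; elim: r => [|i r IH].
  rewrite (_ : _ \o _ = cst 0%E); last by apply/funext => x /=; rewrite big_nil.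
  exact: integrable0.
rewrite (_ : _ \o _ = (EFin \o F i) \+ (EFin \o (fun x => \sum_(i <- r) F i x))).
  exact: integrableD.
by apply/funext => x /=; rewrite big_cons.
Qed.

Lemma Rintegral_sum (I : Type) (r : seq I) (F : I -> T -> R) :
  (forall i, mu.-integrable D (EFin \o F i)) ->
  \int[mu]_(x in D) (\sum_(i <- r) F i x) = \sum_(i <- r) \int[mu]_(x in D) F i x.
Proof.
move=> Fi; elim: r => [|i r IH].
  by under eq_Rintegral do rewrite big_nil; rewrite Rintegral_cst// mul0r big_nil.
under eq_Rintegral do rewrite big_cons.
by rewrite RintegralD//; [rewrite big_cons IH|exact: sum_integrable].
Qed.

Lemma L2_integralE f : L2 f ->
  (\int[mu]_(x in D) (f x ^+ 2)%:E = (\int[mu]_(x in D) (f x ^+ 2))%:E)%E.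
Proof.
move=> hf; rewrite /Rintegral fineK// ge0_fin_numE; first exact: hf.2.
by apply: integral_ge0 => x _; rewrite lee_fin sqr_ge0.
Qed.

End square_integrable_functions.

(** * Stability of the electrode voltages *)

Section stability.
Context (R : realType) (n L : nat).
Local Notation E := 'rV[R]_n.+1.
Context (D : set E) (D_open : open D).
Context (S : {measure set E -> \bar R}) (e : 'I_L -> set E) (z : 'I_L -> R).
Context (e_meas : forall l, measurable (e l)).
Context (e_boundary : forall l, e l `<=` boundary D).
Local Notation vol := (lebesgue_rV R n.+1).
Local Notation state := (cem_state R n L).
Implicit Types v w : state.

Definition sub_state v w : state :=
  CemState (fun x => cem_val v x - cem_val w x)
    (fun i x => cem_grad v i x - cem_grad w i x)
    (fun x => cem_trace v x - cem_trace w x) (cem_volt v - cem_volt w).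

(** What makes every integrand of the form integrable: [fine] sends an infinite integral to 0, so
    bilinearity can be used only for such states. *)
Definition finite_energy v :=
  (forall i, L2 vol D (cem_grad v i)) /\
  forall l, L2 S (e l) (fun x => cem_trace v x - cem_volt v ord0 l).

Let mD : measurable D. Proof. exact: open_measurable_rV. Qed.

Lemma measurable_boundary : measurable (boundary D).
Proof.
apply: measurableD; first by apply: closed_measurable_rV; exact: closed_closure.
by apply: open_measurable_rV; exact: open_interior.
Qed.

Lemma Hdot_sqnorm_lty v : in_H D S v -> (Hdot_sqnorm D v < +oo)%E.
Proof.
move=> [[_ v2] hg _ _]; apply: (@le_lt_trans _ _ (H_sqnorm D (Defs.shift (- 0) v))).
  by apply: ereal_inf_lbound; exists 0.
rewrite /H_sqnorm/= oppr0; under eq_integral do rewrite addr0.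
apply: lte_add_pinfty; last exact: ltry.
apply: lte_add_pinfty; first exact: v2.
by apply: lte_sum_pinfty => i _; exact: (hg i).2.
Qed.

(** At zero mean, shifting the voltages by [c] adds [L * c ^+ 2] to their sum of squares, so no
    representative of the class has a smaller voltage part. This converts bounds in the quotient
    norm into bounds on the normalised voltages. *)
Lemma Hdot_sqnorm_ge v : zero_mean (cem_volt v) ->
  ((\sum_(l < L) cem_volt v ord0 l ^+ 2)%:E <= Hdot_sqnorm D v)%E.
Proof.
move=> v0; apply: le_ereal_inf_tmp => _ [c _ <-].
rewrite /H_sqnorm/= -[leLHS]add0e leeD//.
  rewrite adde_ge0//; last apply: sume_ge0 => i _.
    by apply: integral_ge0 => x _; rewrite lee_fin sqr_ge0.
  by apply: integral_ge0 => x _; rewrite lee_fin sqr_ge0.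
rewrite lee_fin -subr_ge0 -sumrB.
under eq_bigr => l _.
  rewrite mxE (_ : _ - _ = c ^+ 2 - (2 * c) * cem_volt v ord0 l); last by ring.
  over.
rewrite sumrB -[X in _ - X]mulr_sumr v0 mulr0 subr0.
by apply: sumr_ge0 => l _; exact: sqr_ge0.
Qed.

Context (norms : star_norm_equivalent D S e).

(** [in_H] makes the trace a limit on the boundary without asserting a finite L^2 norm on the
    electrodes. Finiteness comes from the norm equivalence, whose upper bound is an inequality
    between extended reals. *)
Lemma in_H_finite_energy v : in_H D S v -> finite_energy v.
Proof.
move=> Hv; have [a [b [a0 b0 ab]]] := norms.
have /andP[_ starb] := ab _ Hv.
have star_oo : (star_sqnorm D S e v < +oo)%E.
  by apply: le_lt_trans starb _; rewrite lte_mul_pinfty// ?lee_fin ?ltW// Hdot_sqnorm_lty.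
have [_ hg _ [mt _]] := Hv.
split; first exact: hg.
move=> l; split.
  apply: measurable_funB => //; apply: measurable_funS mt => //.
  exact: measurable_boundary.
apply: le_lt_trans star_oo.
rewrite /star_sqnorm -[leLHS]add0e leeD//.
  by apply: sume_ge0 => i _; apply: integral_ge0 => x _; rewrite lee_fin sqr_ge0.
rewrite (bigD1 l)//= leeDl//; apply: sume_ge0 => i _.
by apply: integral_ge0 => x _; rewrite lee_fin sqr_ge0.
Qed.

Definition energy v : R :=
  \sum_(i < n.+1) \int[vol]_(x in D) (cem_grad v i x ^+ 2)
  + \sum_(l < L) \int[S]_(x in e l) ((cem_trace v x - cem_volt v ord0 l) ^+ 2).

Lemma star_sqnormE v : finite_energy v -> star_sqnorm D S e v = (energy v)%:E.
Proof.
move=> [gv tv]; rewrite /star_sqnorm /energy EFinD -!sumEFin.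
by congr (_ + _)%E; apply: eq_bigr => k _; rewrite L2_integralE.
Qed.

Definition conductivity_on (s : E -> R) (a b : R) :=
  measurable_fun D s /\ forall x, D x -> a <= s x <= b.

Lemma conductivity_norm s a b : 0 <= a -> conductivity_on s a b ->
  forall x, D x -> `|s x| <= b.
Proof. by move=> a0 [_ h] x /h /andP[h1 h2]; rewrite ger0_norm// (le_trans a0). Qed.

Lemma grad_integrable s a b v w : 0 <= a -> conductivity_on s a b ->
  finite_energy v -> finite_energy w ->
  vol.-integrable D (EFin \o
    (fun x => s x * \sum_(i < n.+1) cem_grad v i x * cem_grad w i x)).
Proof.
move=> a0 hs [gv _] [gw _].
apply: (bounded_mul_integrable mD hs.1 (conductivity_norm a0 hs)).
by apply: sum_integrable => // i; exact: L2_mul_integrable.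
Qed.

Lemma cem_formBl s a b v v' w : 0 <= a -> conductivity_on s a b ->
  finite_energy v -> finite_energy v' -> finite_energy w ->
  cem_form D S e z s (sub_state v v') w =
  cem_form D S e z s v w - cem_form D S e z s v' w.
Proof.
move=> a0 hs hv hv' hw; rewrite /cem_form.
rewrite opprD addrACA -RintegralB//; [|exact: grad_integrable hs _ _..].
congr (_ + _).
  apply: eq_Rintegral => x _; rewrite -mulrBr -sumrB; congr (_ * _).
  by apply: eq_bigr => i _ /=; rewrite mulrBl.
rewrite -sumrB; apply: eq_bigr => l _; rewrite -mulrBr; congr (_ * _).
rewrite -RintegralB//; first last.
- by apply: L2_mul_integrable; [exact: e_meas|exact: hv'.2|exact: hw.2].
- by apply: L2_mul_integrable; [exact: e_meas|exact: hv.2|exact: hw.2].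
by apply: eq_Rintegral => x _ /=; rewrite !mxE; ring.
Qed.

Lemma cem_form_ge s a b zplus w : 0 < a -> conductivity_on s a b ->
  (forall l, 0 < z l <= zplus) -> finite_energy w ->
  Num.min a zplus^-1 * energy w <= cem_form D S e z s w w.
Proof.
move=> a0 hs hz hw; rewrite /energy /cem_form mulrDr; apply: lerD.
  rewrite -Rintegral_sum//; last by move=> i; exact: L2_sqr_integrable (hw.1 i).
  have iE : vol.-integrable D
      (EFin \o (fun x => \sum_(i < n.+1) cem_grad w i x ^+ 2)).
    by apply: sum_integrable => // i; exact: L2_sqr_integrable (hw.1 i).
  rewrite -RintegralZl//; apply: le_Rintegral => //.
  - exact: (integrableZl mD _ iE).
  - exact: (grad_integrable (ltW a0) hs hw hw).
  move=> x Dx; rewrite [leRHS](_ : _ = s x * \sum_(i < n.+1) cem_grad w i x ^+ 2).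
    apply: ler_wpM2r; first by apply: sumr_ge0 => i _; exact: sqr_ge0.
    by have /andP[sa _] := hs.2 x Dx; rewrite ge_min sa.
  by congr (_ * _); apply: eq_bigr => i _; rewrite expr2.
rewrite mulr_sumr; apply: ler_sum => l _.
have /andP[zl0 zl] := hz l.
apply: ler_pM.
- by rewrite le_min ltW//= invr_ge0 (le_trans _ zl)// ltW.
- by apply: Rintegral_ge0 => x _; exact: sqr_ge0.
- by rewrite ge_min lef_pV2 ?posrE ?(lt_le_trans zl0)// zl orbT.
- by under [leLHS]eq_Rintegral do rewrite expr2.
Qed.

Lemma stability I s s' a b zplus v v' : 0 < a -> 0 < zplus ->
  conductivity_on s a b -> conductivity_on s' a b ->
  (forall l, 0 < z l <= zplus) -> in_H D S (sub_state v' v) ->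
  weak_solution D S e z s I v -> weak_solution D S e z s' I v' ->
  energy (sub_state v' v) <= ((Num.min a zplus^-1) ^- 2) *
     \int[vol]_(x in D)
       ((s x - s' x) ^+ 2 * \sum_(i < n.+1) cem_grad v i x ^+ 2).
Proof.
move=> a0 zplus0 hs hs' hz Hw [Hv sv] [Hv' sv'].
set k := Num.min _ _.
set w := sub_state v' v in Hw *.
have [fv fv' fw] : [/\ finite_energy v, finite_energy v' & finite_energy w].
  by split; exact: in_H_finite_energy.
have k_gt0 : 0 < k by rewrite lt_min a0 invr_gt0.
pose P x := \sum_(i < n.+1) cem_grad v i x * cem_grad w i x.
have iV : vol.-integrable D (EFin \o (fun x => \sum_(i < n.+1) cem_grad v i x ^+ 2)).
  by apply: sum_integrable => // i; exact: L2_sqr_integrable (fv.1 i).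
have iW : vol.-integrable D (EFin \o (fun x => \sum_(i < n.+1) cem_grad w i x ^+ 2)).
  by apply: sum_integrable => // i; exact: L2_sqr_integrable (fw.1 i).
have iQ : vol.-integrable D (EFin \o (fun x =>
    (s x - s' x) ^+ 2 * \sum_(i < n.+1) cem_grad v i x ^+ 2)).
  apply: (@bounded_mul_integrable _ _ _ _ _ mD _ _ (b ^+ 2)) => //.
    by apply: measurable_funX; apply: measurable_funB; [exact: hs.1|exact: hs'.1].
  move=> x Dx; have /andP[h1 h2] := hs.2 x Dx; have /andP[h3 h4] := hs'.2 x Dx.
  rewrite ger0_norm ?sqr_ge0// -real_normK ?num_real// lerXn2r ?nnegrE//.
    by rewrite (le_trans (ltW a0))// (le_trans h1).
  by rewrite ler_norml; apply/andP; split; lra.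
(* The right-hand sides agree, so [B(v' - v, w; s')] is [B(v, w; s) - B(v, w; s')], in which the
   electrode terms cancel. *)
have key : cem_form D S e z s' w w = \int[vol]_(x in D) ((s x - s' x) * P x).
  rewrite (cem_formBl (ltW a0) hs')// sv'// -sv// /cem_form opprD addrACA subrr addr0.
  rewrite -RintegralB//; [|exact: (grad_integrable (ltW a0) hs fv fw)
    |exact: (grad_integrable (ltW a0) hs' fv fw)].
  by apply: eq_Rintegral => x _; rewrite -mulrBl.
(* The weight [k / 2] is chosen so that half of the coercive term [k * energy w] absorbs the
   gradient of [w]. Solving for [energy w] then produces the factor [k ^- 2]. *)
have young : cem_form D S e z s' w w <= (2 * k)^-1 * (\int[vol]_(x in D)
     ((s x - s' x) ^+ 2 * \sum_(i < n.+1) cem_grad v i x ^+ 2))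
     + k / 2 * \int[vol]_(x in D) (\sum_(i < n.+1) cem_grad w i x ^+ 2).
  rewrite key -!RintegralZl// -RintegralD//; last 2 first.
  - exact: (integrableZl mD (2 * k)^-1 iQ).
  - exact: (integrableZl mD (k / 2) iW).
  apply: le_Rintegral => //.
  - rewrite (_ : _ \o _ = (fun x => (s x * P x)%:E) \- (fun x => (s' x * P x)%:E))%E.
      by apply: integrableB => //; [exact: (grad_integrable (ltW a0) hs fv fw)
       |exact: (grad_integrable (ltW a0) hs' fv fw)].
    by apply/funext => x /=; rewrite mulrBl.
  - exact: (integrableD mD (integrableZl mD (2 * k)^-1 iQ) (integrableZl mD (k / 2) iW)).
  move=> x _; rewrite /P !mulr_sumr -big_split/=; apply: ler_sum => i _.
  rewrite -subr_ge0; move: (s x - s' x) (cem_grad v i x) (cem_grad v' i x) => t p q.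
  rewrite (_ : _ - _ = (2 * k)^-1 * (t * p - k * (q - p)) ^+ 2).
    by rewrite mulr_ge0 ?sqr_ge0// invr_ge0 mulr_ge0// ltW.
  by field; rewrite gt_eqF.
have grad_le : \int[vol]_(x in D) (\sum_(i < n.+1) cem_grad w i x ^+ 2) <= energy w.
  rewrite Rintegral_sum//; last by move=> i; exact: L2_sqr_integrable (fw.1 i).
  rewrite lerDl; apply: sumr_ge0 => l _.
  by apply: Rintegral_ge0 => x _; exact: sqr_ge0.
have low := cem_form_ge a0 hs' hz fw.
move: low young grad_le; rewrite -/k.
set Q := \int[vol]_(x in D) _; set W := \int[vol]_(x in D) _ => low young grad_le.
have : k * energy w <= (2 * k)^-1 * Q + k / 2 * energy w.
  apply: le_trans low _; apply: le_trans young _.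
  by rewrite lerD2l ler_wpM2l// divr_ge0// ltW.
rewrite -lerBlDr (_ : _ - _ = k / 2 * energy w); last by field.
move=> h; have := ler_wpM2l (_ : 0 <= 2 / k) h.
rewrite (_ : 2 / k * (k / 2 * energy w) = energy w); last first.
  by field; rewrite gt_eqF.
rewrite (_ : 2 / k * ((2 * k)^-1 * Q) = k ^- 2 * Q); last by field; rewrite gt_eqF.
by apply; rewrite divr_ge0// ltW.
Qed.

Lemma voltage_stability I s s' a b zplus v v' : 0 < a -> 0 < zplus ->
  conductivity_on s a b -> conductivity_on s' a b ->
  (forall l, 0 < z l <= zplus) -> in_H D S (sub_state v' v) ->
  weak_solution D S e z s I v -> weak_solution D S e z s' I v' ->
  zero_mean (cem_volt v) -> zero_mean (cem_volt v') ->
  forall c, 0 < c -> (forall w, in_H D S w ->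
     (c%:E * Hdot_sqnorm D w <= star_sqnorm D S e w)%E) ->
  c * \sum_(l < L) (cem_volt v' ord0 l - cem_volt v ord0 l) ^+ 2 <=
    ((Num.min a zplus^-1) ^- 2) * \int[vol]_(x in D)
       ((s x - s' x) ^+ 2 * \sum_(i < n.+1) cem_grad v i x ^+ 2).
Proof.
move=> a0 zplus0 hs hs' hz Hw sv sv' v0 v'0 c c0 hc.
apply: le_trans (stability a0 zplus0 hs hs' hz Hw sv sv').
rewrite -lee_fin -star_sqnormE; last exact: in_H_finite_energy.
apply: le_trans (hc _ Hw); rewrite EFinM; apply: lee_wpmul2l.
  by rewrite lee_fin ltW.
apply: le_trans (Hdot_sqnorm_ge (v := sub_state v' v) _).
  by rewrite lee_fin; apply: ler_sum => l _; rewrite /= !mxE.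
rewrite /zero_mean; under eq_bigr do rewrite !mxE.
by rewrite sumrB v0 v'0 subrr.
Qed.

End stability.

(** * Integration by translation; smooth functions *)

Lemma compact_bound (R : realType) (T : topologicalType) (K : set T) (f : T -> R) :
  compact K -> {within K, continuous f} ->
  exists2 M : R, 0 < M & forall x, K x -> `|f x| <= M.
Proof.
move=> cK cf; have /compact_bounded[M [_ fM]] := continuous_compact cf cK.
exists (`|M| + 1) => [|x Kx]; first by rewrite ltr_pwDr.
by apply: fM; [rewrite (le_lt_trans (ler_norm _))// ltrDl|exists x].
Qed.

Section bounded_domain.
Context (R : realType) (n : nat).
Local Notation E := 'rV[R]_n.

Lemma compact_closure (A : set E) : bounded_set A -> compact (closure A).
Proof.
move=> /bounded_sub_cube[M _ AM].
apply: (subclosed_compact (@closed_closure _ A) (@compact_cube R n M)).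
by have /closure_id -> := @closed_cube R n M; exact: closureS.
Qed.

Lemma continuous_L2 (D : set E) (f : E -> R) : measurable D -> bounded_set D ->
  continuous f -> L2 (lebesgue_rV R n) D f.
Proof.
move=> mD bD cf; have [M _ DM] := bounded_sub_cube bD.
have [B _ fB] := compact_bound (@compact_cube R n M) (continuous_subspaceT cf).
apply: (@L2_bounded _ _ _ _ _ mD _ B) => //; first exact: lebesgue_rV_bounded.
  by apply: measurable_funTS; exact: continuous_measurable_rV.
by move=> x /DM; exact: fB.
Qed.

Lemma integrable_indic_cube M :
  (lebesgue_rV R n).-integrable setT (EFin \o \1_(@cube R n M)).
Proof.
have mM : measurable (@cube R n M) by exact: measurable_cube.
apply/integrableP; split; first by apply/measurable_EFinP; exact: measurable_indic.
under eq_integral do rewrite /= ger0_norm//.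
by rewrite integral_indic// setIT; exact: lebesgue_rV_cube.
Qed.

Lemma integrable_bounded_support (f : E -> R) (B M : R) : measurable_fun setT f ->
  (forall x, `|f x| <= B) -> (forall x, ~ cube M x -> f x = 0) ->
  (lebesgue_rV R n).-integrable setT (EFin \o f).
Proof.
move=> mf fB f0.
apply: (le_integrable measurableT) (integrableZl measurableT B (integrable_indic_cube M)).
  exact/measurable_EFinP.
move=> x _ /=; rewrite lee_fin indicE; have [xM|xM] := pselect (cube M x).
  by rewrite mem_set// mulr1 (le_trans (fB x))// ler_norm.
by rewrite f0// normr0.
Qed.

Lemma eq_measure_translate (h : E) (A : set E) : measurable A ->
  lebesgue_rV R n A = pushforward (lebesgue_rV R n) (fun x => x + h) A.
Proof. by move=> mA; rewrite /pushforward lebesgue_rV_translate. Qed.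

Lemma ge0_integral_translate (f : E -> \bar R) h : measurable_fun setT f ->
  (forall x, 0 <= f x)%E ->
  (\int[lebesgue_rV R n]_x f (x + h)%R = \int[lebesgue_rV R n]_x f x)%E.
Proof.
move=> mf f0.
transitivity (\int[pushforward (lebesgue_rV R n) (fun x => (x + h)%R)]_x f x)%E.
  by rewrite ge0_integral_pushforward//; exact: measurable_translate.
apply: eq_measure_integral; first exact: measurable_translate.
by move=> mh A mA _; rewrite [RHS](eq_measure_translate h mA).
Qed.

Lemma integral_translate (f : E -> \bar R) h : measurable_fun setT f ->
  (lebesgue_rV R n).-integrable setT (fun x => f (x + h)) ->
  (\int[lebesgue_rV R n]_x f (x + h)%R = \int[lebesgue_rV R n]_x f x)%E.
Proof.
move=> mf fi.
transitivity (\int[pushforward (lebesgue_rV R n) (fun x => (x + h)%R)]_x f x)%E.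
  by rewrite integral_pushforward//; exact: measurable_translate.
apply: eq_measure_integral; first exact: measurable_translate.
by move=> mh A mA _; rewrite [RHS](eq_measure_translate h mA).
Qed.

End bounded_domain.

(** * Partial derivatives of test functions *)

Section smooth_functions.
Context (R : realType) (n : nat).
Local Notation E := 'rV[R]_n.
Implicit Types f g : E -> R.

Lemma smooth_continuous f : smooth_on setT f -> continuous f.
Proof. by move=> sf x; have [] := sf [::] x I. Qed.

Lemma smooth_partial_continuous f i : smooth_on setT f ->
  continuous ('D_(basis_vec R i) f).
Proof. by move=> sf x; have [] := sf [:: i] x I. Qed.

Lemma smooth_partial_derivable f i : smooth_on setT f ->
  forall x, derivable f x (basis_vec R i).
Proof. by move=> sf x; have [_] := sf [::] x I. Qed.

Lemma partialsB s f g : smooth_on setT f -> smooth_on setT g ->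
  partials s (fun x => f x - g x) = (fun x => partials s f x - partials s g x).
Proof.
move=> sf sg; elim: s => //= i s ->; apply/funext => x.
by rewrite -deriveB//; [have [_] := sf s x I; exact|have [_] := sg s x I; exact].
Qed.

Lemma smoothB f g : smooth_on setT f -> smooth_on setT g ->
  smooth_on setT (fun x => f x - g x).
Proof.
move=> sf sg s x _; rewrite partialsB//.
have [cf df] := sf s x I; have [cg dg] := sg s x I.
split; first exact: (continuousB cf cg).
by move=> i; exact: (derivableB (df i) (dg i)).
Qed.

Lemma smooth_cst (c : R) : smooth_on setT (fun _ : E => c).
Proof.
move=> s x _; have [k ->] : exists k : R, partials s (fun _ : E => c) = cst k.
  elim: s => [|i s [k IH]]; first by exists c.
  by exists 0 => /=; rewrite IH; apply/funext => y; rewrite derive_cst.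
by split; [exact: cst_continuous|move=> i; exact: derivable_cst].
Qed.

Section test.
Context (D : set E) (phi : E -> R) (tphi : test_function D phi) (i : 'I_n).
Local Notation v := (basis_vec R i).
Local Notation vol := (lebesgue_rV R n).

Let sphi : smooth_on setT phi. Proof. exact: tphi.1. Qed.

(** Along a line the directional derivative becomes a one-variable derivative, to which the mean
    value theorem applies. *)
Lemma is_derive_line x (t : R) :
  is_derive t (1 : R) (fun s : R => phi (x + s *: v)) ('D_v phi (x + t *: v)).
Proof.
have E0 : (fun h : R => h^-1 *: ((phi \o shift (x + t *: v)) (h *: v)
      - phi (x + t *: v))) =
   (fun h : R => h^-1 *: (((fun s : R => phi (x + s *: v)) \o shift t) (h *: (1 : R))
      - phi (x + t *: v))).
  apply/funext => h /=; congr (_ *: (phi _ - _)).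
  by rewrite scalerDl addrCA [_ *: 1]mulr1.
apply: DeriveDef; last by rewrite /derive E0.
by have := @smooth_partial_derivable phi i sphi (x + t *: v); rewrite /derivable E0.
Qed.

Lemma increment_bound (B h : R) x : (forall y, `|'D_v phi y| <= B) -> 0 < h ->
  `|phi (x + h *: v) - phi x| <= B * h.
Proof.
move=> hB h0.
have [||c _] := @MVT R (fun s : R => phi (x + s *: v))
  (fun t => 'D_v phi (x + t *: v)) 0 h h0.
- by move=> t _; exact: is_derive_line.
- apply: derivable_within_continuous => t _.
  exact: (@ex_derive _ _ _ _ _ _ _ (is_derive_line x t)).
rewrite scale0r addr0 subr0 => ->.
by rewrite normrM (gtr0_norm h0) ler_wpM2r// ltW.
Qed.

Lemma test_function_bounds : exists M B, [/\ 0 < M, 0 < B,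
  forall x, ~ cube M x -> phi x = 0 & forall x, `|'D_v phi x| <= B /\ `|phi x| <= B].
Proof.
have [_ [K [cK _ K0]]] := tphi.
have [M M0 KM] := bounded_sub_cube (compact_bounded cK).
have phi0 x : ~ cube M x -> phi x = 0 by move=> xM; apply: K0 => /KM.
have D0 x : ~ cube M x -> 'D_v phi x = 0.
  move=> xM; rewrite (@near_eq_derive _ _ _ phi (cst 0)) ?derive_cst//.
  have : open_nbhs x (~` cube M) by split => //; apply: closed_openC; exact: closed_cube.
  by move/open_nbhs_nbhs; apply: filterS => y; exact: phi0.
have [B1 B10 hB1] := compact_bound (@compact_cube R n M)
  (continuous_subspaceT (@smooth_partial_continuous phi i sphi)).
have [B2 B20 hB2] := compact_bound (@compact_cube R n M)
  (continuous_subspaceT (smooth_continuous sphi)).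
exists M, (Num.max B1 B2); split => //; first by rewrite lt_max B10.
move=> x; have [xM|xM] := pselect (cube M x).
  by split; rewrite le_max ?hB1 ?hB2 ?orbT.
by rewrite D0// phi0// !normr0 le_max ltW.
Qed.

Lemma partial_out x : ~ D x -> 'D_v phi x = 0.
Proof.
have [_ [K [cK KD K0]]] := tphi.
move=> Dx; rewrite (@near_eq_derive _ _ _ phi (cst 0)) ?derive_cst//.
have : open_nbhs x (~` K).
  split; last by move=> /KD.
  by apply: closed_openC; apply: compact_closed => //; exact: norm_hausdorff.
by move/open_nbhs_nbhs; apply: filterS => y; exact: K0.
Qed.

(** Difference quotients of [phi] integrate to 0 by translation invariance, and they converge
    boundedly, with supports in one cube, to the partial derivative. This says that constants have
    weak gradient 0. *)
Lemma integral_partial0 : measurable D -> \int[vol]_(x in D) 'D_v phi x = 0.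
Proof.
move=> mD; rewrite Rintegral_mkcond.
have -> : 'D_v phi \_ D = 'D_v phi.
  apply/funext => x; rewrite patchE; case: ifPn => // /negP; rewrite inE => xD.
  by rewrite partial_out.
have [M [B [M0 B0 phi0 hB]]] := test_function_bounds.
pose h k : R := k.+1%:R^-1.
have h_gt0 k : 0 < h k by rewrite invr_gt0.
pose q k (x : E) : R := (h k)^-1 * (phi (x + h k *: v) - phi x).
have mphi : measurable_fun setT phi.
  by apply: continuous_measurable_rV; exact: smooth_continuous.
have mDphi : measurable_fun setT ('D_v phi).
  by apply: continuous_measurable_rV; exact: smooth_partial_continuous.
have iphi : vol.-integrable setT (EFin \o phi).
  by apply: (integrable_bounded_support mphi _ phi0) => x; exact: (hB x).2.
(* The steps [h k] are at most 1, so a cube enlarged by 1 contains the supports of all difference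
   quotients. *)
have out k x : ~ cube (M + 1) x -> ~ cube M x /\ ~ cube M (x + h k *: v).
  move=> xM; split=> xM'; apply: xM => j; first by rewrite (le_trans (xM' j))// lerDl.
  rewrite -[x ord0 j](addrK ((h k *: v) ord0 j)).
  rewrite (le_trans (ler_normB _ _))// lerD//; first by have := xM' j; rewrite mxE.
  rewrite !mxE normrM (gtr0_norm (h_gt0 k)) eqxx/=.
  rewrite -[leRHS]mulr1 ler_pM ?(ltW (h_gt0 k))//; first by rewrite /h invf_le1 ?ler1n.
  by case: (j == i); rewrite ?normr1 ?normr0.
have mphi' k : measurable_fun setT (fun x : E => phi (x + h k *: v)).
  apply: (@measurableT_comp _ _ _ _ _ _ phi) => //.
  exact: measurable_translate.
have iphi' k : vol.-integrable setT (EFin \o (fun x : E => phi (x + h k *: v))).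
  apply: (@integrable_bounded_support _ _ _ B (M + 1)) => //.
    by move=> x; exact: (hB _).2.
  by move=> x /(out k)[_ /phi0].
have q0 k : \int[vol]_x q k x = 0.
  rewrite RintegralZl//; last exact: (integrableB measurableT (iphi' k) iphi).
  rewrite RintegralB// (_ : Rintegral _ _ _ = \int[vol]_x phi x) ?subrr ?mulr0//.
  congr fine; apply: (integral_translate (f := EFin \o phi)); last exact: iphi'.
  exact/measurable_EFinP.
have mq k : measurable_fun setT (q k).
  by apply: measurable_funM => //; exact: measurable_funB.
(* Derivability is a limit over the punctured neighbourhood of 0, hence the positivity of the
   steps. *)
have hcvg : h k @[k --> \oo] --> (0 : R)^'.
  move=> A; rewrite /dnbhs/= /within/= => A0.
  have h0 : h k @[k --> \oo] --> (0 : R) by exact: cvg_harmonic.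
  have [N _ NA] := h0 _ A0; exists N => // k /NA; apply.
  by rewrite gt_eqF ?h_gt0.
have [|||||_ _] := @dominated_convergence _ _ R vol setT measurableT
  (fun k x => (q k x)%:E)
  (fun x => ('D_v phi x)%:E) (fun x => (B * \1_(cube (M + 1)) x)%:E).
- by move=> k; exact/measurable_EFinP.
- exact/measurable_EFinP.
- apply/aeW => x _; apply/fine_cvgP; split; first exact: nearW.
  have := @smooth_partial_derivable phi i sphi x.
  rewrite /derivable => /(cvg_comp _ _ hcvg); apply: cvg_trans.
  apply: near_eq_cvg; apply: nearW => k /=.
  by rewrite /q [x + _]addrC.
- under eq_fun do rewrite EFinM.
  exact: (integrableZl measurableT B (integrable_indic_cube n (M + 1))).
- apply/aeW => x k _; rewrite lee_fin indicE.
  have [xM|/(out k)[xM xM']] := pselect (cube (M + 1) x).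
    rewrite mem_set// mulr1 /q normrM ger0_norm; last by rewrite invr_ge0 ltW.
    by rewrite mulrC ler_pdivrMr// increment_bound// => y; exact: (hB y).1.
  by rewrite /q !phi0// subrr mulr0 normr0 mulr_ge0// ltW.
have -> : [sequence (\int[vol]_x (q k x)%:E)%E]_k = cst 0%E.
  apply/funext => k; rewrite /= -[LHS]fineK ?[fine _](q0 k)//.
  apply: integrable_fin_num => //.
  apply: (integrableZl measurableT (h k)^-1 (integrableB measurableT (iphi' k) iphi)).
by move=> /(cvg_lim (@ereal_hausdorff R)); rewrite lim_cst// /Rintegral => <-.
Qed.

End test.
End smooth_functions.

(** * The solution map *)

(** Squeezed by [(a - b) ^+ 2 <= 2 * a ^+ 2 + 2 * b ^+ 2]. Stated for extended integrals, as
    [is_trace] requires. *)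
Lemma L2_dist_cvgB d (T : measurableType d) (R : realType)
    (mu : {measure set T -> \bar R}) (D : set T) (F G : nat -> T -> R) (f g : T -> R) :
  measurable D -> (forall k, measurable_fun D (F k)) ->
  (forall k, measurable_fun D (G k)) -> measurable_fun D f -> measurable_fun D g ->
  ((fun k => \int[mu]_(x in D) ((F k x - f x) ^+ 2)%:E) @ \oo --> (0 : \bar R))%E ->
  ((fun k => \int[mu]_(x in D) ((G k x - g x) ^+ 2)%:E) @ \oo --> (0 : \bar R))%E ->
  ((fun k => \int[mu]_(x in D) ((F k x - G k x - (f x - g x)) ^+ 2)%:E)
    @ \oo --> (0 : \bar R))%E.
Proof.
move=> mD mF mG mf mg Ff Gg.
pose a k := (\int[mu]_(x in D) ((F k x - f x) ^+ 2)%:E)%E.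
pose b k := (\int[mu]_(x in D) ((G k x - g x) ^+ 2)%:E)%E.
have ub : ((fun k => 2%:E * a k + 2%:E * b k) @ \oo --> (0 : \bar R))%E.
  rewrite -[X in _ --> X]adde0 -[X in (X + _)%E](mule0 2%:E) -[X in (_ + X)%E](mule0 2%:E).
  by apply: cvgeD; [rewrite mule0|exact: cvgeZl|exact: cvgeZl].
apply: (squeeze_cvge _ (cvg_cst 0%E) ub); apply: nearW => k.
have mFf : measurable_fun D (fun x => ((F k x - f x) ^+ 2)%:E).
  by apply/measurable_EFinP; apply: measurable_funX; exact: measurable_funB.
have mGg : measurable_fun D (fun x => ((G k x - g x) ^+ 2)%:E).
  by apply/measurable_EFinP; apply: measurable_funX; exact: measurable_funB.
have sq0 (h : T -> R) x : D x -> (0 <= (h x ^+ 2)%:E)%E by rewrite lee_fin sqr_ge0.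
apply/andP; split; first exact: integral_ge0 (sq0 (fun x => F k x - G k x - (f x - g x))).
rewrite /a /b -!ge0_integralZl//; [|exact: (sq0 (fun x => G k x - g x))
  |exact: (sq0 (fun x => F k x - f x))].
rewrite -ge0_integralD//; first last.
- exact: measurable_funeM.
- by move=> x _; rewrite mule_ge0// lee_fin sqr_ge0.
- exact: measurable_funeM.
- by move=> x _; rewrite mule_ge0// lee_fin sqr_ge0.
apply: ge0_le_integral => //.
- exact: (sq0 (fun x => F k x - G k x - (f x - g x))).
- apply/measurable_EFinP; apply: measurable_funX.
  by apply: measurable_funB; exact: measurable_funB.
- by apply: emeasurable_funD; exact: measurable_funeM.
- move=> x _; rewrite -!EFinM -EFinD lee_fin.
  have := sqr_ge0 ((F k x - f x) + (G k x - g x)).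
  by nra.
Qed.

Section state_space.
Context (R : realType) (n L : nat).
Local Notation E := 'rV[R]_n.+1.
Context (D : set E) (D_open : open D) (D_bounded : bounded_set D).
Context (S : {measure set E -> \bar R}).
Local Notation vol := (lebesgue_rV R n.+1).
Local Notation state := (cem_state R n L).
Implicit Types v w : state.

Let mD : measurable D. Proof. exact: open_measurable_rV. Qed.

Lemma test_function_L2 phi : test_function D phi -> L2 vol D phi.
Proof. by move=> [sphi _]; apply: continuous_L2 => //; exact: smooth_continuous. Qed.

Lemma test_partial_L2 phi i : test_function D phi -> L2 vol D ('D_(basis_vec R i) phi).
Proof.
by move=> [sphi _]; apply: continuous_L2 => //; exact: smooth_partial_continuous.
Qed.

Lemma is_weak_gradientB (v w : E -> R) (gv gw : 'I_n.+1 -> E -> R) :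
  L2 vol D v -> L2 vol D w -> (forall i, L2 vol D (gv i)) ->
  (forall i, L2 vol D (gw i)) ->
  is_weak_gradient D v gv -> is_weak_gradient D w gw ->
  is_weak_gradient D (fun x => v x - w x) (fun i x => gv i x - gw i x).
Proof.
move=> hv hw hgv hgw Gv Gw i phi tphi.
have hp := test_function_L2 tphi; have hdp := test_partial_L2 i tphi.
under eq_Rintegral do rewrite mulrBl.
rewrite RintegralB//; [|exact: L2_mul_integrable..].
under [in RHS]eq_Rintegral do rewrite mulrBl.
rewrite [in RHS]RintegralB//; [|exact: L2_mul_integrable..].
by rewrite Gv// Gw// opprD.
Qed.

Lemma smooth_measurable (A : set E) phi : measurable A -> smooth_on setT phi ->
  measurable_fun A phi.
Proof.
move=> mA sphi; apply: measurable_funTS; apply: continuous_measurable_rV.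
exact: smooth_continuous.
Qed.

Lemma smooth_partial_measurable (A : set E) phi i : measurable A ->
  smooth_on setT phi -> measurable_fun A ('D_(basis_vec R i) phi).
Proof.
move=> mA sphi; apply: measurable_funTS; apply: continuous_measurable_rV.
exact: smooth_partial_continuous.
Qed.

Lemma is_traceB (v w : E -> R) (gv gw : 'I_n.+1 -> E -> R) (tv tw : E -> R) :
  L2 vol D v -> L2 vol D w -> (forall i, L2 vol D (gv i)) ->
  (forall i, L2 vol D (gw i)) ->
  is_trace D S v gv tv -> is_trace D S w gw tw ->
  is_trace D S (fun x => v x - w x) (fun i x => gv i x - gw i x)
    (fun x => tv x - tw x).
Proof.
move=> hv hw hgv hgw [mtv [p [sp pv pgv ptv]]] [mtw [q [sq qw qgw qtw]]].
have mb : measurable (boundary D) by exact: measurable_boundary.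
split; first exact: measurable_funB.
exists (fun k x => p k x - q k x); split.
- by move=> k; exact: smoothB.
- apply: L2_dist_cvgB => //; [..|exact: hv.1|exact: hw.1];
    by move=> k; exact: smooth_measurable.
- move=> i; have := L2_dist_cvgB mD
    (fun k => smooth_partial_measurable i mD (sp k))
    (fun k => smooth_partial_measurable i mD (sq k)) (hgv i).1 (hgw i).1 (pgv i) (qgw i).
  apply: cvg_trans; apply: near_eq_cvg; apply: nearW => k.
  apply: eq_integral => x _; rewrite deriveB//; exact: smooth_partial_derivable.
- by apply: L2_dist_cvgB => // k; exact: smooth_measurable.
Qed.

Lemma in_H_sub v w : in_H D S v -> in_H D S w -> in_H D S (sub_state v w).
Proof.
move=> [hv hgv Gv tv] [hw hgw Gw tw]; split.
- exact: L2B.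
- by move=> i; exact: (L2B mD (hgv i) (hgw i)).
- exact: (is_weak_gradientB hv hw hgv hgw Gv Gw).
- exact: (is_traceB hv hw hgv hgw tv tw).
Qed.

Definition const_state (c : R) : state :=
  CemState (cst c) (fun=> cst 0) (cst c) (\row_l c).

Lemma in_H_const c : in_H D S (const_state c).
Proof.
have Dcst (k : R) : L2 vol D (cst k).
  by apply: continuous_L2 => //; exact: cst_continuous.
split=> /=.
- exact: Dcst.
- by move=> i; exact: Dcst.
- move=> i phi tphi; rewrite RintegralZl//; last first.
    apply: eq_integrable (L2_mul_integrable mD (Dcst 1) (test_partial_L2 i tphi)) => //.
    by move=> x _ /=; rewrite mul1r.
  rewrite integral_partial0// mulr0; under eq_Rintegral do rewrite mul0r.
  by rewrite Rintegral_cst// mul0r oppr0.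
- split; first exact: measurable_cst.
  exists (fun _ => cst c); split=> [k|||].
  + exact: smooth_cst.
  + under eq_fun do under eq_integral do rewrite subrr expr0n/=.
    by under eq_fun do rewrite integral0; exact: cvg_cst.
  + move=> i; under eq_fun do under eq_integral do rewrite derive_cst subrr expr0n/=.
    by under eq_fun do rewrite integral0; exact: cvg_cst.
  + under eq_fun do under eq_integral do rewrite subrr expr0n/=.
    by under eq_fun do rewrite integral0; exact: cvg_cst.
Qed.

(** Adding [c] is subtracting the constant state [- c], so closure under differences is enough. *)
Lemma in_H_shift c v : in_H D S v -> in_H D S (Defs.shift c v).
Proof.
move=> Hv; have := in_H_sub Hv (in_H_const (- c)).
rewrite (_ : sub_state _ _ = Defs.shift c v)//; case: v {Hv} => v g t V.
rewrite /sub_state /Defs.shift/=; congr CemState.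
- by apply/funext => x; rewrite opprK.
- by apply/funext => i; apply/funext => x; rewrite subr0.
- by apply/funext => x; rewrite opprK.
- by apply/rowP => l; rewrite !mxE opprK.
Qed.

Context (e : 'I_L -> set E) (z : 'I_L -> R).

(** The form sees a state only through its gradient and the jumps [trace - voltage], which a common
    shift leaves alone. *)
Lemma weak_solution_shift c sigma I v : weak_solution D S e z sigma I v ->
  weak_solution D S e z sigma I (Defs.shift c v).
Proof.
move=> [Hv sv]; split; first exact: in_H_shift.
move=> w Hw; rewrite -sv// /cem_form; congr (_ + _).
apply: eq_bigr => l _; congr (_ * _); apply: eq_Rintegral => x _ /=.
by rewrite mxE; congr (_ * _); ring.
Qed.

Context (wellposed : cem_wellposed D S e z).

(** [solution_map] is a choice by [xget]; the chosen set is inhabited because any weak solution can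
    be shifted by the mean of its voltages. *)
Lemma solution_mapP sigma I : admissible D sigma -> zero_mean I ->
  weak_solution D S e z sigma I (solution_map D S e z I sigma) /\
  zero_mean (cem_volt (solution_map D S e z I sigma)).
Proof.
move=> asigma I0; have [v [sv _]] := wellposed asigma I0.
have : exists v, weak_solution D S e z sigma I v /\ zero_mean (cem_volt v).
  exists (Defs.shift (- ((\sum_l cem_volt v ord0 l) / L%:R)) v).
  split; first exact: weak_solution_shift.
  rewrite /zero_mean; under eq_bigr do rewrite mxE.
  rewrite big_split/= sumr_const card_ord.
  (* Without electrodes the mean divides by 0, but the sum of voltages is empty. *)
  have [L0|L_gt0] := posnP L.
    rewrite big1 ?add0r => [|i _]; last by have := ltn_ord i; rewrite [X in (_ < X)%N]L0.
    by rewrite mul0r oppr0 mul0rn.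
  by rewrite mulNrn -[X in _ - X]mulr_natr divfK ?subrr// pnatr_eq0 -lt0n.
by move=> /(xgetPex (zero_state R n L)).
Qed.

Context (norms : star_norm_equivalent D S e).
Context (e_meas : forall l, measurable (e l)).
Context (e_boundary : forall l, e l `<=` boundary D).
Context (zplus : R) (z_bound : forall l, 0 < z l <= zplus).

(** The stability estimate involves the gradient of only one of the two solutions. Taking the limit
    solution for it makes the dominating function [b ^+ 2 * |grad v| ^+ 2] independent of [k]. *)
Lemma solution_map_cvg I (s_ : nat -> E -> R) s a b : zero_mean I -> 0 < a ->
  (forall k, admissible D (s_ k)) -> admissible D s ->
  (forall k x, D x -> a <= s_ k x <= b) -> (forall x, D x -> a <= s x <= b) ->
  {ae vol, forall x, D x -> s_ k x @[k --> \oo] --> s x} ->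
  forall l, cem_volt (solution_map D S e z I (s_ k)) ord0 l @[k --> \oo] -->
    cem_volt (solution_map D S e z I s) ord0 l.
Proof.
move=> I0 a0 adm_ adm bnd_ bnd ss l.
have cond t : admissible D t -> (forall x, D x -> a <= t x <= b) ->
    conductivity_on D t a b.
  move=> [mt _ _] ht; split => //; apply: measurable_funS mt.
    by apply: closed_measurable_rV; exact: closed_closure.
  exact: subset_closure.
have [sol v0] := solution_mapP adm I0.
have {}sol_ k := solution_mapP (adm_ k) I0.
have [c [c' [c0 _ hc]]] := norms.
set v := solution_map _ _ _ _ _ s in sol v0 *.
have fv : finite_energy D S e v by apply: in_H_finite_energy => //; exact: sol.1.
(* Without electrodes the bound on [z] says nothing about the sign of [zplus]; the maximum is
   positive in all cases. *)
pose p := Num.max zplus 1.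
have p0 : 0 < p by rewrite lt_max ltr01 orbT.
have zp i : 0 < z i <= p.
  by have /andP[z0 zz] := z_bound i; rewrite z0 le_max zz.
pose K := ((Num.min a p^-1) ^- 2).
pose f k x := (s x - s_ k x) ^+ 2 * \sum_(i < n.+1) cem_grad v i x ^+ 2.
have iV : vol.-integrable D (EFin \o (fun x => \sum_(i < n.+1) cem_grad v i x ^+ 2)).
  by apply: sum_integrable => // i; exact: L2_sqr_integrable (fv.1 i).
have sq_le k x : D x -> (s x - s_ k x) ^+ 2 <= b ^+ 2.
  move=> Dx; have /andP[h1 h2] := bnd_ k x Dx; have /andP[h3 h4] := bnd x Dx.
  rewrite -real_normK ?num_real// lerXn2r ?nnegrE//.
    by rewrite (le_trans (ltW a0))// (le_trans h1).
  by rewrite ler_norml; apply/andP; split; lra.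
have mf k : measurable_fun D (f k).
  apply: measurable_funM; last by apply/measurable_EFinP; exact: measurable_int iV.
  by apply: measurable_funX; apply: measurable_funB; [exact: (cond _ adm bnd).1
    |exact: (cond _ (adm_ k) (bnd_ k)).1].
have bound k : c * (cem_volt (solution_map D S e z I (s_ k)) ord0 l
    - cem_volt v ord0 l) ^+ 2 <= K * \int[vol]_(x in D) f k x.
  have := voltage_stability D_open e_meas e_boundary norms a0 p0 (cond _ adm bnd)
    (cond _ (adm_ k) (bnd_ k)) zp (in_H_sub (sol_ k).1.1 sol.1) sol (sol_ k).1 v0
    (sol_ k).2 c0.
  move=> /(_ (fun w Hw => proj1 (elimT andP (hc w Hw)))); apply: le_trans.
  apply: ler_wpM2l; first exact: ltW.
  rewrite (bigD1 l)//= lerDl.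
  by apply: sumr_ge0 => i _; exact: sqr_ge0.
have Qcvg : \int[vol]_(x in D) f k x @[k --> \oo] --> (0 : R).
  have [|||||_ _] := @dominated_convergence _ _ R vol D mD
    (fun k x => (f k x)%:E) (cst 0%E)
    (fun x => ((b ^+ 2)%:E * (\sum_(i < n.+1) cem_grad v i x ^+ 2)%:E)%E).
  - by move=> k; exact/measurable_EFinP.
  - exact: measurable_cst.
  - move: ss; apply: filterS => x /[swap] Dx /(_ Dx) sx.
    apply/fine_cvgP; split; first exact: nearW.
    have sk : s x - s_ k x @[k --> \oo] --> s x - s x by exact: (cvgB (cvg_cst _) sx).
    rewrite subrr in sk.
    have H := cvgM (cvgM sk sk) (cvg_cst (\sum_(i < n.+1) cem_grad v i x ^+ 2)).
    rewrite !mul0r in H; have -> : fine \o (fun k => (f k x)%:E) =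
      (fun k => (s x - s_ k x) * (s x - s_ k x) * \sum_(i < n.+1) cem_grad v i x ^+ 2).
      by apply/funext => k /=; rewrite /f expr2.
    exact: H.
  - exact: (integrableZl mD (b ^+ 2) iV).
  - apply/aeW => x k Dx; rewrite -EFinM lee_fin /f ger0_norm.
      by rewrite ler_wpM2r ?sq_le//; apply: sumr_ge0 => i _; exact: sqr_ge0.
    by rewrite mulr_ge0 ?sqr_ge0//; apply: sumr_ge0 => i _; exact: sqr_ge0.
  by rewrite integral0 => /fine_cvgP[_].
apply/cvgrPdist_lt => eps eps0.
have KQ : K * \int[vol]_(x in D) f k x @[k --> \oo] --> (0 : R).
  by rewrite -(mulr0 K); exact: cvgMr.
have ce0 : 0 < c * eps ^+ 2 by rewrite mulr_gt0 ?exprn_gt0.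
move/cvgr0Pnorm_lt : KQ => /(_ _ ce0); apply: filterS => k hk.
have eps_ge0 := ltW eps0.
rewrite distrC -(ltr_pXn2r (ltn0Sn 1)) ?nnegrE// real_normK ?num_real//.
rewrite -(ltr_pM2l c0) (le_lt_trans (bound k))// (le_lt_trans _ hk)//.
exact: ler_norm.
Qed.

End state_space.

(** * Interpolating level-set functions *)

Section borel_metric.
Context (R : realType) (X : pointedType) (dist : X -> X -> R).

(** The preimage of an open interval is itself [dist_open]: a point with no ball inside it would
    yield, by choice, a sequence approaching at rate [k.+1%:R^-1] with values outside the interval.
    Prescribing the rate avoids a separate notion of convergence on [X]. *)
Lemma seq_continuous_measurable (g : X -> R) :
  (forall p (p_ : nat -> X), (forall k, dist p (p_ k) < k.+1%:R^-1) ->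
     g (p_ k) @[k --> \oo] --> g p) ->
  measurable_fun setT (g : borel dist -> R).
Proof.
move=> gc; apply: (measurability _ (RGenOpens.measurableE R)).
move=> _ [_ [a [b ->] <-]]; rewrite setTI; apply: sub_sigma_algebra => p /= gp.
apply: contrapT => noball.
have /choice[p_ Hp] k : exists q, dist p q < k.+1%:R^-1 /\ ~ `]a, b[%classic (g q).
  apply: contrapT => noq; apply: noball; exists k.+1%:R^-1; first by rewrite invr_gt0.
  by move=> q pq; apply: contrapT => gq; apply: noq; exists q.
have : \forall k \near \oo, `]a, b[%classic (g (p_ k)).
  apply: (gc p p_ (fun k => (Hp k).1)).
  by apply: open_nbhs_nbhs; split => //; exact: interval_open.
by case=> N _ /(_ N (leqnn N)); exact: (Hp N).2.
Qed.

End borel_metric.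

Section ramp.
Context (R : realType).
Implicit Types (c : \bar R) (s r : R).

(* Continuous in s, nonincreasing in c, and tends to the indicator of c <= s. *)
Definition ramp (m : nat) c s : R :=
  match c with
  | r%:E => Num.min 1 (Num.max 0 (1 + m%:R * (s - r)))
  | +oo%E => 0
  | -oo%E => 1
  end.

Lemma ramp_ge0 m c s : 0 <= ramp m c s.
Proof. by case: c => [r||] //=; rewrite le_min ler01 le_max lexx. Qed.

Lemma ramp_le1 m c s : ramp m c s <= 1.
Proof. by case: c => [r||] //=; rewrite ge_min lexx. Qed.

Lemma ramp_le m c c' s : (c <= c')%E -> ramp m c' s <= ramp m c s.
Proof.
move=> cc'; have := ramp_ge0 m c s; have := ramp_le1 m c' s.
case: c cc' => [r||]; case: c' => [r'||] //= + _ _.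
rewrite lee_fin => rr'; rewrite le_min !ge_min lexx/=; apply/orP; right.
rewrite ge_max !le_max lexx/=; apply/orP; right.
by rewrite lerD2l ler_wpM2l// lerD2l lerN2.
Qed.

Lemma ramp_continuous m c : continuous (ramp m c).
Proof.
case: c => [r||] s; [|exact: cst_continuous..].
apply: (@continuous_min _ _ (cst 1) (fun s => Num.max 0 (1 + m%:R * (s - r)))).
  exact: cst_continuous.
apply: (@continuous_max _ _ (cst 0) (fun s => 1 + m%:R * (s - r))).
  exact: cst_continuous.
apply: continuousD; first exact: cst_continuous.
apply: continuousM; first exact: cst_continuous.
by apply: continuousB => //; exact: cst_continuous.
Qed.

(** The ramp rises to the left of [r] and is already 1 at [r], so its limit carries the non-strict
    inequality with which the levels are defined. *)
Lemma ramp_cvg c s : ramp m c s @[m --> \oo] --> (((c <= s%:E)%E)%:R : R).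
Proof.
case: c => [r||]; last 2 first.
- exact: cvg_cst.
- by rewrite leNye; exact: cvg_cst.
rewrite lee_fin /=; have [rs|sr] := leP r s.
  have -> : (fun m : nat => Num.min 1 (Num.max 0 (1 + m%:R * (s - r)))) = cst 1.
    apply/funext => m /=; apply: min_l; rewrite le_max lerDl mulr_ge0 ?orbT//.
    by rewrite subr_ge0.
  exact: cvg_cst.
apply: cvg_near_cst.
have [N hN] : exists N : nat, (r - s)^-1 < N%:R.
  by exists (Num.truncn (r - s)^-1).+1; rewrite truncnS_gt.
exists N => // m /= Nm; rewrite (max_l (y := _ + _)) ?min_r//.
have rs : 0 < r - s by rewrite subr_gt0.
rewrite -opprB mulrN subr_le0 -ler_pdivrMr// div1r (le_trans (ltW hN))//.
by rewrite ler_nat.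
Qed.

End ramp.

Section mix.
Context (R : realType) (k : nat) (c : nat -> \bar R).
Context (c0 : c 0%N = -oo%E) (ck : c k = +oo%E).
Context (c_lt : forall i, (i < k)%N -> (c i < c i.+1)%E).

(* Approximates [\sum_i f i * [c i <= s < c i.+1]]; the factor with d switches
   the dependence on s off where d = 0. *)
Definition mix (m : nat) (f : 'I_k -> R) (d s : R) : R :=
  1 + Num.min 1 (m%:R * d) *
    (\sum_(i < k) f i * (ramp m (c i) s - ramp m (c i.+1) s) - 1).

Definition level_value (f : 'I_k -> R) (s : R) : R :=
  \sum_(i < k) f i * ((c i <= s%:E < c i.+1)%E)%:R.

Lemma ramp_diff_ge0 m (i : 'I_k) s : 0 <= ramp m (c i) s - ramp m (c i.+1) s.
Proof. by rewrite subr_ge0 ramp_le// ltW// c_lt. Qed.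

(** Telescoping between the ramp at -oo, which is 1, and the ramp at +oo, which is 0. The
    differences are thus a partition of unity, and [mix] is a convex combination of 1 and the [f i],
    which is where its bounds come from. *)
Lemma sum_ramp_diff m s : \sum_(i < k) (ramp m (c i) s - ramp m (c i.+1) s) = 1.
Proof.
have := telescope_sumr (fun i => - ramp m (c i) s) (leq0n k).
rewrite c0 ck /= big_mkord oppr0 sub0r opprK => <-.
by apply: eq_bigr => i _; rewrite opprK addrC.
Qed.

Lemma mix_bounds m f d s a b : 0 <= d -> a <= 1 <= b ->
  (forall i, a <= f i <= b) -> a <= mix m f d s <= b.
Proof.
move=> d0 /andP[a1 b1] fab; rewrite /mix.
set t := Num.min _ _; set S := \sum_(i < k) _.
have t0 : 0 <= t by rewrite le_min ler01 mulr_ge0.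
have t1 : t <= 1 by rewrite ge_min lexx.
have aS : a <= S.
  rewrite -[a]mulr1 -(sum_ramp_diff m s) mulr_sumr; apply: ler_sum => i _.
  by apply: ler_wpM2r; [exact: ramp_diff_ge0|have /andP[] := fab i].
have Sb : S <= b.
  rewrite -[b]mulr1 -(sum_ramp_diff m s) mulr_sumr; apply: ler_sum => i _.
  by apply: ler_wpM2r; [exact: ramp_diff_ge0|have /andP[] := fab i].
by apply/andP; split; nra.
Qed.

(** Where [d > 0] all ingredients converge. Where [d = 0] the argument [s_] may jump, but the switch
    tends to 0 and its cofactor stays below [\sum_i |f i| + 1]. *)
Lemma mix_continuous m (T : Type) (F : set_system T) (FF : Filter F)
    (f_ : T -> 'I_k -> R) (d_ s_ : T -> R) (f : 'I_k -> R) (d s : R) :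
  0 <= d -> (forall x, 0 <= d_ x) ->
  (forall i, f_ x i @[x --> F] --> f i) -> d_ x @[x --> F] --> d ->
  (0 < d -> s_ x @[x --> F] --> s) ->
  mix m (f_ x) (d_ x) (s_ x) @[x --> F] --> mix m f d s.
Proof.
move=> d_ge0 d_0 ff dd ss.
have tt : Num.min 1 (m%:R * d_ x) @[x --> F] --> Num.min 1 (m%:R * d).
  apply: (@continuous_cvg _ _ _ _ FF d_ (fun y : R => Num.min 1 (m%:R * y)) d) => //.
  apply: (@continuous_min R R (cst 1) (fun y : R => m%:R * y)); first exact: cst_continuous.
  by apply: continuousM => //; exact: cst_continuous.
rewrite /mix; apply: cvgD; first exact: cvg_cst.
have [d_gt0|] := ltP 0 d.
  apply: cvgM => //; apply: cvgB; last exact: cvg_cst.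
  apply: cvg_big => [|i _]; first exact: add_continuous.
  apply: cvgM => //; apply: cvgB;
    apply: (continuous_cvg _ _ (ss d_gt0)); exact: ramp_continuous.
move=> d_le0; have d0 : d = 0 by apply/eqP; rewrite eq_le d_le0.
rewrite d0 mulr0 min_r// mul0r in tt *.
apply: norm_cvg0.
have ub : Num.min 1 (m%:R * d_ x) * (\sum_(i < k) `|f_ x i| + 1) @[x --> F] -->
    0 * (\sum_(i < k) `|f i| + 1).
  apply: cvgM => //; apply: cvgD; last exact: cvg_cst.
  by apply: cvg_big => [|i _]; [exact: add_continuous|exact: cvg_norm].
rewrite mul0r in ub; apply: (squeeze_cvgr _ (cvg_cst 0) ub); apply: nearW => x.
rewrite normr_ge0/= normrM ger0_norm; last by rewrite le_min ler01 mulr_ge0.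
rewrite ler_wpM2l//; first by rewrite le_min ler01 mulr_ge0.
rewrite (le_trans (ler_normB _ _))// normr1 lerD2r.
apply: le_trans (ler_norm_sum _ _ _) _; apply: ler_sum => i _.
rewrite normrM (ger0_norm (ramp_diff_ge0 _ _ _)) ler_piMr//.
by rewrite lerBlDr (le_trans (ramp_le1 _ _ _))// lerDl ramp_ge0.
Qed.

Lemma mix_cvg (f : 'I_k -> R) (d s : R) : 0 < d -> mix m f d s @[m --> \oo] --> level_value f s.
Proof.
move=> d0; rewrite /mix.
have t1 : Num.min 1 (m%:R * d) @[m --> \oo] --> (1 : R).
  apply: cvg_near_cst.
  have [N hN] : exists N : nat, d^-1 < N%:R.
    by exists (Num.truncn d^-1).+1; rewrite truncnS_gt.
  exists N => // m /= Nm; apply: min_l.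
  by rewrite -ler_pdivrMr// div1r (le_trans (ltW hN))// ler_nat.
rewrite [X in _ --> X](_ : _ = 1 + 1 * (level_value f s - 1)); last by ring.
apply: cvgD; first exact: cvg_cst.
apply: cvgM => //; apply: cvgB; last exact: cvg_cst.
apply: cvg_big => [|i _]; first exact: add_continuous.
apply: cvgM; first exact: cvg_cst.
have cc : (c i < c i.+1)%E by exact: c_lt.
(* Thresholds increase, so the indicator of a half-open level is the difference of two threshold
   indicators. *)
rewrite [X in _ --> X](_ : _ = ((c i <= s%:E)%E)%:R - ((c i.+1 <= s%:E)%E)%:R).
  by apply: cvgB; exact: ramp_cvg.
rewrite ltNge; have [h1|h1] := boolP (c i.+1 <= s%:E)%E; rewrite ?andbF ?andbT ?subr0//.
by rewrite (le_trans (ltW cc) h1) subrr.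
Qed.

Lemma level_unique s (i j : 'I_k) : (c i <= s%:E < c i.+1)%E ->
  (c j <= s%:E < c j.+1)%E -> i = j.
Proof.
move=> /andP[i1 i2] /andP[j1 j2].
have c_le (p q : nat) : (p <= q <= k)%N -> (c p <= c q)%E.
  move=> /andP[pq qk]; elim: q pq qk => [|q IH]; first by rewrite leqn0 => /eqP ->.
  rewrite leq_eqVlt => /predU1P[-> //|pq qk].
  by rewrite (le_trans (IH pq (ltnW qk)))// ltW// c_lt.
have [ij|ij|ij] := ltngtP i j; last exact/val_inj.
- have := lt_le_trans i2 (le_trans (c_le i.+1 j _) j1).
  by rewrite ltxx ij (ltnW (ltn_ord j)) => /(_ isT).
- have := lt_le_trans j2 (le_trans (c_le j.+1 i _) i1).
  by rewrite ltxx ij (ltnW (ltn_ord i)) => /(_ isT).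
Qed.

Lemma level_value_eq f s (i : 'I_k) : (c i <= s%:E < c i.+1)%E -> level_value f s = f i.
Proof.
move=> si; rewrite /level_value (bigD1 i)//= si mulr1 big1 ?addr0// => j ji.
suff -> : (c j <= s%:E < c j.+1)%E = false by rewrite mulr0.
by apply/negP => sj; move/eqP: ji; apply; exact: level_unique sj si.
Qed.

Lemma level_exists s : exists i : 'I_k, (c i <= s%:E < c i.+1)%E.
Proof.
have : exists i, (i <= k)%N && (s%:E < c i)%E by exists k; rewrite leqnn ck ltry.
(* The level ends at the first threshold above [s], which cannot be [c 0], equal to -oo. *)
move=> /ex_minnP[[|i] /andP[ik si] imin]; first by rewrite c0 in si.
exists (Ordinal ik) => /=; rewrite si andbT leNgt; apply/negP => si'.
by have := imin i; rewrite (ltnW ik) si' ltnn => /(_ isT).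
Qed.

End mix.

(** * Measurability of the forward maps *)

(** One number [b] dominates 1, all [f i] and all their inverses, and [a] is its inverse. The value
    1 lies between the bounds because [mix] takes it where the switch is off. *)
Lemma positive_continuous_bounds (R : realType) (T : topologicalType) (K : set T)
    (k : nat) (f : 'I_k -> T -> R) : compact K ->
  (forall i, {within K, continuous (f i)}) -> (forall i x, K x -> 0 < f i x) ->
  exists a b : R, [/\ 0 < a, a <= 1 <= b & forall i x, K x -> a <= f i x <= b].
Proof.
move=> cK cf f0.
have [K0|/set0P/negP/negPn/eqP K0] := pselect (K !=set0); last first.
  by exists 1, 1; rewrite lexx; split => // i x; rewrite K0.
have bi i : {b : R | 0 <= b & forall x, K x -> f i x <= b /\ (f i x)^-1 <= b}.
  apply: cid2.
  have [B B0 fB] := compact_bound cK (cf i).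
  have [y /set_mem Ky fy] := compact_EVT_min K0 cK (cf i).
  exists (B + (f i y)^-1) => [|x Kx]; first by rewrite addr_ge0 ?ltW ?invr_gt0 ?f0.
  split; first by rewrite (le_trans (ler_norm _))// (le_trans (fB x Kx))// lerDl
    invr_ge0 ltW ?f0.
  have : (f i x)^-1 <= (f i y)^-1 by rewrite lef_pV2 ?posrE ?f0// fy// mem_set.
  by move/le_trans; apply; rewrite lerDr ltW.
pose b := 1 + \sum_i s2val (bi i).
have b1 : 1 <= b by rewrite lerDl; apply: sumr_ge0 => i _; exact: (s2valP (bi i)).
have ib i : s2val (bi i) <= b.
  rewrite /b (bigD1 i)//= addrCA lerDl addr_ge0//; apply: sumr_ge0 => j _.
  exact: (s2valP (bi j)).
have b_gt0 : 0 < b by rewrite (lt_le_trans ltr01).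
exists b^-1, b; split; first by rewrite invr_gt0.
  by rewrite b1 invf_le1// b1.
move=> i x Kx; have [h1 h2] := s2valP' (bi i) x Kx.
rewrite (le_trans h1 (ib i)) andbT -[leRHS]invrK lef_pV2 ?posrE ?invr_gt0 ?f0//.
exact: le_trans h2 (ib i).
Qed.

Section forward_measurability.
Context (R : realType) (n L : nat).
Local Notation E := 'rV[R]_n.+1.
Context (D : set E) (D_open : open D) (D_bounded : bounded_set D).
Context (S : {measure set E -> \bar R}) (e : 'I_L -> set E) (z : 'I_L -> R).
Context (e_meas : forall l, measurable (e l)).
Context (e_boundary : forall l, e l `<=` boundary D).
Context (zplus : R) (z_bound : forall l, 0 < z l <= zplus).
Context (norms : star_norm_equivalent D S e) (wellposed : cem_wellposed D S e z).
Local Notation vol := (lebesgue_rV R n.+1).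
Local Notation volt I sigma := (cem_volt (solution_map D S e z I sigma)).

Lemma continuous_admissible (s : E -> R) (a b : R) : 0 < a ->
  {within closure D, continuous s} -> (forall x, closure D x -> a <= s x <= b) ->
  admissible D s.
Proof.
move=> a0 cs sab; split; last by exists a, b.
- apply: within_continuous_measurable_rV => //.
  by apply: closed_measurable_rV; exact: closed_closure.
- exists 1%N, (fun=> D); split.
  + by move=> _; split.
  + by move=> i j; rewrite (ord1 i) (ord1 j) eqxx.
  + by apply/seteqP; split=> [x Dx|x [i _]//]; exists ord0.
  + by move=> _; exists s.
Qed.

Context (I : 'rV[R]_L) (I_mean : zero_mean I).

(** The bounds may depend on the sequence, since log-Gaussian fields have none in common. *)
Lemma volt_measurable_continuous (X : pointedType) (dist : X -> X -> R)
    (F : X -> E -> R) : (forall p, admissible D (F p)) ->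
  (forall p (p_ : nat -> X), (forall k, dist p (p_ k) < k.+1%:R^-1) ->
     exists a b : R, [/\ 0 < a, forall k x, D x -> a <= F (p_ k) x <= b,
       forall x, D x -> a <= F p x <= b &
       {ae vol, forall x, D x -> F (p_ k) x @[k --> \oo] --> F p x}]) ->
  forall l, measurable_fun setT (fun p : borel dist => volt I (F p) ord0 l).
Proof.
move=> adm cvg l; apply: seq_continuous_measurable => p p_ pp.
have [a [b [a0 ab_ ab ae]]] := cvg p p_ pp.
exact: (solution_map_cvg D_open D_bounded wellposed norms e_meas e_boundary z_bound
  I_mean a0 (fun k => adm (p_ k)) (adm p) ab_ ab ae).
Qed.

Lemma volt_measurable_limit d (X : measurableType d)
    (F_ : nat -> X -> E -> R) (F : X -> E -> R) (a b : R) : 0 < a ->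
  (forall m p, admissible D (F_ m p)) -> (forall p, admissible D (F p)) ->
  (forall m p x, D x -> a <= F_ m p x <= b) -> (forall p x, D x -> a <= F p x <= b) ->
  (forall p, {ae vol, forall x, D x -> F_ m p x @[m --> \oo] --> F p x}) ->
  (forall m l, measurable_fun setT (fun p => volt I (F_ m p) ord0 l)) ->
  forall l, measurable_fun setT (fun p => volt I (F p) ord0 l).
Proof.
move=> a0 adm_ adm ab_ ab ae mF l.
apply: (@measurable_fun_cvg _ _ _ setT (fun m p => volt I (F_ m p) ord0 l)) => // p _.
exact: (solution_map_cvg D_open D_bounded wellposed norms e_meas e_boundary z_bound
  I_mean a0 (adm_^~ p) (adm p) (ab_^~ p) (ab p) (ae p)).
Qed.

(** * Fields given by the levels of a function [g] that is continuous where a switch [d] is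
    positive *)

Section level.
Context (X : pointedType) (dist : X -> X -> R).
Context (k : nat) (c : nat -> \bar R).
Context (c0 : c 0%N = -oo%E) (ck : c k = +oo%E).
Context (c_lt : forall i, (i < k)%N -> (c i < c i.+1)%E).
Context (f : 'I_k -> E -> R) (g d F : X -> E -> R).
Context (f_continuous : forall i, {within closure D, continuous (f i)}).
Context (f_gt0 : forall i x, closure D x -> 0 < f i x).
Context (d_ge0 : forall p x, 0 <= d p x).
Context (d_continuous : forall p, {within closure D, continuous (d p)}).
Context (g_continuous : forall p x, closure D x -> 0 < d p x ->
  g p y @[y --> within (closure D) (nbhs x)] --> g p x).
Context (dg_continuous : forall p (p_ : nat -> X),
  (forall k, dist p (p_ k) < k.+1%:R^-1) -> forall x, D x ->
  d (p_ k) x @[k --> \oo] --> d p x /\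
  (0 < d p x -> g (p_ k) x @[k --> \oo] --> g p x)).
Context (d_ae : forall p, {ae vol, forall x, D x -> 0 < d p x}).
Context (d_dense : forall p, D `<=` closure (D `&` [set x | 0 < d p x])).
Context (F_level : forall p x, D x -> 0 < d p x ->
  F p x = level_value c (f^~ x) (g p x)).
Context (F_range : forall p x, closure D x -> exists i, F p x = f i x).
Context (F_measurable : forall p, measurable_fun (closure D) (F p)).

Let regular p : set E := D `&` [set x | 0 < d p x].

Let sub_closure x : D x -> closure D x.
Proof. exact: subset_closure. Qed.

Let closure_nbhs x : D x -> nbhs x (closure D).
Proof.
by move=> Dx; apply: (filterS sub_closure); exact: open_nbhs_nbhs.
Qed.

Lemma open_regular p : open (regular p).
Proof.
rewrite openE => x [Dx dx]; apply: filterI; first exact: open_nbhs_nbhs.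
have /subspace_continuousP/(_ x (sub_closure Dx)) := @d_continuous p.
rewrite within_interior; last exact: closure_nbhs.
by move/cvgr_gt; apply.
Qed.

Lemma near_below p x t : regular p x -> ((g p x)%:E < t)%E ->
  \forall y \near x, ((g p y)%:E < t)%E.
Proof.
move=> [Dx dx]; have := @g_continuous _ _ (sub_closure Dx) dx.
rewrite within_interior; last exact: closure_nbhs.
case: t => [r|_ _|_]; last by rewrite ltNge leNye.
  move=> /cvgr_lt gx; rewrite lte_fin => /gx; apply: filterS => y.
  by rewrite lte_fin.
by apply: (@filterE _ (nbhs x)) => y; rewrite ltry.
Qed.

Let piece p (i : 'I_k) : set E :=
  regular p `&` [set x | (c i <= (g p x)%:E < c i.+1)%E].

(** Induction on a threshold bounding [g] from above on [W]. Either the part of [W] strictly below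
    the previous threshold, an open set, is nonempty and the induction continues there, or all of
    [W] lies in one level and is interior to that piece. This is how a fat set where [g] equals a
    threshold is covered. *)
Lemma piece_meets p i (W : set E) : (i <= k)%N -> open W -> W !=set0 ->
  W `<=` regular p -> (forall x, W x -> ((g p x)%:E < c i)%E) ->
  exists j, W `&` (piece p j)° !=set0.
Proof.
elim: i W => [|i IH] W ik oW [x Wx] Wp Wc.
  by have := Wc x Wx; rewrite c0 ltNge leNye.
have [V0|V0] := pselect (W `&` [set y | ((g p y)%:E < c i)%E] !=set0).
  have [||||j [y [[Wy _] jy]]] := IH (W `&` [set y | ((g p y)%:E < c i)%E]) (ltnW ik).
  - rewrite openE => y [Wy gy]; apply: filterI; first exact: open_nbhs_nbhs.
    by apply: near_below gy; exact: Wp.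
  - exact: V0.
  - by move=> y [/Wp].
  - by move=> y [].
  - by exists j, y.
exists (Ordinal ik), x; split => //.
rewrite /interior; apply: filterS (open_nbhs_nbhs (conj oW Wx)) => y Wy.
split; first exact: Wp.
rewrite /= Wc// andbT leNgt; apply/negP => gy.
by apply: V0; exists y.
Qed.

Lemma level_admissible p : admissible D (F p).
Proof.
have [a [b [a0 _ fab]]] := positive_continuous_bounds (compact_closure D_bounded)
  f_continuous f_gt0.
split => //; last first.
  by exists a, b; split => // x Dx; have [i ->] := @F_range p x Dx; exact: fab.
exists k, (fun i => (piece p i)°); split.
- by move=> i; split; [exact: open_interior|move=> x /interior_subset[[]]].
- move=> i j ij; apply/seteqP; split => // x [/interior_subset[_ xi]].
  by move=> /interior_subset[_ xj]; move/eqP: ij; apply; exact: (level_unique c_lt xi xj).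
- apply/seteqP; split=> [x Dx|x [i _]]; last first.
    by apply: closureS => y /interior_subset[[]].
  (* Otherwise some open set around [x] misses all pieces; it meets [D], then the regular points by
     density, and then a piece by [piece_meets]. *)
  apply: contrapT => xU.
  have xV : nbhs x (~` \bigcup_i closure (piece p i)°).
    apply: open_nbhs_nbhs; split => //; apply: closed_openC.
    apply: closed_bigcup => [|i _]; first exact: finite_finset.
    exact: closed_closure.
  have [y [Dy Vy]] := Dx _ (nbhs_interior xV).
  have [w [[Dw dw] Vw]] := @d_dense p y Dy _ (open_nbhs_nbhs (conj (@open_interior _ _) Vy)).
  have [|||v [Vv rv]|j [v [[Vv _] jv]]] := @piece_meets p k
    ((~` \bigcup_i closure (piece p i)°)° `&` regular p) (leqnn k).
  + by apply: openI; [exact: open_interior|exact: open_regular].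
  + by exists w.
  + by move=> v [].
  + by rewrite ck ltry.
  + by apply: (interior_subset Vv); exists j => //; exact: subset_closure.
- move=> i; exists (f i); split.
    apply: (continuous_subspaceW _ (@f_continuous i)).
    by apply: closureS => y /interior_subset[[]].
  move=> x /interior_subset[[Dx dx] xi]; rewrite F_level//.
  exact: (level_value_eq c_lt).
Qed.

(** For fixed [m] the ramped field is continuous in [x], hence admissible, and continuous in [p],
    hence has measurable voltages; then [m] tends to infinity. The bounds come from [f] alone, so
    they are uniform in [m] and [p]. *)
Lemma level_volt_measurable l :
  measurable_fun setT (fun p : borel dist => volt I (F p) ord0 l).
Proof.
have [a [b [a0 ab1 fab]]] := positive_continuous_bounds (compact_closure D_bounded)
  f_continuous f_gt0.
pose F_ m p x := mix c m (f^~ x) (d p x) (g p x).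
have F_ab m p x : closure D x -> a <= F_ m p x <= b.
  by move=> Dx; apply: mix_bounds => // i; exact: fab.
have F_adm m p : admissible D (F_ m p).
  apply: (continuous_admissible a0 _ (F_ab m p)).
  apply/subspace_continuousP => x Dx; apply: mix_continuous => //.
  - by move=> i; have /subspace_continuousP := @f_continuous i; exact.
  - by have /subspace_continuousP := @d_continuous p; exact.
  - exact: g_continuous.
apply: (@volt_measurable_limit _ (borel dist) F_ F a b a0) => //.
- exact: level_admissible.
- by move=> m p x /subset_closure; exact: F_ab.
- by move=> p x /subset_closure Dx; have [i ->] := @F_range p x Dx; exact: fab.
- move=> p; move: (@d_ae p); apply: filterS => x dx Dx.
  by rewrite (F_level Dx (dx Dx)); apply: mix_cvg => //; exact: dx.
move=> m l'; apply: volt_measurable_continuous => // p p_ pp.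
exists a, b; split => //.
- by move=> j x /subset_closure; exact: F_ab.
- by move=> x /subset_closure; exact: F_ab.
- apply/aeW => x Dx; have [dd gg] := @dg_continuous _ _ pp _ Dx.
  by apply: mix_continuous => // i; exact: cvg_cst.
Qed.

End level.

End forward_measurability.

(** * From the norms of the prior spaces to pointwise convergence *)

Section sup_norms.
Context (R : realType).

(** The real [sup] is an upper bound only of sets that are bounded, hence the preliminary bound
    [M]. *)
Lemma le_sup_norm (T : Type) (K : set T) (f : T -> R) (M : R) x :
  (forall y, K y -> `|f y| <= M) -> K x -> `|f x| <= sup_norm K f.
Proof.
move=> fM Kx; apply: ub_le_sup; last by exists x.
by exists M => _ [y Ky <-]; exact: fM.
Qed.

Lemma C0_dist_ge (T : topologicalType) (K : set T) (u v : C0 R K) x :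
  compact K -> K x -> `|u x - v x| <= C0_dist u v.
Proof.
move=> cK Kx.
have [B1 _ uB] := compact_bound cK (@C0_continuous _ _ _ u).
have [B2 _ vB] := compact_bound cK (@C0_continuous _ _ _ v).
apply: (@le_sup_norm _ K (fun x => u x - v x) (B1 + B2)) => // y Ky.
by rewrite (le_trans (ler_normB _ _))// lerD// ?uB ?vB.
Qed.

Lemma rate_cvg (u : nat -> R) l : (forall k, `|l - u k| < k.+1%:R^-1) ->
  u k @[k --> \oo] --> l.
Proof.
move=> ul; apply/cvgrPdist_lt => eps eps0.
have /cvgr0Pnorm_lt/(_ _ eps0) := @cvg_harmonic R.
apply: filterS => k /(le_lt_trans (ler_norm _)) h.
exact: (lt_trans (ul k) h).
Qed.

Lemma C0_rate_cvg (T : topologicalType) (K : set T) (u : C0 R K) (u_ : nat -> C0 R K) x :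
  compact K -> (forall k, C0_dist u (u_ k) < k.+1%:R^-1) -> K x ->
  u_ k x @[k --> \oo] --> u x.
Proof.
move=> cK uu Kx; apply: rate_cvg => k; exact: (le_lt_trans (C0_dist_ge _ _ cK Kx) (uu k)).
Qed.

Lemma enorm_coord n (x : 'rV[R]_n) i : `|x ord0 i| <= enorm x.
Proof.
rewrite /enorm -sqrtr_sqr ler_sqrt; last by apply: sumr_ge0 => j _; exact: sqr_ge0.
by rewrite (bigD1 i)//= lerDl; apply: sumr_ge0 => j _; exact: sqr_ge0.
Qed.

Lemma enorm_continuous n : continuous (@enorm R n).
Proof.
have cs : continuous (fun x : 'rV[R]_n => \sum_(i < n) x ord0 i ^+ 2).
  apply: continuous_big => [|i _ x]; first exact: add_continuous.
  by under eq_fun do rewrite expr2; apply: continuousM; exact: coord_continuous.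
by move=> x; apply: continuous_comp; [exact: cs|exact: sqrt_continuous].
Qed.

Lemma cvg_rV n (T : Type) (F : set_system T) (FF : Filter F) (f : T -> 'rV[R]_n)
    (l : 'rV[R]_n) :
  (forall i, f t ord0 i @[t --> F] --> l ord0 i) -> f t @[t --> F] --> l.
Proof.
move=> fl; apply/cvg_ballP => eps eps0.
have : \forall t \near F, forall i, `|l ord0 i - f t ord0 i| < eps.
  by apply: filter_forall => i; have /cvgrPdist_lt := fl i; exact.
by apply: filterS => t ht; apply/rV_ballE.
Qed.

(** Inversion sends 0 to 0 and jumps there, so the line is split into this point and its open
    complement. *)
Lemma measurable_invr : measurable_fun setT (fun x : R => x^-1).
Proof.
rewrite -(setvU [set (0 : R)]); apply/measurable_funU => //; first exact: measurableC.
split; last exact: measurable_fun_set1.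
apply: open_continuous_measurable_fun.
  by apply: closed_openC; apply: accessible_closed_set1; exact: hausdorff_accessible.
by move=> x /set_mem/eqP x0; exact: inv_continuous.
Qed.

End sup_norms.

(** * The log-Gaussian and level-set priors *)

Section forward_map_priors.
Context (R : realType) (n L : nat).
Local Notation E := 'rV[R]_n.+1.
Context (D : set E) (D_open : open D) (D_bounded : bounded_set D).
Context (S : {measure set E -> \bar R}) (e : 'I_L -> set E) (z : 'I_L -> R).
Context (e_meas : forall l, measurable (e l)).
Context (e_boundary : forall l, e l `<=` boundary D).
Context (zplus : R) (z_bound : forall l, 0 < z l <= zplus).
Context (norms : star_norm_equivalent D S e) (wellposed : cem_wellposed D S e z).
Local Notation vol := (lebesgue_rV R n.+1).
Local Notation volt I sigma := (cem_volt (solution_map D S e z I sigma)).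

Lemma forward_map_measurable dX (X : measurableType dX) (F : X -> E -> R) (J : nat)
    (I : 'I_J -> 'rV[R]_L) :
  (forall j l, measurable_fun setT (fun p => volt (I j) (F p) ord0 l)) ->
  measurable_fun setT (forward_map D S e z F I).
Proof.
by move=> mF; apply/measurable_fun_rVP => i; under eq_fun do rewrite mxE; exact: mF.
Qed.

Context (I : 'rV[R]_L) (I_mean : zero_mean I).

Let cD : compact (closure D). Proof. exact: compact_closure. Qed.

Lemma log_gaussian_measurable l : measurable_fun setT
  (fun u : borel (@C0_dist R _ (closure D)) =>
     volt I (@log_gaussian_map R n D u) ord0 l).
Proof.
have bnd (u : C0 R (closure D)) : exists B : R, forall x, closure D x -> `|u x| <= B.
  by have [B _ uB] := compact_bound cD (@C0_continuous _ _ _ u); exists B.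
apply: (volt_measurable_continuous D_open D_bounded e_meas e_boundary z_bound norms
  wellposed I_mean) => [u|u u_ uu].
  have [B uB] := bnd u.
  apply: (@continuous_admissible R n D D_open _ (expR (- B)) (expR B)); first exact: expR_gt0.
    by move=> x; apply: continuous_comp; [exact: C0_continuous|exact: continuous_expR].
  by move=> x Dx; rewrite !ler_expR -ler_norml uB.
have [B uB] := bnd u.
(* The rate [k.+1%:R^-1] is at most 1, so each [u_ k] stays within 1 of [u]. *)
exists (expR (- (B + 1))), (expR (B + 1)); split; first exact: expR_gt0.
- move=> k x /subset_closure Dx; rewrite !ler_expR -ler_norml.
  rewrite -[u_ k x](subKr (u x)) (le_trans (ler_normB _ _))// lerD ?uB//.
  rewrite (le_trans (C0_dist_ge _ _ cD Dx))// (le_trans (ltW (uu k)))//.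
  by rewrite invf_le1 ?ler1n.
- move=> x /subset_closure Dx; rewrite !ler_expR -ler_norml.
  by rewrite (le_trans (uB x Dx))// lerDl.
- apply/aeW => x /subset_closure Dx.
  by apply: continuous_cvg; [exact: continuous_expR|exact: C0_rate_cvg].
Qed.

Lemma level_set_measurable k (c : nat -> \bar R) (f : 'I_k -> C0 R (closure D)) :
  c 0%N = -oo%E -> c k = +oo%E -> (forall i, (i < k)%N -> (c i < c i.+1)%E) ->
  (forall i x, closure D x -> 0 < f i x) ->
  forall l, measurable_fun setT (fun u : borel (@C0_dist R _ (closure D)) =>
     volt I (level_set_map c f u) ord0 l).
Proof.
move=> c0 ck c_lt f0.
have lE (u : C0 R (closure D)) x :
    level_set_map c f u x = level_value c (fun i => f i x) (u x).
  apply: eq_bigr => i _; rewrite indicE; congr (_ * (nat_of_bool _)%:R).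
  by apply/idP/idP; rewrite inE.
apply: (@level_volt_measurable _ _ _ D D_open D_bounded S e z e_meas e_boundary zplus
  z_bound norms wellposed I I_mean
  (C0 R (closure D)) (@C0_dist R _ (closure D)) k c c0 ck c_lt (fun i => f i : E -> R)
  (fun u => u : E -> R) (fun _ _ => 1) (fun u => level_set_map c f u)) => //.
- by move=> i; exact: C0_continuous.
- by move=> u; apply: continuous_subspaceT => x; exact: cst_continuous.
- move=> u x Dx _.
  by have /subspace_continuousP := @C0_continuous _ _ _ u; exact.
- move=> u u_ uu x /subset_closure Dx; split; first exact: cvg_cst.
  by move=> _; exact: C0_rate_cvg.
- by move=> u; apply/aeW.
- by move=> u x /subset_closure; apply: closureS => y Dy; split => //=; exact: ltr01.
- move=> u x Dx; have [i iu] := level_exists c0 ck (u x).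
  by exists i; rewrite lE (level_value_eq c_lt _ iu).
- move=> u; have mcD : measurable (closure D).
    by apply: closed_measurable_rV; exact: closed_closure.
  (* The sharp field is measurable in [x] as a pointwise limit of the continuous ramped ones. *)
  apply: (@measurable_fun_cvg _ _ _ _ (fun m x => mix c m (fun i => f i x) 1 (u x))) => //.
    move=> m; apply: within_continuous_measurable_rV => //.
    apply/subspace_continuousP => x Dx; apply: mix_continuous => //.
    + by move=> i; have /subspace_continuousP := @C0_continuous _ _ _ (f i); exact.
    + exact: cvg_cst.
    + by move=> _; have /subspace_continuousP := @C0_continuous _ _ _ u; exact.
  by move=> x Dx; rewrite lE; exact: mix_cvg.
Qed.

End forward_map_priors.

(** * The star-shaped prior *)

Section angular_coordinates.
Context (R : realType) (n : nat) (theta0 phi0 : R).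
Context (theta0_itv : - pi < theta0 <= pi) (phi0_itv : 0 <= phi0 <= pi).
Local Notation E := 'rV[R]_n.+1.
Local Notation ang := (@angular R n theta0 phi0).

Lemma atan2_itv (y x : R) : - pi < atan2 theta0 y x <= pi.
Proof.
rewrite /atan2; have := atan_gtNpi2 (y / x); have := atan_ltpi2 (y / x).
have pi0 : 0 < (pi : R) := pi_gt0 R.
case: (ltgtP 0 x) => [x0|x0|_] /=.
- by move=> h1 h2; apply/andP; split; lra.
- case: ifPn => y0 h1 h2; apply/andP; split; try lra.
    have : atan (y / x) <= atan 0 by apply: le_atan; rewrite mulr_ge0_le0// invr_le0 ltW.
    by rewrite atan0; lra.
  have : atan 0 < atan (y / x).
    by apply: lt_atan; rewrite nmulr_rgt0 ?invr_lt0// ltNge.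
  by rewrite atan0; lra.
- by case: ifP => _; [|case: ifP => _]; move=> *; rewrite ?theta0_itv//; apply/andP; split; lra.
Qed.

Lemma polar_angle_itv (w rho : R) : 0 <= polar_angle phi0 w rho <= pi.
Proof.
rewrite /polar_angle; have := atan_gtNpi2 (w / rho); have := atan_ltpi2 (w / rho).
have pi0 : 0 < (pi : R) := pi_gt0 R.
case: ifP => _; first by move=> h1 h2; apply/andP; split; lra.
move=> _ _; case: ifP => _; first by rewrite lexx ltW.
by case: ifP => _ //; rewrite lexx ltW.
Qed.

Lemma angular_angles (y : E) : @angles R n (ang y).
Proof.
by split=> i i0; rewrite mxE ?(negbTE i0) ?i0 ?eqxx; [exact: polar_angle_itv|exact: atan2_itv].
Qed.

Lemma measurable_angular : measurable_fun setT ang.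
Proof.
have mc k : measurable_fun setT (fun x : E => x ord0 (inord k)).
  exact: measurable_coord.
have matan (f g : E -> R) : measurable_fun setT f -> measurable_fun setT g ->
    measurable_fun setT (fun x => atan (f x / g x)).
  move=> mf mg; apply: (@measurableT_comp _ _ _ _ _ _ (@atan R)).
    by apply: continuous_measurable_fun => x; exact: continuous_atan.
  apply: measurable_funM => //.
  by apply: (measurableT_comp (@measurable_invr R)).
have mrho : measurable_fun setT (fun x : E =>
    Num.sqrt (x ord0 (inord 0) ^+ 2 + x ord0 (inord 1) ^+ 2)).
  apply: (measurableT_comp (continuous_measurable_fun (@sqrt_continuous R))).
  by apply: measurable_funD; exact: measurable_funX.
apply/measurable_fun_rVP => i; under eq_fun do rewrite mxE.
case: (nat_of_ord i == 0%N).
  rewrite /atan2; apply: measurable_fun_ifT; first exact: measurable_fun_ltr.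
    exact: matan.
  apply: measurable_fun_ifT; first exact: measurable_fun_ltr.
    apply: measurable_fun_ifT; first exact: measurable_fun_ler.
      by apply: measurable_funD => //; exact: matan.
    by apply: measurable_funB => //; exact: matan.
  apply: measurable_fun_ifT => //; first exact: measurable_fun_ltr.
  by apply: measurable_fun_ifT => //; exact: measurable_fun_ltr.
rewrite /polar_angle; apply: measurable_fun_ifT; first exact: measurable_fun_ltr.
  by apply: measurable_funB => //; exact: matan.
apply: measurable_fun_ifT => //; first exact: measurable_fun_ltr.
by apply: measurable_fun_ifT => //; exact: measurable_fun_ltr.
Qed.

Lemma measurable_angle_strip : measurable (@angle_strip R n).
Proof.
apply: closed_measurable_rV.
rewrite (_ : @angle_strip R n = \bigcap_(i in [set: 'I_n]) [set t : 'rV[R]_n |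
    i != 0%N :> nat -> 0 <= t ord0 i <= pi]); last first.
  by apply/seteqP; split=> t h i; [move=> _; exact: h|exact: (h i I)].
apply: closed_bigI => i _; have [i0|i0] := boolP (i == 0%N :> nat).
  rewrite (_ : mkset _ = setT); first exact: closedT.
  by apply/seteqP; split.
rewrite (_ : mkset _ = (fun t : 'rV[R]_n => t ord0 i) @^-1` `[0, pi]%classic).
  apply: closed_comp; last exact: interval_closed.
  by move=> t _; exact: coord_continuous.
by apply/seteqP; split=> t; rewrite /= in_itv/= ?i0 => // h; exact: h.
Qed.

Lemma measurable_CP (r : CP R n) : measurable_fun setT (r : 'rV[R]_n -> R).
Proof.
have -> : (r : 'rV[R]_n -> R) = (r : 'rV[R]_n -> R) \_ (@angle_strip R n).
  apply/funext => t; rewrite patchE; case: ifPn => // /negP; rewrite inE.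
  exact: C0_out.
apply/(measurable_restrictT _ measurable_angle_strip).
apply: within_continuous_measurable_rV; first exact: measurable_angle_strip.
exact: C0_continuous.
Qed.

(** [angles] is half open; this compact set contains it and lies in the strip where radii are
    continuous, so it makes their sup norms genuine bounds. *)
Definition angle_box : set 'rV[R]_n :=
  [set t | forall i : 'I_n, (if i == 0%N :> nat then `[- pi, pi] else `[0, pi])%classic
     (t ord0 i)].

Lemma compact_angle_box : compact angle_box.
Proof.
apply: (@rV_compact _ _ (fun i : 'I_n =>
  (if i == 0%N :> nat then `[- pi, pi] else `[0, pi])%classic)) => i.
by case: ifP => _; exact: segment_compact.
Qed.

Lemma angle_box_strip : angle_box `<=` @angle_strip R n.
Proof. by move=> t h i i0; have := h i; rewrite (negbTE i0)/= in_itv. Qed.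

Lemma angles_box : @angles R n `<=` angle_box.
Proof.
move=> t [h1 h2] i; case: ifPn => i0 /=; rewrite in_itv/=; last exact: h1.
by have /andP[/ltW -> ->] := h2 i (eqP i0).
Qed.

Lemma CP_dist_ge (r r' : CP R n) t : @angles R n t -> `|r t - r' t| <= CP_dist r r'.
Proof.
move=> at_; have cb (q : CP R n) : {within angle_box, continuous (q : 'rV[R]_n -> R)}.
  by apply: (continuous_subspaceW angle_box_strip); exact: C0_continuous.
have [B1 _ rB] := compact_bound compact_angle_box (cb r).
have [B2 _ r'B] := compact_bound compact_angle_box (cb r').
apply: (@le_sup_norm _ _ _ (fun t => r t - r' t) (B1 + B2)) => // y /angles_box yb.
by rewrite (le_trans (ler_normB _ _))// lerD// ?rB ?r'B.
Qed.

(* On the side [x < 0] of the branch cut the angle in (0, 2 pi) is used, which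
   differs from [angular] by at most a full turn. *)
Let smooth_angular (shift : R) (y : E) : 'rV[R]_n :=
  \row_(i < n) if i == 0%N :> nat then atan (y ord0 (inord 1) / y ord0 (inord 0)) + shift
    else pi / 2 - atan (y ord0 (inord 2) /
      Num.sqrt (y ord0 (inord 0) ^+ 2 + y ord0 (inord 1) ^+ 2)).

Let rho_gt0 (y : E) : y ord0 (inord 0) != 0 ->
  0 < Num.sqrt (y ord0 (inord 0) ^+ 2 + y ord0 (inord 1) ^+ 2).
Proof.
move=> y0; rewrite sqrtr_gt0 ltr_wpDr ?sqr_ge0//.
by rewrite lt_neqAle sqr_ge0 eq_sym sqrf_eq0 y0.
Qed.

Let smooth_angular_continuous shift (y : E) : y ord0 (inord 0) != 0 ->
  smooth_angular shift x @[x --> y] --> smooth_angular shift y.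
Proof.
move=> y0; apply: (@cvg_rV R n E (nbhs y) _) => i; rewrite !mxE.
under eq_fun do rewrite mxE.
have cc k : x ord0 (inord k) @[x --> y] --> y ord0 (inord k).
  exact: coord_continuous.
case: (nat_of_ord i == 0%N).
  apply: cvgD; last exact: cvg_cst.
  apply: continuous_cvg; first exact: continuous_atan.
  exact: (cvgM (cc 1%N) (cvgV y0 (cc 0%N))).
apply: cvgB; first exact: cvg_cst.
apply: continuous_cvg; first exact: continuous_atan.
have rho0 : Num.sqrt (y ord0 (inord 0) ^+ 2 + y ord0 (inord 1) ^+ 2) != 0.
  by rewrite gt_eqF ?rho_gt0.
have sq : Num.sqrt (x ord0 (inord 0) ^+ 2 + x ord0 (inord 1) ^+ 2) @[x --> y] -->
    Num.sqrt (y ord0 (inord 0) ^+ 2 + y ord0 (inord 1) ^+ 2).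
  apply: continuous_cvg; first exact: sqrt_continuous.
  exact: (cvgD (cvgM (cc 0%N) (cc 0%N)) (cvgM (cc 1%N) (cc 1%N))).
exact: (cvgM (cc 2%N) (cvgV rho0 sq)).
Qed.

Let smooth_angular_strip shift y : @angle_strip R n (smooth_angular shift y).
Proof.
move=> i i0; rewrite mxE (negbTE i0).
set t := (X in atan X); have := atan_gtNpi2 t; have := atan_ltpi2 t.
by have := pi_gt0 R => pi0 h1 h2; apply/andP; split; lra.
Qed.

Let angular_smooth (r : CP R n) (y : E) : y ord0 (inord 0) != 0 ->
  r (ang y) = r (smooth_angular (if 0 < y ord0 (inord 0) then 0 else pi) y).
Proof.
move=> y0; have [pos|neg] := ltP 0 (y ord0 (inord 0)).
  congr (CP_fun r _); apply/rowP => i; rewrite !mxE /atan2 pos addr0.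
  by case: ifP => // _; rewrite /polar_angle rho_gt0.
have neg' : y ord0 (inord 0) < 0 by rewrite lt_neqAle y0.
have [y1|y1] := leP 0 (y ord0 (inord 1)).
  congr (CP_fun r _); apply/rowP => i; rewrite !mxE /atan2 ltNge neg neg' y1/=.
  by case: ifP => // _; rewrite /polar_angle rho_gt0.
(* Here [atan2] is [atan - pi] and the smooth branch is [atan + pi]: a full turn apart, absorbed by
   periodicity. *)
rewrite -CP_periodic; congr (CP_fun r _); apply/rowP => i.
rewrite !mxE /atan2 ltNge neg neg'/= leNgt y1/=.
case: ifP => // _; last by rewrite /polar_angle rho_gt0// addr0.
by ring.
Qed.

(** The sign of the first coordinate is constant near [y], so a single smooth branch serves a
    neighbourhood, and it takes values in the strip where [r] is continuous. A nonzero first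
    coordinate also keeps both denominators of the angles nonzero. *)
Lemma CP_angular_continuous (r : CP R n) (y : E) : y ord0 (inord 0) != 0 ->
  r (ang x) @[x --> y] --> r (ang y).
Proof.
move=> y0; rewrite angular_smooth//.
set s := if _ then _ else _.
have near_s : \forall x \near y, r (smooth_angular s x) = r (ang x).
  have cc : x ord0 (inord 0) @[x --> y] --> y ord0 (inord 0).
    exact: coord_continuous.
  have [pos|neg] := ltP 0 (y ord0 (inord 0)).
    move/cvgr_gt : cc => /(_ 0 pos); apply: (@filterS _ (nbhs y)) => x x0.
    by rewrite angular_smooth ?gt_eqF// x0 /s pos.
  have neg' : y ord0 (inord 0) < 0 by rewrite lt_neqAle y0.
  move/cvgr_lt : cc => /(_ 0 neg'); apply: (@filterS _ (nbhs y)) => x x0.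
  by rewrite angular_smooth ?lt_eqF// ltNge (ltW x0) /s ltNge neg.
apply: cvg_trans (near_eq_cvg near_s) _.
have := @C0_continuous _ _ _ (CP_fun r).
move=> /subspace_continuousP/(_ _ (smooth_angular_strip s y)) rc.
apply: cvg_comp rc => A; rewrite /within/= => yA.
have := @smooth_angular_continuous s y y0 _ yA.
by apply: (@filterS _ (nbhs y)) => x; apply; exact: smooth_angular_strip.
Qed.

End angular_coordinates.

Section star_shaped_prior.
Context (R : realType) (n L : nat).
Local Notation E := 'rV[R]_n.+1.
Context (D : set E) (D_open : open D) (D_bounded : bounded_set D).
Context (S : {measure set E -> \bar R}) (e : 'I_L -> set E) (z : 'I_L -> R).
Context (e_meas : forall l, measurable (e l)).
Context (e_boundary : forall l, e l `<=` boundary D).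
Context (zplus : R) (z_bound : forall l, 0 < z l <= zplus).
Context (norms : star_norm_equivalent D S e) (wellposed : cem_wellposed D S e z).
Context (I : 'rV[R]_L) (I_mean : zero_mean I).
Context (D0 : D !=set0) (theta0 phi0 uplus uminus : R).
Context (theta0_itv : - pi < theta0 <= pi) (phi0_itv : 0 <= phi0 <= pi).
Context (uplus_gt0 : 0 < uplus) (uminus_gt0 : 0 < uminus).
Local Notation vol := (lebesgue_rV R n.+1).
Local Notation X := (CP R n * set_point D0)%type.
Local Notation ang := (@angular R n theta0 phi0).
Local Notation center p := (set_point_val p.2).
Implicit Types p : X.

(** A single cut at 0; the upper level [0 <= gap] matches the non-strict inequality of
    [star_set]. *)
Let levels (i : nat) : \bar R :=
  match i with 0%N => -oo%E | 1%N => 0%E | _ => +oo%E end.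

Let values (i : 'I_2) : R := if i == ord0 then uminus else uplus.

Let gap p (x : E) : R := p.1 (ang (x - center p)) - enorm (x - center p).

(* Vanishes on the hyperplane through the center where the angles jump. *)
Let offset p (x : E) : R := `|(x - center p) ord0 (inord 0)|.

Let inord0 : (inord 0 : 'I_n.+1) = ord0.
Proof. by apply/val_inj; rewrite /= inordK. Qed.

Let star_mapE p x : star_map theta0 phi0 uplus uminus p x =
  uminus + (uplus - uminus) * \1_(star_set theta0 phi0 p) x.
Proof. by rewrite /star_map indicE; case: (x \in _) => /=; ring. Qed.

Let measurable_star_map p (A : set E) : measurable A ->
  measurable_fun A (star_map theta0 phi0 uplus uminus p).
Proof.
move=> mA; rewrite (funext (star_mapE p)).
apply: measurable_funD => //; apply: measurable_funM => //.
apply: measurable_indic.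
have mtr := @measurable_translate R n.+1 (- center p).
have m1 : measurable_fun setT (fun x : E => enorm (x - center p)).
  apply: (measurableT_comp _ mtr); apply: continuous_measurable_rV.
  exact: enorm_continuous.
have m2 : measurable_fun setT (fun x : E => p.1 (ang (x - center p))).
  apply: (measurableT_comp (measurable_CP p.1)).
  by apply: (measurableT_comp _ mtr); exact: measurable_angular.
have mb := measurable_fun_ler m1 m2.
have := mb measurableT [set true]; rewrite setTI => mset.
rewrite (_ : star_set _ _ _ = D `&` ((fun x : E => enorm (x - center p) <=
  p.1 (ang (x - center p))) @^-1` [set true]))//.
by apply: measurableI; [exact: open_measurable_rV|exact: (mset Logic.I)].
Qed.

Let gap_continuous p x : 0 < offset p x -> {for x, continuous (gap p)}.
Proof.
rewrite normr_gt0 => x0.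
have ct : y - center p @[y --> x] --> x - center p by exact: (cvgB cvg_id (cvg_cst _)).
have h1 : p.1 (ang (y - center p)) @[y --> x] --> p.1 (ang (x - center p)).
  by apply: (cvg_comp (fun y : E => y - center p) (fun y => p.1 (ang y)) ct);
    exact: CP_angular_continuous.
have h2 : enorm (y - center p) @[y --> x] --> enorm (x - center p).
  apply: (cvg_comp (fun y : E => y - center p) (@enorm R _) ct).
  exact: enorm_continuous.
exact: (cvgB h1 h2).
Qed.

Let center_cvg p (p_ : nat -> X) :
  (forall k, star_dist p (p_ k) < k.+1%:R^-1) ->
  center (p_ k) @[k --> \oo] --> center p.
Proof.
move=> pp; apply: (@cvg_rV R _ nat \oo _) => i; apply: rate_cvg => k.
apply: le_lt_trans (pp k); rewrite /star_dist le_max; apply/orP; right.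
by apply: le_trans (enorm_coord _ i); rewrite !mxE.
Qed.

(** Radius and center move together, so the change of the radius term is split: replacing the radius
    costs at most [CP_dist], at whatever angle, and moving the center is covered by continuity off
    the hyperplane. *)
Let offset_gap_continuous p (p_ : nat -> X) :
  (forall k, star_dist p (p_ k) < k.+1%:R^-1) -> forall x, D x ->
  offset (p_ k) x @[k --> \oo] --> offset p x /\
  (0 < offset p x -> gap (p_ k) x @[k --> \oo] --> gap p x).
Proof.
move=> pp x _.
have ct : x - center (p_ k) @[k --> \oo] --> x - center p.
  exact: (cvgB (cvg_cst _) (center_cvg pp)).
split.
  apply: cvg_norm.
  exact: (cvg_comp _ _ ct (@coord_continuous _ _ _ _ _ _)).
rewrite normr_gt0 => x0; apply: cvgB; last first.
  by apply: (cvg_comp _ _ ct); exact: enorm_continuous.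
have h1 : (p_ k).1 (ang (x - center (p_ k))) - p.1 (ang (x - center (p_ k)))
    @[k --> \oo] --> (0 : R).
  apply: rate_cvg => k; rewrite sub0r opprB; apply: le_lt_trans (pp k).
  by rewrite /star_dist le_max CP_dist_ge//; exact: angular_angles.
have h2 : p.1 (ang (x - center (p_ k))) @[k --> \oo] --> p.1 (ang (x - center p)).
  apply: (cvg_comp (fun k => x - center (p_ k)) (fun y => p.1 (ang y)) ct).
  exact: CP_angular_continuous.
have := cvgD h1 h2; rewrite add0r => h.
have -> : (fun k => (p_ k).1 (ang (x - center (p_ k)))) = (fun k =>
   (p_ k).1 (ang (x - center (p_ k))) - p.1 (ang (x - center (p_ k)))
     + p.1 (ang (x - center (p_ k)))).
  by apply/funext => k; rewrite subrK.
exact: h.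
Qed.

Lemma star_measurable l : measurable_fun setT
  (fun p : borel (@star_dist R n D D0) => cem_volt (solution_map D S e z I
     (star_map theta0 phi0 uplus uminus p)) ord0 l).
Proof.
have lev0 : levels 0 = -oo%E by [].
have lev2 : levels 2 = +oo%E by [].
have lev_lt i : (i < 2)%N -> (levels i < levels i.+1)%E.
  by case: i => [|[|//]] _; rewrite ?ltNyr ?ltry.
apply: (@level_volt_measurable _ _ _ D D_open D_bounded S e z e_meas e_boundary zplus
  z_bound norms wellposed I I_mean X (@star_dist R n D D0) 2 levels lev0 lev2 lev_lt
  (fun i _ => values i) gap offset (star_map theta0 phi0 uplus uminus)).
- by move=> i; apply: continuous_subspaceT => x; exact: cst_continuous.
- by move=> i x _; rewrite /values; case: ifP.
- by move=> p x; exact: normr_ge0.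
- move=> p; apply: continuous_subspaceT => x.
  have ct : y - center p @[y --> x] --> x - center p by exact: (cvgB cvg_id (cvg_cst _)).
  have h : (y - center p) ord0 (inord 0) @[y --> x] --> (x - center p) ord0 (inord 0).
    apply: (cvg_comp (fun y : E => y - center p) (fun y : E => y ord0 (inord 0)) ct).
    exact: coord_continuous.
  exact: (cvg_norm h).
- move=> p x Dx /gap_continuous h; exact: cvg_within_filter.
- exact: offset_gap_continuous.
- move=> p; exists [set x : E | x ord0 ord0 = center p ord0 ord0]; split.
  + have mc := @measurable_coord R n.+1 ord0.
    have := mc measurableT [set center p ord0 ord0].
    by rewrite setTI; apply; exact: measurable_set1.
  + exact: lebesgue_rV_hyperplane.
  + move=> x /= nx; apply: contrapT => xc; apply: nx => _.
    rewrite normr_gt0 inord0 !mxE subr_eq0; exact/eqP.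
- move=> p x Dx V Vx.
  have : nbhs x (D `&` V) by apply: filterI => //; exact: open_nbhs_nbhs.
  move=> /nbhs_ballP[eps /= eps0 xeps].
  have [x0|x0] := eqVneq (x ord0 ord0) (center p ord0 ord0); last first.
    exists x; have [_ Vx'] := xeps x (ballxx _ eps0); split => //; split => //=.
    by rewrite normr_gt0 inord0 !mxE subr_eq0.
  (* A point of the hyperplane is left by moving [eps / 2] in the first coordinate, still within the
     ball. *)
  pose y : E := \row_i (x ord0 i + (eps / 2) *+ (i == ord0)).
  have [Dy Vy] : (D `&` V) y.
    apply: xeps; apply/rV_ballE => // i; rewrite mxE opprD addNKr normrN.
    case: (i == ord0); rewrite ?mulr0n ?normr0// mulr1n ger0_norm ?divr_ge0 ?ltW//.
    by rewrite ltr_pdivrMr// ltr_pMr// ltr1n.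
  exists y; split => //; split => //=.
  rewrite normr_gt0 inord0 !mxE eqxx mulr1n x0 addrAC subrr add0r.
  by rewrite gt_eqF// divr_gt0.
- move=> p x Dx _; rewrite /star_map.
  have gx (i : 'I_2) : (levels i <= (gap p x)%:E < levels i.+1)%E ->
    level_value levels values (gap p x) = values i.
    exact: level_value_eq.
  have [g0|g0] := leP 0 (gap p x).
    rewrite (gx (Ordinal (isT : (1 < 2)%N)))/=; last by rewrite lee_fin g0 ltry.
    by rewrite mem_set//; split => //; rewrite -subr_ge0.
  rewrite (gx ord0)/=; last by rewrite leNye lte_fin.
  rewrite memNset// => -[_]; apply/negP; rewrite -ltNge -subr_lt0//.
- move=> p x _; rewrite /star_map; case: ifP => _.
    by exists (Ordinal (isT : (1 < 2)%N)).
  by exists ord0.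
- move=> p; apply: measurable_star_map; apply: closed_measurable_rV.
  exact: closed_closure.
Qed.

End star_shaped_prior.

(** * Weighted norms and densities *)

Section positive_semidefinite.
Context (R : realType).

Definition psd N (A : 'M[R]_N) : Prop :=
  A^T = A /\ forall x : 'rV[R]_N, 0 <= (x *m A *m x^T) ord0 ord0.

Lemma covariance_psd N (G : 'M[R]_N) : covariance_matrix G -> psd G.
Proof.
move=> [sG G0]; split => // x; have [->|x0] := eqVneq x 0.
  by rewrite !mul0mx mxE.
exact/ltW/G0.
Qed.

Lemma psd_mxdiag J L (G : 'M[R]_L) : psd G -> psd (\mxdiag_(j < J) G).
Proof.
move=> [sG G0]; split; first by rewrite tr_mxdiag; congr mxdiag; apply/funext => j.
move=> x; rewrite -[x]submxrowK mul_mxrow_mxdiag tr_mxrow mul_mxrow_mxcol summxE.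
by apply: sumr_ge0 => j _; exact: G0.
Qed.

(** For invertible [G] the form of the inverse at [x] is that of [G] at [x *m invmx G]; otherwise
    [invmx G] is [G] itself. *)
Lemma psd_invmx N (G : 'M[R]_N) : psd G -> psd (invmx G).
Proof.
move=> [sG G0]; have sV : (invmx G)^T = invmx G by rewrite trmx_inv sG.
split => // x; have [uG|nuG] := boolP (G \in unitmx); last first.
  by rewrite invmx_out.
have := G0 (x *m invmx G).
by rewrite trmx_mul sV mulmxKV// mulmxA.
Qed.

Context (N : nat) (G : 'M[R]_N) (psdV : psd (invmx G)).
Local Notation A := (invmx G).
Local Notation "''q' x" := ((x *m A *m x^T) ord0 ord0) (at level 10, x at level 8).
Implicit Types x y : 'rV[R]_N.

Lemma wnorm_ge0 x : 0 <= wnorm G x.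
Proof. exact: sqrtr_ge0. Qed.

Lemma wnormN x : wnorm G (- x) = wnorm G x.
Proof. by rewrite /wnorm linearN/= mulNmx mulNmx mulmxN opprK. Qed.

Lemma wnorm_sqr x : wnorm G x ^+ 2 = 'q x.
Proof. by rewrite sqr_sqrtr//; exact: psdV.2. Qed.

Lemma psd_polar (t : R) x y : 'q (t *: x - y) =
  t ^+ 2 * 'q x - t * ((x *m A *m y^T) ord0 ord0 *+ 2) + 'q y.
Proof.
have yx : (y *m A *m x^T) ord0 ord0 = (x *m A *m y^T) ord0 ord0.
  have <- : (y *m A *m x^T)^T = x *m A *m y^T.
    by rewrite trmx_mul trmxK trmx_mul psdV.1 mulmxA.
  by rewrite [RHS]mxE.
rewrite linearB/= linearZ/= mulmxBl mulmxBr !mulmxBl -!scalemxAl -!scalemxAr.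
move: (x *m A *m x^T) (x *m A *m y^T) (y *m A *m x^T) (y *m A *m y^T) yx.
by move=> a b c d yx; rewrite !mxE yx; ring.
Qed.

Lemma psd_cauchy_schwarz x y : (x *m A *m y^T) ord0 ord0 <= wnorm G x * wnorm G y.
Proof.
set b := (X in X <= _); have [b0|b0] := leP b 0.
  by rewrite (le_trans b0)// mulr_ge0 ?wnorm_ge0.
have sx := wnorm_sqr x; have sy := wnorm_sqr y.
have x0 := wnorm_ge0 x; have y0 := wnorm_ge0 y.
move: (wnorm G x) (wnorm G y) x0 y0 sx sy => p q p0 q0 sx sy.
have h t : 0 <= t ^+ 2 * p ^+ 2 - t * (b *+ 2) + q ^+ 2.
  by rewrite sx sy -psd_polar; exact: psdV.2.
have [p_0|p_gt0] : p = 0 \/ 0 < p.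
- by move: p0; rewrite le_eqVlt => /predU1P[<-|]; [left|right].
(* For [p = 0] the polynomial is affine in [t], and this [t] gives it the value -1. *)
- have := h ((q ^+ 2 + 1) / (b *+ 2)).
  rewrite p_0 expr0n/= mulr0 sub0r divfK; last by rewrite gt_eqF// mulrn_wgt0.
  by rewrite opprD addrAC addNr sub0r oppr_ge0 ler10.
(* The minimiser of the quadratic in [t]. *)
have := h (b / p ^+ 2).
rewrite (_ : _ + _ = (q ^+ 2 * p ^+ 2 - b ^+ 2) / p ^+ 2); last first.
  by field; rewrite gt_eqF.
rewrite pmulr_lge0 ?invr_gt0 ?exprn_gt0// subr_ge0 -exprMn => bqp.
by rewrite mulrC -(ler_pXn2r (ltn0Sn 1)) ?nnegrE ?mulr_ge0// ltW.
Qed.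

Lemma wnormD x y : wnorm G (x + y) <= wnorm G x + wnorm G y.
Proof.
rewrite -(ler_pXn2r (ltn0Sn 1)) ?nnegrE ?addr_ge0 ?wnorm_ge0// wnorm_sqr.
have := psd_polar 1 x (- y); rewrite scale1r opprK => ->.
have := psd_cauchy_schwarz x y.
rewrite linearN/= mulmxN mulNmx mulNmx mulmxN opprK -!wnorm_sqr.
rewrite [in X in _ - 1 * X]mxE => h.
by rewrite sqrrD expr1n !mul1r mulNrn opprK lerD2r lerD2l lerMn2r.
Qed.

Lemma wnorm_dist x y : `|wnorm G x - wnorm G y| <= wnorm G (x - y).
Proof.
have h1 := wnormD (x - y) y; have h2 := wnormD (y - x) x.
rewrite subrK in h1; rewrite subrK -opprB wnormN in h2.
by rewrite ler_norml; apply/andP; split; lra.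
Qed.

Lemma measurable_wnorm : measurable_fun setT (@wnorm R N G).
Proof.
apply: (measurableT_comp (continuous_measurable_fun (@sqrt_continuous R))).
have mc i : measurable_fun setT (fun x : 'rV[R]_N => x ord0 i) by exact: measurable_coord.
under eq_fun do rewrite mxE; apply: measurable_sum => j.
under eq_fun do rewrite !mxE; apply: measurable_funM => //.
by apply: measurable_sum => k; apply: measurable_funM.
Qed.

End positive_semidefinite.

(** * Probabilities given by a density *)

Section densities.
Context d (T : measurableType d) (R : realType).

Lemma density_probability (mu : probability T R) (f : T -> R) :
  measurable_fun setT f -> (forall x, 0 <= f x) ->
  (\int[mu]_x (f x)%:E = 1)%E ->
  exists P : probability T R,
    forall A, measurable A -> (P A = \int[mu]_(x in A) (f x)%:E)%E.
Proof.
move=> mf f0 f1.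
pose m A : \bar R := (\int[mu]_(x in A) (f x)%:E)%E.
have m0 : m set0 = 0%E by rewrite /m integral_set0.
have m_ge0 A : (0 <= m A)%E by apply: integral_ge0 => x _; rewrite lee_fin.
have m_add : semi_sigma_additive m.
  apply: semi_sigma_additive_nng_induced; first exact/measurable_EFinP.
  by move=> x; rewrite lee_fin.
pose M : {measure set T -> \bar R} := HB.pack m (isMeasure.Build _ _ _ m m0 m_ge0 m_add).
pose P : probability T R := HB.pack (m : set T -> \bar R) M
  (Measure_isProbability.Build _ _ _ M f1).
by exists P.
Qed.

(** [Radon_Nikodym] is a chosen function; having the same integrals as [f] over all measurable sets,
    it agrees with [f] almost everywhere. *)
Lemma Radon_Nikodym_density (nu : {finite_measure set T -> \bar R})
    (mu : {sigma_finite_measure set T -> \bar R}) (f : T -> R) :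
  measurable_fun setT f ->
  (forall A, measurable A -> (nu A = \int[mu]_(x in A) (f x)%:E)%E) ->
  nu `<< mu /\
  ae_eq mu setT (Radon_Nikodym (charge_of_finite_measure nu) mu) (EFin \o f).
Proof.
move=> mf nuE.
have numu : nu `<< mu.
  apply/null_content_dominatesP => A mA A0; rewrite nuE//.
  by apply: null_set_integral => //; exact/measurable_EFinP/measurable_funTS.
split => //; apply: integral_ae_eq => //.
- exact: Radon_Nikodym_integrable.
- exact/measurable_EFinP.
- by move=> A _ mA; rewrite -nuE// -Radon_Nikodym_integral.
Qed.

Lemma integral_density (nu : {finite_measure set T -> \bar R})
    (mu : {sigma_finite_measure set T -> \bar R}) (f g : T -> R) (B : set T) :
  measurable_fun setT f ->
  (forall A, measurable A -> (nu A = \int[mu]_(x in A) (f x)%:E)%E) ->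
  measurable B -> nu.-integrable B (EFin \o g) -> measurable_fun setT g ->
  (\int[nu]_(x in B) (g x)%:E = \int[mu]_(x in B) (g x * f x)%:E)%E.
Proof.
move=> mf nuE mB ig mg.
have [numu rn] := Radon_Nikodym_density mf nuE.
rewrite -(Radon_Nikodym_change_of_variables numu mB ig).
apply: ae_eq_integral => //.
- apply: emeasurable_funM; first exact/measurable_EFinP/measurable_funTS.
  apply: measurable_funTS; apply: measurable_int; exact: Radon_Nikodym_integrable.
- by apply/measurable_EFinP; apply: measurable_funTS; exact: measurable_funM.
- move: rn; apply: filterS => x /= h _.
  by rewrite h// EFinM.
Qed.

Lemma Rintegral_probability_cst (mu : probability T R) (r : R) :
  \int[mu]_x r = r.
Proof. by rewrite Rintegral_cst// [X in fine X](probability_setT mu) mulr1. Qed.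

(** A zero integral would force [f = 0] off a null set; as [f] vanishes nowhere, that null set would
    be the whole space, of mass 1. *)
Lemma integral_probability_gt0 (mu : probability T R) (f : T -> R) :
  measurable_fun setT f -> (forall x, 0 < f x <= 1) ->
  0 < \int[mu]_x f x /\ (\int[mu]_x (f x)%:E = (\int[mu]_x f x)%:E)%E.
Proof.
move=> mf f01.
have i1 : mu.-integrable setT (EFin \o f).
  apply: (@le_integrable _ _ _ mu _ measurableT _ (cst 1%E)).
  - exact/measurable_EFinP.
  - by move=> x _ /=; have /andP[/ltW f0 f1] := f01 x; rewrite lee_fin normr1 ger0_norm.
  - exact: finite_measure_integrable_cst.
have fE : (\int[mu]_x (f x)%:E = (\int[mu]_x f x)%:E)%E.
  by rewrite /Rintegral fineK//; exact: integrable_fin_num.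
split => //; rewrite lt_neqAle; apply/andP; split; last first.
  by apply: Rintegral_ge0 => x _; have /andP[/ltW] := f01 x.
apply/eqP => int0.
have : (\int[mu]_x `|(EFin \o f) x| = 0)%E.
  under eq_integral => x _.
    rewrite /= ger0_norm; last by have /andP[/ltW] := f01 x.
    over.
  by rewrite fE -int0.
move/(ae_eq_integral_abs mu measurableT (measurable_int _ i1)) => [M [mM M0 fM]].
have MT : M = setT.
  apply/seteqP; split => // x _; apply: fM => /= /(_ I) [fx0].
  by have /andP[] := f01 x; rewrite fx0 ltxx.
have M1 : mu M = 1%E by rewrite MT; exact: probability_setT.
by have /eqP := etrans (esym M1) M0; rewrite onee_eq0.
Qed.

End densities.

(** * Bayes' formula *)

Section bayes.
Context (R : realType) (N : nat) (Gamma : 'M[R]_N) (psdV : psd (invmx Gamma)).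
Local Notation Y := 'rV[R]_N.
Local Notation vol := (lebesgue_rV R N).
Context dX (X : measurableType dX) (mu0 : probability X R).
Context (G : X -> Y) (G_meas : measurable_fun setT G).

Definition likelihood (t : Y) (x : X) : R := expR (- potential Gamma G x t).
Local Notation lik := likelihood.
Local Notation Z := (normalising_constant mu0 Gamma G).

Lemma likelihood_itv t x : 0 < lik t x <= 1.
Proof.
rewrite expR_gt0 /= -expR0 ler_expR oppr_le0 mulr_ge0 ?invr_ge0//.
exact: sqr_ge0.
Qed.

Lemma measurable_likelihood : measurable_fun setT (fun p : X * Y => lik p.2 p.1).
Proof.
apply: measurableT_comp => //; apply: measurableT_comp => //.
apply: measurable_funM => //; apply: measurable_funX.
apply: (measurableT_comp (@measurable_wnorm R N Gamma)).
apply/measurable_fun_rVP => i; under eq_fun do rewrite !mxE.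
apply: measurable_funB.
  have /measurable_fun_rVP m1 := G_meas.
  exact: (measurableT_comp (m1 i) measurable_fst).
exact: (measurableT_comp (measurable_coord i) measurable_snd).
Qed.

Lemma measurable_likelihood1 t : measurable_fun setT (lik t).
Proof.
have mt : measurable_fun setT (fun x : X => (x, t)).
  by apply/measurable_fun_pairP; split; [exact: measurable_id|exact: measurable_cst].
exact: (measurableT_comp measurable_likelihood mt).
Qed.

Lemma normalising_constant_gt0 t : 0 < Z t.
Proof.
exact: (integral_probability_gt0 mu0 (measurable_likelihood1 t) (likelihood_itv t)).1.
Qed.

Lemma normalising_constantE t : (\int[mu0]_x (lik t x)%:E = (Z t)%:E)%E.
Proof.
exact: (integral_probability_gt0 mu0 (measurable_likelihood1 t) (likelihood_itv t)).2.
Qed.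

Lemma likelihood_integrable t A : measurable A -> mu0.-integrable A (EFin \o lik t).
Proof.
move=> mA; apply: (integrableS measurableT) => //; apply/integrableP; split.
  by apply/measurable_EFinP; exact: measurable_likelihood1.
under eq_integral => x _.
  rewrite /= ger0_norm; last by have /andP[/ltW] := likelihood_itv t x.
  over.
by rewrite normalising_constantE ltry.
Qed.

(** The unnormalised posterior mass of [A]. Up to the Gaussian constant it is, as a function of [t],
    the Lebesgue density of the data on the event that [u] lies in [A]. *)
Definition joint_weight (A : set X) (t : Y) : R := \int[mu0]_(x in A) lik t x.

Lemma joint_weightE A t : measurable A ->
  (\int[mu0]_(x in A) (lik t x)%:E = (joint_weight A t)%:E)%E.
Proof.
move=> mA; rewrite /joint_weight /Rintegral fineK//.
by apply: integrable_fin_num => //; exact: likelihood_integrable.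
Qed.

Lemma joint_weightT t : joint_weight setT t = Z t.
Proof. by []. Qed.

Lemma measurable_joint_weight A : measurable A -> measurable_fun setT (joint_weight A).
Proof.
move=> mA; apply/measurable_EFinP.
have -> : EFin \o joint_weight A =
    fubini_G mu0 (fun p : X * Y => (\1_A p.1 * lik p.2 p.1)%:E).
  apply/funext => t; rewrite /fubini_G/= -joint_weightE// integral_mkcond.
  apply: eq_integral => x _; rewrite patchE indicE.
  by case: ifPn => _; rewrite ?mul1r ?mul0r.
apply: measurable_fun_fubini_tonelli_G.
  apply/measurable_EFinP; apply: measurable_funM; last exact: measurable_likelihood.
  by apply: (measurableT_comp _ measurable_fst); exact: measurable_indic.
move=> p /=; rewrite lee_fin mulr_ge0//.
by have /andP[/ltW] := likelihood_itv p.2 p.1.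
Qed.

Definition post_density (t : Y) (x : X) : R := (Z t)^-1 * lik t x.

Lemma post_density_ge0 t x : 0 <= post_density t x.
Proof.
have /andP[/ltW l0 _] := likelihood_itv t x.
by rewrite mulr_ge0// invr_ge0 ltW// normalising_constant_gt0.
Qed.

Lemma measurable_post_density t : measurable_fun setT (post_density t).
Proof. by apply: measurable_funM => //; exact: measurable_likelihood1. Qed.

Lemma integral_post_density t A : measurable A ->
  (\int[mu0]_(x in A) (post_density t x)%:E = ((Z t)^-1 * joint_weight A t)%:E)%E.
Proof.
move=> mA; under eq_integral do rewrite EFinM.
rewrite integralZl//; last exact: likelihood_integrable.
by rewrite joint_weightE// EFinM.
Qed.

(** Since [Z t] is positive for every [t], a measure is chosen separately at each data point;
    measurability in [t] follows afterwards from the formula that determines its values. *)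
Lemma posterior_exists : exists post : Y -> probability X R, forall t A,
  measurable A -> (post t A = \int[mu0]_(x in A) (post_density t x)%:E)%E.
Proof.
have /choice[post postE] t : exists P : probability X R, forall A, measurable A ->
    (P A = \int[mu0]_(x in A) (post_density t x)%:E)%E.
  apply: density_probability.
  - exact: measurable_post_density.
  - exact: post_density_ge0.
  - rewrite integral_post_density// joint_weightT mulVf//.
    by rewrite gt_eqF// normalising_constant_gt0.
by exists post.
Qed.

Context (post : Y -> probability X R).
Context (postE : forall t A, measurable A ->
  (post t A = \int[mu0]_(x in A) (post_density t x)%:E)%E).

Lemma post_joint_weight t A : measurable A ->
  post t A = ((Z t)^-1 * joint_weight A t)%:E.
Proof. by move=> mA; rewrite postE// integral_post_density. Qed.

Lemma post_Radon_Nikodym t : post t `<< mu0 /\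
  ae_eq mu0 setT (density (post t) mu0) (EFin \o post_density t).
Proof.
apply: Radon_Nikodym_density; first exact: measurable_post_density.
by move=> A mA; exact: postE.
Qed.

Lemma measurable_post A : measurable A -> measurable_fun setT (fun t => post t A).
Proof.
move=> mA; rewrite (funext (fun t => post_joint_weight t mA)).
apply/measurable_EFinP; apply: measurable_funM; last exact: measurable_joint_weight.
apply: (measurableT_comp (@measurable_invr R)).
exact: (measurable_joint_weight measurableT).
Qed.

Context (Q0 : probability Y R) (Q0_normal : is_mvnormal Gamma Q0).
Context dO (Omega : measurableType dO) (P : probability Omega R).
Context (u : Omega -> X) (u_meas : measurable_fun setT u).
Context (u_law : forall A, measurable A -> P (u @^-1` A) = mu0 A).
Context (eta : Omega -> Y) (eta_meas : measurable_fun setT eta).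
Context (eta_law : forall B, measurable B -> P (eta @^-1` B) = Q0 B).
Context (indep : independent_rv P u eta).

Local Notation y := (fun w => G (u w) + eta w).

Lemma measurable_observation : measurable_fun setT y.
Proof.
apply/measurable_fun_rVP => i; under eq_fun do rewrite mxE.
have /measurable_fun_rVP m1 := G_meas; have /measurable_fun_rVP m2 := eta_meas.
by apply: measurable_funD; [exact: (measurableT_comp (m1 i) u_meas)|exact: m2].
Qed.

Let c0 : R := (Num.sqrt ((2 * pi) ^+ N * \det Gamma))^-1.

Let c0_ge0 : 0 <= c0. Proof. by rewrite invr_ge0 sqrtr_ge0. Qed.

Lemma mvnormal_pdf_likelihood t x : mvnormal_pdf Gamma (t - G x) = c0 * lik t x.
Proof.
rewrite /mvnormal_pdf [LHS]mulrC /likelihood /potential -[t - G x]opprB wnormN.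
by rewrite [_ ^+ 2 / 2]mulrC.
Qed.

Let shifted_set (A : set X) (B : set Y) : set (X * Y) :=
  [set p | A p.1 /\ B (G p.1 + p.2)].

Let measurable_shifted_set A B : measurable A -> measurable B ->
  measurable (shifted_set A B).
Proof.
move=> mA mB.
have m1 : measurable_fun setT (fun p : X * Y => G p.1 + p.2).
  apply/measurable_fun_rVP => i; under eq_fun do rewrite mxE.
  have /measurable_fun_rVP m1 := G_meas.
  apply: measurable_funD; first exact: (measurableT_comp (m1 i) measurable_fst).
  exact: (measurableT_comp (measurable_coord i) measurable_snd).
rewrite (_ : shifted_set A B = (fst @^-1` A) `&` ((fun p => G p.1 + p.2) @^-1` B))//.
apply: measurableI.
- by rewrite -[X in measurable X]setTI; exact: measurable_fst.
- by rewrite -[X in measurable X]setTI; exact: m1.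
Qed.

Let joint_law (C : set (X * Y)) : measurable C ->
  (mu0 \x Q0)%E C = P ((fun w => (u w, eta w)) @^-1` C).
Proof.
have m2 : measurable_fun setT (fun w => (u w, eta w)) by apply/measurable_fun_pairP; split.
apply: (product_measure_unique (m' := pushforward P (fun w => (u w, eta w)))) => //=.
by move=> A B mA mB; rewrite -u_law// -eta_law//; exact: indep.
Qed.

Let measurable_pdf x : measurable_fun setT (fun t : Y => mvnormal_pdf Gamma (t - G x)).
Proof.
rewrite (funext (fun t => mvnormal_pdf_likelihood t x)).
apply: measurable_funM => //.
have mx : measurable_fun setT (fun t : Y => (x, t)).
  by apply/measurable_fun_pairP; split; [exact: measurable_cst|exact: measurable_id].
exact: (measurableT_comp measurable_likelihood mx).
Qed.

Let translated_normal x B : measurable B ->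
  Q0 ((fun s : Y => G x + s) @^-1` B) = (\int[vol]_(t in B) (c0 * lik t x)%:E)%E.
Proof.
move=> mB.
have mB' : measurable ((fun s : Y => G x + s) @^-1` B).
  rewrite -[X in measurable X]setTI.
  have mt := @measurable_translate R N (G x).
  rewrite (_ : (fun s : Y => G x + s) = (fun s => s + G x)); last first.
    by apply/funext => s; rewrite addrC.
  exact: mt.
rewrite Q0_normal// integral_mkcond [RHS]integral_mkcond.
rewrite -[RHS](ge0_integral_translate (G x)).
- apply: eq_integral => s _; rewrite !patchE.
  rewrite -mvnormal_pdf_likelihood addrK.
  by congr (if _ then _ else _); apply/idP/idP; rewrite !inE /= addrC.
- apply/(measurable_restrictT _ mB); apply/measurable_EFinP.
  apply: measurable_funTS; rewrite -(funext (fun t => mvnormal_pdf_likelihood t x)).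
  exact: measurable_pdf.
- move=> t; rewrite patchE; case: ifP => // _; rewrite lee_fin mulr_ge0//.
  by have /andP[/ltW] := likelihood_itv t x.
Qed.

(** By independence this is the product measure of [shifted_set A B]. Its section over a point [x]
    of [A] is [B] translated by [- G x], whose [Q0]-mass is an integral over [B] itself after
    translation; exchanging the integrals gives the density. *)
Lemma joint_probability A B : measurable A -> measurable B ->
  P (u @^-1` A `&` y @^-1` B) = (\int[vol]_(t in B) (c0 * joint_weight A t)%:E)%E.
Proof.
move=> mA mB.
transitivity ((mu0 \x Q0)%E (shifted_set A B)).
  by rewrite joint_law//; exact: measurable_shifted_set.
pose H (p : X * Y) : \bar R := (\1_A p.1 * (\1_B p.2 * (c0 * lik p.2 p.1)))%:E.
have mH : measurable_fun setT H.
  apply/measurable_EFinP; apply: measurable_funM.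
    by apply: (measurableT_comp _ measurable_fst); exact: measurable_indic.
  apply: measurable_funM.
    by apply: (measurableT_comp _ measurable_snd); exact: measurable_indic.
  by apply: measurable_funM => //; exact: measurable_likelihood.
have H0 p : (0 <= H p)%E.
  rewrite lee_fin !mulr_ge0//; have /andP[/ltW] := likelihood_itv p.2 p.1.
  by [].
transitivity (\int[mu0]_x \int[vol]_t H (x, t))%E.
  rewrite /product_measure1; apply: eq_integral => x _ /=.
  have [xA|xA] := pselect (A x).
    rewrite (_ : xsection _ _ = (fun s : Y => G x + s) @^-1` B); last first.
      by apply/seteqP; split=> s; rewrite /xsection/= inE /shifted_set/=; [case|split].
    rewrite translated_normal// integral_mkcond; apply: eq_integral => t _.
    rewrite patchE /H/= !indicE (mem_set xA) mul1r.
    by case: ifP => _; rewrite ?mul1r ?mul0r.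
  rewrite (_ : xsection _ _ = set0); last first.
    by apply/seteqP; split=> s //; rewrite /xsection/= inE => -[].
  rewrite measure0 integral0_eq// => t _.
  by rewrite /H/= indicE (memNset xA) mul0r.
rewrite fubini_tonelli// [RHS]integral_mkcond; apply: eq_integral => t _.
rewrite patchE; case: ifPn => tB; last first.
  by rewrite integral0_eq// => x _; rewrite /H/= [\1_B t]indicE (negbTE tB) mul0r mulr0.
rewrite EFinM -joint_weightE// -ge0_integralZl//.
- rewrite [RHS]integral_mkcond; apply: eq_integral => x _.
  rewrite patchE /H/= !indicE tB mul1r.
  by case: ifP => _; rewrite ?mul1r ?mul0r// EFinM.
- by apply/measurable_EFinP; apply: measurable_funTS; exact: measurable_likelihood1.
- by move=> x _; rewrite lee_fin; have /andP[/ltW] := likelihood_itv t x.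
Qed.

Let yM : {mfun Omega >-> Y} :=
  HB.pack (y : Omega -> Y) (isMeasurableFun.Build _ _ _ _ _ measurable_observation).

Let law : probability Y R := distribution P yM.

Let lawE B : measurable B -> law B = (\int[vol]_(t in B) (c0 * Z t)%:E)%E.
Proof.
move=> mB; have := joint_probability measurableT mB.
by rewrite preimage_setT setTI.
Qed.

Let integral_law f B : measurable B -> measurable_fun setT f ->
  (forall t, 0 <= f t)%E ->
  (\int[law]_(t in B) f t = \int[P]_(w in y @^-1` B) f (y w))%E.
Proof.
move=> mB mf f0; rewrite /law /distribution ge0_integral_pushforward//.
exact: measurable_funTS.
Qed.

(** The data have Lebesgue density [c0 * Z t], so integrating the posterior against their law
    cancels [(Z t)^-1] and leaves the joint probability. *)
Lemma posterior_conditional : is_conditional_distribution P u y post.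
Proof.
split; first exact: measurable_post.
move=> A B mA mB; rewrite joint_probability//.
have mp := measurable_post mA.
rewrite -(integral_law (f := fun t => post t A))//.
have mg : measurable_fun setT (fun t => (Z t)^-1 * joint_weight A t).
  by have := mp; rewrite (funext (fun t => post_joint_weight t mA)) => /measurable_EFinP.
rewrite [RHS](eq_integral (fun t => ((Z t)^-1 * joint_weight A t)%:E)); last first.
  by move=> t _; exact: post_joint_weight.
rewrite (@integral_density _ _ R law vol (fun t => c0 * Z t)).
- apply: eq_integral => t _; congr EFin.
  by field; rewrite gt_eqF// normalising_constant_gt0.
- by apply: measurable_funM => //; exact: (measurable_joint_weight measurableT).
- exact: lawE.
- exact: mB.
- apply: (@le_integrable _ _ _ law _ mB _ (cst 1%E)).
  + by apply/measurable_EFinP; exact: measurable_funTS.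
  + move=> t _; rewrite -[(EFin \o _) t]/(((Z t)^-1 * joint_weight A t)%:E).
    rewrite -post_joint_weight// gee0_abs// [leRHS]/= normr1.
    exact: probability_le1.
  + by apply: finite_measure_integrable_cst.
- exact: mg.
Qed.

(** For fixed [A], both kernels have the same integral over every [B] against the law of the data,
    so they agree almost everywhere for that law; the null set, which may depend on [A], is pulled
    back along [y]. *)
Lemma posterior_unique post' : is_conditional_distribution P u y post' ->
  forall A, measurable A -> {ae P, forall w, post' (y w) A = post (y w) A}.
Proof.
move=> [mpost' post'E] A mA; have [_ postE'] := posterior_conditional.
have : ae_eq law setT (fun t => post' t A) (fun t => post t A).
  apply: integral_ae_eq => //.
  - apply: (@le_integrable _ _ _ law _ measurableT _ (cst 1%E)).
    + exact: mpost'.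
    + by move=> t _; rewrite gee0_abs// [leRHS]/= normr1; exact: probability_le1.
    + by apply: finite_measure_integrable_cst.
  - exact: measurable_post.
  - move=> B _ mB; rewrite !integral_law//; [|exact: measurable_post|exact: mpost'].
    by rewrite -post'E// -postE'.
move=> [M [mM M0 hM]]; exists (y @^-1` M); split.
- by rewrite -[X in measurable X]setTI; exact: measurable_observation.
- exact: M0.
- by move=> w /= hw; apply: hM => /= h; apply: hw; exact: h.
Qed.

End bayes.

(** * Hellinger distance *)

Lemma gaussian_lipschitz (R : realType) (a b : R) : 0 <= a -> 0 <= b ->
  `|expR (- (a ^+ 2 / 4)) - expR (- (b ^+ 2 / 4))| <= `|a - b|.
Proof.
wlog ab : a b / a <= b => [hw a0 b0|a0 b0].
  have [ab|/ltW ba] := leP a b; first exact: hw.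
  by rewrite distrC [leRHS]distrC; exact: hw.
set p := expR (- (a ^+ 2 / 4)).
have p0 : 0 < p by exact: expR_gt0.
have p1 : p <= 1 by rewrite -expR0 ler_expR oppr_le0 divr_ge0 ?sqr_ge0.
have qp : expR (- (b ^+ 2 / 4)) <= p.
  by rewrite ler_expR lerN2 ler_pM2r// ler_pXn2r.
rewrite ger0_norm ?subr_ge0// distrC ger0_norm ?subr_ge0//.
(* At distance at least 1 the claim is clear, both values lying in (0, 1]. Below it [b <= a + 1], so
   [p * a <= 1] gives [p * (b + a) / 4 <= 3 / 4], the slope that is required. *)
have [ba1|/ltW ba1] := leP 1 (b - a).
  have := expR_gt0 (- (b ^+ 2 / 4)).
  by lra.
have q_ge : p * (1 - (b ^+ 2 - a ^+ 2) / 4) <= expR (- (b ^+ 2 / 4)).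
  rewrite (_ : - (b ^+ 2 / 4) = - (a ^+ 2 / 4) + - ((b ^+ 2 - a ^+ 2) / 4)); last by ring.
  by rewrite expRD -/p ler_pM2l// expR_ge1Dx.
(* From [1 + a^2/4 <= expR (a^2/4)] and [a <= 1 + a^2/4]. *)
have pa1 : p * a <= 1.
  have h := expR_ge1Dx (a ^+ 2 / 4).
  have pe : p * expR (a ^+ 2 / 4) = 1 by rewrite -expRD addNr expR0.
  by have := sqr_ge0 (a - 2); nra.
have : p * ((b ^+ 2 - a ^+ 2) / 4) <= b - a.
  rewrite (_ : p * _ = (b - a) * (p * (b + a) / 4)); last by ring.
  rewrite -[leRHS]mulr1 ler_wpM2l ?subr_ge0//.
  by nra.
by lra.
Qed.

(** Meant for square roots [p / s] of posterior densities, with [s] the root of [Z]. The numerators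
    contribute [w / r]. Since [s + s' >= 2 * r], the roots of [Z] differ by at most [w / r], and
    dividing by [s * s' >= r ^+ 2] gives the cubic term. *)
Lemma normalised_ratio_dist (R : realType) (r s s' p p' w : R) :
  0 < r -> r <= s -> r <= s' -> 0 < p' <= 1 -> `|p - p'| <= w ->
  `|s ^+ 2 - s' ^+ 2| <= 2 * w -> `|p / s - p' / s'| <= (r^-1 + r ^- 3) * w.
Proof.
move=> r0 rs rs' /andP[p'0 p'1] pp ss.
have w0 : 0 <= w by exact: le_trans pp.
have s0 : 0 < s by exact: lt_le_trans rs.
have s'0 : 0 < s' by exact: lt_le_trans rs'.
have ds : `|s - s'| <= w / r.
  rewrite ler_pdivlMr//.
  have : `|s - s'| * (2 * r) <= 2 * w.
    apply: le_trans ss; rewrite subr_sqr normrM ler_wpM2l//.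
    by rewrite ger0_norm; lra.
  by lra.
rewrite (_ : p / s - p' / s' = (p - p') / s + p' * (s' - s) / (s * s')); last first.
  by field; rewrite !gt_eqF.
apply: le_trans (ler_normD _ _) _; rewrite [leRHS]mulrDl; apply: lerD.
  rewrite normrM mulrC; apply: ler_pM => //.
  by rewrite gtr0_norm ?invr_gt0// lef_pV2.
rewrite !normrM (gtr0_norm p'0) distrC gtr0_norm ?invr_gt0 ?mulr_gt0//.
rewrite (_ : r ^- 3 * w = 1 * (w / r) * (r * r)^-1); last by field; rewrite gt_eqF.
apply: ler_pM => //.
- by apply: mulr_ge0 => //; exact: ltW.
- by rewrite invr_ge0; apply: mulr_ge0; exact: ltW.
- by apply: ler_pM => //; exact: ltW.
- by rewrite lef_pV2 ?posrE ?mulr_gt0//; apply: ler_pM => //; exact: ltW.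
Qed.

Lemma sqr_sqrt_dist (R : realType) (a b c : R) : 0 < a -> 0 < b -> `|a - b| <= c ->
  `|Num.sqrt a ^+ 2 - Num.sqrt b ^+ 2| <= c.
Proof. by move=> /ltW a0 /ltW b0; rewrite !sqr_sqrtr. Qed.

Section hellinger_distance.
Context (R : realType) (N : nat) (Gamma : 'M[R]_N) (psdV : psd (invmx Gamma)).
Local Notation Y := 'rV[R]_N.
Context dX (X : measurableType dX) (mu0 : probability X R).
Context (G : X -> Y) (G_meas : measurable_fun setT G).
Local Notation lik := (likelihood Gamma G).
Local Notation Z := (normalising_constant mu0 Gamma G).
Local Notation wn := (wnorm Gamma).
Local Notation post_dens := (post_density Gamma mu0 G).

Let root_lik (t : Y) (x : X) : R := expR (- (wn (G x - t) ^+ 2 / 4)).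

Let Z_gt0 t : 0 < Z t.
Proof. exact: normalising_constant_gt0. Qed.

Let root_lik_sqr t x : root_lik t x ^+ 2 = lik t x.
Proof.
rewrite expr2 -expRD /likelihood /potential; congr expR.
by field.
Qed.

Let root_lik_itv t x : 0 < root_lik t x <= 1.
Proof.
by rewrite expR_gt0 /= -expR0 ler_expR oppr_le0 divr_ge0 ?sqr_ge0.
Qed.

Let root_lik_lipschitz t t' x : `|root_lik t x - root_lik t' x| <= wn (t - t').
Proof.
apply: le_trans (gaussian_lipschitz (wnorm_ge0 _ _) (wnorm_ge0 _ _)) _.
apply: le_trans (wnorm_dist psdV _ _) _.
have -> : G x - t - (G x - t') = - (t - t') by rewrite !opprB addrC addrA subrK.
by rewrite wnormN.
Qed.

Lemma normalising_constant_lipschitz t t' : `|Z t - Z t'| <= 2 * wn (t - t').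
Proof.
have il s : mu0.-integrable setT (EFin \o lik s) by exact: likelihood_integrable.
rewrite /normalising_constant -RintegralB//; [|exact: il..].
have iB := integrableB measurableT (il t) (il t').
apply: le_trans (le_normr_Rintegral measurableT iB) _.
have -> : 2 * wn (t - t') = \int[mu0]_x (2 * wn (t - t')).
  by rewrite Rintegral_probability_cst.
apply: le_Rintegral => //.
- exact: integrable_norm iB.
- exact: finite_measure_integrable_cst.
move=> x _; rewrite -!root_lik_sqr subr_sqr normrM mulrC ler_pM//.
  have /andP[h1 h2] := root_lik_itv t x; have /andP[h3 h4] := root_lik_itv t' x.
  by rewrite ger0_norm; lra.
Qed.

Lemma normalising_constant_bound (rho : R) : 0 < rho ->
  exists2 m : R, 0 < m & forall t, wn t < rho -> m <= Z t.
Proof.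
move=> rho0; pose f x := expR (- (wn (G x) ^+ 2 + rho ^+ 2)).
have mf : measurable_fun setT f.
  apply: measurableT_comp => //; apply: measurableT_comp => //.
  apply: measurable_funD => //; apply: measurable_funX.
  exact: (measurableT_comp (@measurable_wnorm R N Gamma)).
have f01 x : 0 < f x <= 1.
  by rewrite expR_gt0 /= -expR0 ler_expR oppr_le0 addr_ge0 ?sqr_ge0.
have [m0 mE] := integral_probability_gt0 mu0 mf f01.
exists (\int[mu0]_x f x) => // t t_rho; apply: le_Rintegral => //.
- apply/integrableP; split; first exact/measurable_EFinP.
  under eq_integral => x _.
    rewrite /= ger0_norm; last by have /andP[/ltW] := f01 x.
    over.
  by rewrite mE ltry.
- exact: likelihood_integrable.
move=> x _; rewrite ler_expR lerN2 /potential.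
have h := wnormD psdV (G x) (- t); rewrite wnormN in h.
have h0 := wnorm_ge0 Gamma (G x - t); have h1 := wnorm_ge0 Gamma (G x).
have h2 := wnorm_ge0 Gamma t.
have h3 : wn (G x - t) <= wn (G x) + rho by lra.
have h4 : wn (G x - t) ^+ 2 <= (wn (G x) + rho) ^+ 2.
  by rewrite ler_pXn2r// nnegrE; lra.
by have := sqr_ge0 (wn (G x) - rho); nra.
Qed.

Context (post : Y -> probability X R).
Context (postE : forall t A, measurable A ->
  (post t A = \int[mu0]_(x in A) (post_dens t x)%:E)%E).

Let sqrt_post_density t x :
  Num.sqrt (post_dens t x) = root_lik t x / Num.sqrt (Z t).
Proof.
have Z0 := Z_gt0 t.
rewrite /post_density sqrtrM ?invr_ge0 ?ltW// sqrtrV ?ltW// -root_lik_sqr.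
by rewrite sqrtr_sqr ger0_norm 1?mulrC// ltW// expR_gt0.
Qed.

Lemma hellinger_lipschitz (rho : R) : 0 < rho -> exists2 C : R, 0 < C &
  forall t t', Num.max (wn t) (wn t') < rho ->
    hellinger mu0 (post t) (post t') <= C * wn (t - t').
Proof.
move=> rho0; have [m m0 mZ] := normalising_constant_bound rho0.
pose r := Num.sqrt m.
have r0 : 0 < r by rewrite sqrtr_gt0.
pose C := r^-1 + r ^- 3.
have C0 : 0 < C by rewrite addr_gt0// invr_gt0// exprn_gt0.
exists C => // t t'; rewrite gt_max => /andP[t_rho t'_rho].
have w0 := wnorm_ge0 Gamma (t - t').
have Zr s : wn s < rho -> r <= Num.sqrt (Z s).
  by move=> /mZ mZs; rewrite ler_sqrt// (le_trans (ltW m0)).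
have pw x : `|Num.sqrt (post_dens t x) - Num.sqrt (post_dens t' x)| <= C * wn (t - t').
  rewrite (sqrt_post_density t) (sqrt_post_density t').
  apply: (normalised_ratio_dist r0 (Zr _ t_rho) (Zr _ t'_rho) (root_lik_itv t' x)
    (root_lik_lipschitz t t' x)).
  exact: (sqr_sqrt_dist (Z_gt0 t) (Z_gt0 t') (normalising_constant_lipschitz t t')).
have [num mun] := post_Radon_Nikodym G_meas postE t.
have [num' mun'] := post_Radon_Nikodym G_meas postE t'.
pose q x := (Num.sqrt (post_dens t x) - Num.sqrt (post_dens t' x)) ^+ 2.
have mq : measurable_fun setT q.
  apply: measurable_funX; apply: measurable_funB;
  apply: (measurableT_comp (continuous_measurable_fun (@sqrt_continuous R)));
  exact: measurable_post_density.
have q_le x : q x <= (C * wn (t - t')) ^+ 2.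
  rewrite /q -real_normK ?num_real// ler_pXn2r ?nnegrE//.
  by rewrite mulr_ge0// ltW.
(* [density] is known only almost everywhere, which suffices to exchange it for the explicit density
   under the integral. *)
have -> : hellinger mu0 (post t) (post t') = Num.sqrt (2^-1 * \int[mu0]_x q x).
  congr (Num.sqrt (_ * fine _)); apply: ae_eq_integral => //.
  - apply/measurable_EFinP; apply: measurable_funX; apply: measurable_funB;
    apply: (measurableT_comp (continuous_measurable_fun (@sqrt_continuous R)));
    apply: measurableT_comp => //; apply: measurable_int; exact: Radon_Nikodym_integrable.
  - exact/measurable_EFinP.
  - move: mun mun'; apply: filterS2 => x /(_ Logic.I) h /(_ Logic.I) h' _.
    by rewrite h h'.
have Iq : \int[mu0]_x q x <= (C * wn (t - t')) ^+ 2.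
  have -> : (C * wn (t - t')) ^+ 2 = \int[mu0]_x ((C * wn (t - t')) ^+ 2).
    by rewrite Rintegral_probability_cst.
  apply: le_Rintegral => //; last exact: finite_measure_integrable_cst.
  apply: (@le_integrable _ _ _ mu0 _ measurableT _ (cst ((C * wn (t - t')) ^+ 2)%:E)).
  - exact/measurable_EFinP.
  - move=> x _ /=; rewrite lee_fin ger0_norm ?sqr_ge0// ger0_norm ?sqr_ge0//.
  - exact: finite_measure_integrable_cst.
have Iq0 : 0 <= \int[mu0]_x q x by apply: Rintegral_ge0 => x _; exact: sqr_ge0.
(* The bound is written as the root of its square, so squares are compared, and the factor 1/2 is
   given away. *)
rewrite -[leRHS]ger0_norm; last by rewrite mulr_ge0// ltW.
rewrite -sqrtr_sqr ler_sqrt ?sqr_ge0//.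
by lra.
Qed.

End hellinger_distance.

(** * The three priors together, and the posterior *)

Lemma forward_map_prior_measurable (R : realType) (n L J : nat) (D : set 'rV[R]_n.+1)
  (S : {measure set 'rV[R]_n.+1 -> \bar R}) (e : 'I_L -> set 'rV[R]_n.+1)
  (z : 'I_L -> R) (zplus : R) (I : 'I_J -> 'rV[R]_L)
  (dX : measure_display) (X : measurableType dX) (F : X -> 'rV[R]_n.+1 -> R)
  (mu0 : probability X R) :
  open D -> bounded_set D -> (forall l, measurable (e l)) ->
  (forall l, e l `<=` boundary D) -> (forall l, 0 < z l <= zplus) ->
  star_norm_equivalent D S e -> cem_wellposed D S e z ->
  (forall j, zero_mean (I j)) -> eit_prior D F mu0 ->
  measurable_fun setT (forward_map D S e z F I).
Proof.
move=> oD bD me eb zb norms wp I0 prior.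
case: prior => [mu m0 C _ _|D0 theta0 phi0 up um s0 t0 mu _ ht hp up0 um0 _ _
  |k c f mu m0 C c0 ck clt f0 _ _]; apply: forward_map_measurable => j l.
- exact: (log_gaussian_measurable oD bD me eb zb norms wp (I0 j)).
- exact: (star_measurable oD bD me eb zb norms wp (I0 j) ht hp up0 um0).
- exact: (level_set_measurable oD bD me eb zb norms wp (I0 j) c0 ck clt f0).
Qed.

Theorem theorem3p8 (R : realType)
  (n : nat) (hn : (n.+1 <= 3)%N)
  (D : set 'rV[R]_n.+1) (D_open : open D) (D_bounded : bounded_set D)
  (D_smooth : smooth_boundary D)
  (S : {measure set 'rV[R]_n.+1 -> \bar R}) (S_surface : is_surface_measure D S)
  (L : nat) (e : 'I_L -> set 'rV[R]_n.+1)
  (e_meas : forall l, measurable (e l))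
  (e_boundary : forall l, e l `<=` boundary D)
  (z : 'I_L -> R) (zminus zplus : R) (zminus_gt0 : 0 < zminus)
  (z_bound : forall l, zminus <= z l <= zplus)
  (norms : star_norm_equivalent D S e) (wellposed : cem_wellposed D S e z)
  (J : nat) (I : 'I_J -> 'rV[R]_L) (I_mean : forall j, zero_mean (I j))
  (Gamma0 : 'M[R]_L) (Gamma0_cov : covariance_matrix Gamma0)
  (Q0 : probability 'rV[R]_(\sum_(j < J) L) R)
  (Q0_normal : is_mvnormal (\mxdiag_(j < J) Gamma0) Q0)
  (dX : measure_display) (X : measurableType dX) (F : X -> 'rV[R]_n.+1 -> R)
  (mu0 : probability X R) (prior : eit_prior D F mu0)
  (dO : measure_display) (Omega : measurableType dO) (P : probability Omega R)
  (u : Omega -> X) (u_meas : measurable_fun setT u)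
  (u_law : forall A, measurable A -> P (u @^-1` A) = mu0 A)
  (eta : Omega -> 'rV[R]_(\sum_(j < J) L)) (eta_meas : measurable_fun setT eta)
  (eta_law : forall B, measurable B -> P (eta @^-1` B) = Q0 B)
  (indep : independent_rv P u eta) :
  let Gamma := \mxdiag_(j < J) Gamma0 in
  let G := forward_map D S e z F I in
  let Z := normalising_constant mu0 Gamma G in
  let y := fun w => G (u w) + eta w in
  measurable_fun setT y /\
  exists post : 'rV[R]_(\sum_(j < J) L) -> probability X R,
    [/\ is_conditional_distribution P u y post /\
          (forall post', is_conditional_distribution P u y post' ->
            forall A, measurable A ->
            {ae P, forall w, post' (y w) A = post (y w) A}),
        forall t, post t `<< mu0 /\
          ae_eq mu0 setT (density (post t) mu0)
            (fun x => ((Z t)^-1 * expR (- potential Gamma G x t))%:E),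
        {ae Q0, forall t, 0 < Z t} &
        forall rho : R, 0 < rho -> exists2 C : R, 0 < C &
          forall t t', Num.max (wnorm Gamma t) (wnorm Gamma t') < rho ->
            hellinger mu0 (post t) (post t') <= C * wnorm Gamma (t - t')].
Proof.
move=> Gamma G Z y.
have psdV : psd (invmx Gamma).
  by apply: psd_invmx; apply: psd_mxdiag; exact: covariance_psd.
have G_meas : measurable_fun setT G.
  have z_pos l : 0 < z l <= zplus.
    have /andP[zl zz] := z_bound l.
    by apply/andP; split; first exact: (lt_le_trans zminus_gt0 zl).
  exact: (forward_map_prior_measurable D_open D_bounded e_meas e_boundary z_pos norms
    wellposed I_mean prior).
have [post postE] := posterior_exists Gamma mu0 G_meas.
split; first exact: measurable_observation.
exists post; split.
- split; first exact: (posterior_conditional G_meas postE Q0_normal u_meas u_law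
    eta_meas eta_law indep).
  exact: (posterior_unique G_meas postE Q0_normal u_meas u_law eta_meas eta_law
    indep).
- by move=> t; exact: (post_Radon_Nikodym G_meas postE).
- by apply/aeW => t; exact: normalising_constant_gt0.
- exact: (hellinger_lipschitz psdV G_meas postE).
Qed.
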